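(* Let $\Gamma$ be a metric graph, $K$ a finite group acting isometrically on $\Gamma$ and $D$ a $K$-invariant effective divisor on $\Gamma$. Then the set $R(D)^K$ of all $K$-invariant rational functions in $R(D)$ is a tropical semimodule over $\boldsymbol{T}$ and is finitely generated.
   Context: Metric graph: the underlying ($\infty$-)metric space of an edge-weighted graph $(G,l)$, where $G$ is a finite connected nonempty multigraph (loops allowed) and $l:E(G)\to\mathbb{R}_{>0}\cup\{\infty\}$ may take the value $\infty$ only on leaf edges (edges adjacent to a vertex of valence one). Each edge $e$ is identified with $[0,l(e)]$; if $l(e)=\infty$ the leaf end of $e$ is identified with $\infty$ and is called a point at infinity. A divisor on $\Gamma$ is an element $D=\sum D(x)\cdot x$ of the free abelian group on the points of $\Gamma$; it is effective ($D\ge0$) if all $D(x)\ge 0$, and $K$-invariant if $D(\sigma(x))=D(x)$ for all $\sigma\in K$, $x\in\Gamma$. A rational function on $\Gamma$ is the constant function $-\infty$, or a piecewise linear function with integer slopes and finitely many pieces, taking values $\pm\infty$ only at points at infinity. For $f\not\equiv-\infty$, $\mathrm{ord}_x(f)$ is the sum of the outgoing slopes of $f$ at $x$ (at a point at infinity where $f$ is infinite, the outgoing slope from there on a small neighborhood; $0$ if $\Gamma$ is a singleton), and $\mathrm{div}(f)=\sum_x \mathrm{ord}_x(f)\cdot x$. $R(D)=\{f\not\equiv-\infty : D+\mathrm{div}(f)\ge 0\}\cup\{-\infty\}$. A function $f$ is $K$-invariant if $f\circ\sigma=f$ for all $\sigma\in K$. Tropical semifield: $\boldsymbol{T}=\mathbb{R}\cup\{-\infty\}$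 with $a\oplus b=\max\{a,b\}$, $a\odot b=a+b$. $R(D)$ carries pointwise tropical sum and tropical scalar multiplication by $\boldsymbol{T}$. A tropical semimodule over $\boldsymbol{T}$ is defined like a module over a ring; it is finitely generated if there are finitely many elements $f_1,\dots,f_n$ such that each element is $\bigoplus_i a_i\odot f_i$ with $a_i\in\boldsymbol{T}$.
   Formalization: ''Acting isometrically'' here also requires each group element to act continuously at points at infinity; with the ∞-metric alone, swapping the two ends of [-∞,∞] and fixing all finite points is allowed, and then R(D)^K for D the sum of the ends is not finitely generated. *)

(* Defs.v *)
From HB Require Import structures.
From mathcomp Require Import all_boot all_order all_algebra all_fingroup finmap.
From mathcomp Require Import all_classical all_reals ereal topology normedtype.
From mathcomp Require Import lra.

Set Implicit Arguments.
Unset Strict Implicit.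
Unset Printing Implicit Defensive.

Import Order.TTheory GRing.Theory Num.Theory.
Local Open Scope classical_set_scope.
Local Open Scope ring_scope.

(* A finite connected nonempty multigraph with loops and with edge lengths in
   ]0, +oo].  The edge e is identified with [0, len e], running from src e to
   tgt e.  The orientation is auxiliary; it is chosen so that the end of an
   infinite edge that is sent to +oo is always tgt e. *)
Record wgraph (R : realType) := WGraph {
  vertex : finType;
  edge : finType;
  src : edge -> vertex;
  tgt : edge -> vertex;
  len : edge -> \bar R;
  valence := fun v : vertex =>
    (#|[set e | src e == v]%SET| + #|[set e | tgt e == v]%SET|)%N;
  adjacent := fun u v : vertex =>
    [exists e, (src e == u) && (tgt e == v) || (src e == v) && (tgt e == u)];
  vertex_gt0 : (0 < #|vertex|)%N;
  connectedG : forall u v : vertex, connect adjacent u v;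
  len_gt0 : forall e, (0 < len e)%E;
  len_leaf : forall e, len e = +oo%E -> valence (tgt e) = 1%N
}.

(* The points: the vertices, and the pairs (e, t) with 0 < t < len e. *)
Definition mgraph (R : realType) (G : wgraph R) : Type :=
  (vertex G + {p : edge G * R | (0 < p.2%:E < len p.1)%E})%type.

HB.instance Definition _ (R : realType) (G : wgraph R) :=
  Choice.copy (mgraph G)
    (vertex G + {p : edge G * R | (0 < p.2%:E < len p.1)%E})%type.

Section MetricGraph.
Variables (R : realType) (G : wgraph R).

(* The parametrization [0, len e] -> mgraph G of the edge e; arguments outside
   [0, len e] are sent to the nearest end. *)
Definition edge_pt (e : edge G) (t : \bar R) : mgraph G :=
  match insub (e, fine t) with
  | Some p => inr p
  | None => inl (if (t <= 0)%E then src e else tgt e)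
  end.

Definition at_infinity (x : mgraph G) : Prop :=
  exists e : edge G, len e = +oo%E /\ x = inl (tgt e).

Definition seg_len (s t : \bar R) : \bar R :=
  if s == t then 0%E else `|s - t|%E.

(* A chain is a sequence of segments ((e, s), t) on the edges e, each starting
   where the previous one ends. *)
Fixpoint is_chain (x : mgraph G) (c : seq (edge G * \bar R * \bar R))
    (y : mgraph G) : Prop :=
  match c with
  | [::] => x = y
  | (e, s, t) :: c' =>
      [/\ (0 <= s <= len e)%E, (0 <= t <= len e)%E,
          x = edge_pt e s & is_chain (edge_pt e t) c' y]
  end.

Definition dist (x y : mgraph G) : \bar R :=
  ereal_inf [set (\sum_(q <- c) seg_len q.1.2 q.2)%E
            | c in [set c | is_chain x c y]].

(* Quotient topology of the disjoint union of the segments [0, len e] (closed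
   intervals of \bar R) and of the vertices. *)
Definition mgraph_open (U : set (mgraph G)) : Prop :=
  forall (e : edge G) (t : \bar R), (0 <= t <= len e)%E -> U (edge_pt e t) ->
    \forall s \near t, (0 <= s <= len e)%E -> U (edge_pt e s).

Lemma mgraph_openT : mgraph_open setT.
Proof. by move=> e t _ _; near=> s. Unshelve. all: by end_near. Qed.

Lemma mgraph_openI : setI_closed mgraph_open.
Proof.
move=> A B oA oB e t te [At Bt].
have nA := oA e t te At; have nB := oB e t te Bt.
near=> s; move=> se; split.
- by move: se; near: s; exact: nA.
- by move: se; near: s; exact: nB.
Unshelve. all: by end_near. Qed.

Lemma mgraph_open_bigcup (I : Type) (f : I -> set (mgraph G)) :
  (forall i, mgraph_open (f i)) -> mgraph_open (\bigcup_i f i).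
Proof.
move=> of_ e t te [i _ fit]; have n := of_ i e t te fit.
near=> s; move=> se; exists i => //.
by move: se; near: s; exact: n.
Unshelve. all: by end_near. Qed.

HB.instance Definition _ := isOpenTopological.Build (mgraph G)
  mgraph_openT mgraph_openI mgraph_open_bigcup.

(* dist alone does not see the topology at the points at infinity, which are at
   distance +oo from all other points; hence the continuity requirement. *)
Definition isometric (sigma : mgraph G -> mgraph G) : Prop :=
  continuous sigma /\ forall x y, dist (sigma x) (sigma y) = dist x y.

(* The free abelian group on the points, as finitely supported functions. *)
Definition divisor := {fsfun mgraph G -> int with 0}.

Definition effective (D : mgraph G -> int) : Prop := forall x, 0 <= D x.

Definition fct := mgraph G -> \bar R.

(* In \bar R, 0 * +oo = 0, so the affine formula below also forces f to be
   continuous, with the right value, at the point +oo of an infinite edge. *)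
Definition affine_on (f : fct) (e : edge G) (s t : \bar R) : Prop :=
  exists (a : R) (m : int), forall u : \bar R, (s <= u <= t)%E ->
    f (edge_pt e u) = (a%:E + (m%:~R)%:E * u)%E.

Definition piecewise_linear (f : fct) : Prop :=
  forall e : edge G, exists ts : seq (\bar R),
    [/\ path <%O 0%E ts, last 0%E ts = len e &
        forall i, (i < size ts)%N ->
          affine_on f e (nth 0%E (0%E :: ts) i) (nth 0%E ts i)].

Definition rational_fct (f : fct) : Prop :=
  f = cst -oo%E \/
  (piecewise_linear f /\ forall x, ~ at_infinity x -> f x \is a fin_num).

(* Outgoing slopes at the point edge_pt e t in the two directions of e.  At the
   point +oo of an infinite edge, slopeL is the outgoing slope of f near +oo;
   it is 0 when f is finite there. *)
Definition slopeR (f : fct) (e : edge G) (t : \bar R) : int :=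
  xget 0 [set m : int | exists (a : R) (u : \bar R), (t < u)%E /\
    forall s : R, (t < s%:E < u)%E ->
      f (edge_pt e s%:E) = (a + m%:~R * s)%:E].

Definition slopeL (f : fct) (e : edge G) (t : \bar R) : int :=
  xget 0 [set m : int | exists (a : R) (u : \bar R), (u < t)%E /\
    forall s : R, (u < s%:E < t)%E ->
      f (edge_pt e s%:E) = (a - m%:~R * s)%:E].

(* A loop at v contributes both of its ends. *)
Definition ord_at (f : fct) (x : mgraph G) : int :=
  match x with
  | inl v => \sum_(e | src e == v) slopeR f e 0%E
             + \sum_(e | tgt e == v) slopeL f e (len e)
  | inr p => let: (e, t) := val p in slopeR f e t%:E + slopeL f e t%:E
  end.

(* div(f), through its coefficients; divf_finite below shows that finitely many
   of them are nonzero. *)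
Definition divf (f : fct) : mgraph G -> int := fun x => ord_at f x.

Definition Rspace (D : divisor) : set fct :=
  [set f | rational_fct f /\ f <> cst -oo%E /\
           effective (fun x => D x + divf f x)] `|` [set cst -oo%E].

End MetricGraph.

Section DivFinite.
Variables (R : realType) (G : wgraph R).
Implicit Types (f : fct G) (e : edge G) (t : \bar R).

Lemma slopeR_unique f e t (m : int) (a : R) (u : \bar R) :
  (t < u)%E -> t \is a fin_num ->
  (forall s : R, (t < s%:E < u)%E -> f (edge_pt e s%:E) = (a + m%:~R * s)%:E) ->
  slopeR f e t = m.
Proof.
case: t => [t| |] // tu _ fu; rewrite /slopeR.
case: xgetP => [m' _ [a' [u' [tu' fu']]]|/(_ m) []]; last by exists a, u.
have [c [tc cu cu']] : exists c : R, [/\ t < c, (c%:E <= u)%E & (c%:E <= u')%E].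
  case: u u' tu tu' {fu fu'} => [u| |] [u'| |] //=; rewrite ?lte_fin => tu tu'.
  - by exists (Num.min u u'); rewrite lt_min tu tu' !lee_fin !ge_min !lexx orbT.
  - by exists u; rewrite tu lexx leey.
  - by exists u'; rewrite tu' lexx leey.
  - by exists (t + 1); rewrite ltrDl ltr01 !leey.
pose s1 := (t + c) / 2; pose s2 := (t + s1) / 2.
have ts1 : t < s1 by rewrite midf_lt.
have s1c : s1 < c by rewrite midf_lt.
have ts2 : t < s2 by rewrite midf_lt.
have s21 : s2 < s1 by rewrite midf_lt.
have key s : t < s -> s < c -> a' + m'%:~R * s = a + m%:~R * s.
  move=> h1 h2; have h3 : (s%:E < c%:E)%E by rewrite lte_fin.
  apply: EFin_inj; rewrite -fu' ?fu // lte_fin h1 /=; exact: lt_le_trans h3 _.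
have k1 := key _ ts1 s1c; have k2 := key _ ts2 (lt_trans s21 s1c).
have : (m'%:~R - m%:~R) * (s1 - s2) = 0 :> R.
  rewrite mulrBr !mulrBl; apply/eqP.
  have -> : m'%:~R * s1 = a + m%:~R * s1 - a' by rewrite -k1 addrC addKr.
  have -> : m'%:~R * s2 = a + m%:~R * s2 - a' by rewrite -k2 addrC addKr.
  by apply/eqP; lra.
move/eqP; rewrite mulf_eq0 => /orP[|]; rewrite subr_eq0.
  by rewrite eqr_int => /eqP.
by move=> /eqP e12; rewrite e12 ltxx in s21.
Qed.
Lemma slopeL_unique f e t (m : int) (a : R) (u : \bar R) :
  (u < t)%E -> (0 <= u)%E ->
  (forall s : R, (u < s%:E < t)%E -> f (edge_pt e s%:E) = (a - m%:~R * s)%:E) ->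
  slopeL f e t = m.
Proof.
move=> tu u0 fu; rewrite /slopeL.
case: xgetP => [m' _ [a' [u' [tu' fu']]]|/(_ m) []]; last by exists a, u.
have [c [d [cd cu du cu']]] : exists c d : R, [/\ c < d, (u <= c%:E)%E, (d%:E <= t)%E & (u' <= c%:E)%E].
  case: t tu tu' {fu fu'} => [t| |]; last by rewrite ltNge leNye.
  - case: u u0 => [u| |] // u0 tu; case: u' => [u'| |] // tu'.
    + by exists (Num.max u u'), t; move: tu tu'; rewrite !lte_fin gt_max !lee_fin !le_max !lexx orbT => -> ->.
    + by exists u, t; rewrite leNye !lexx -lte_fin.
  - case: u u0 => [u| |] // u0 tu; case: u' => [u'| |] // tu'.
    + by exists (Num.max u u'), (Num.max u u' + 1); rewrite ltrDl ltr01 !leey !lee_fin !le_max !lexx orbT.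
    + by exists u, (u + 1); rewrite ltrDl ltr01 !leey !lexx leNye.
pose s1 := (c + d) / 2; pose s2 := (c + s1) / 2.
have ts1 : c < s1 by rewrite midf_lt.
have s1c : s1 < d by rewrite midf_lt.
have ts2 : c < s2 by rewrite midf_lt.
have s21 : s2 < s1 by rewrite midf_lt.
have key s : c < s -> s < d -> a' - m'%:~R * s = a - m%:~R * s.
  move=> h1 h2; have h3 : (s%:E < d%:E)%E by rewrite lte_fin.
  have h4 : (c%:E < s%:E)%E by rewrite lte_fin.
  have i1 : (u < s%:E < t)%E by rewrite (le_lt_trans cu h4) (lt_le_trans h3 du).
  have i2 : (u' < s%:E < t)%E by rewrite (le_lt_trans cu' h4) (lt_le_trans h3 du).
  by apply: EFin_inj; rewrite -fu' // fu.
have k1 := key _ ts1 s1c; have k2 := key _ ts2 (lt_trans s21 s1c).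
have : (m'%:~R - m%:~R) * (s1 - s2) = 0 :> R by rewrite mulrBr !mulrBl; lra.
move/eqP; rewrite mulf_eq0 => /orP[|]; rewrite subr_eq0.
  by rewrite eqr_int => /eqP.
by move=> /eqP e12; rewrite e12 ltxx in s21.
Qed.

Lemma path_gap (ts : seq (\bar R)) t z : path <%O z ts -> (z < t)%E -> (t < last z ts)%E ->
  t \notin ts -> exists2 i, (i < size ts)%N & (nth 0%E (z :: ts) i < t < nth 0%E ts i)%E.
Proof.
elim: ts z => [|b ts IH] z /=; first by move=> _ h1 h2; move: (lt_trans h1 h2); rewrite ltxx.
move=> /andP[zb p] zt tl; rewrite inE negb_or => /andP[tb nt].
have [tb'|bt] := ltP t b; first by exists 0%N => //=; rewrite zt.
have bt' : (b < t)%E by rewrite lt_neqAle eq_sym tb.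
by have [i si h] := IH b p bt' tl nt; exists i.+1.
Qed.

Lemma divf_finite f : piecewise_linear f -> finite_set [set x | divf f x != 0].
Proof.
move=> pl; have [ts h] := choice pl.
apply: (@sub_finite_set _ _ ([set inl v | v in [set: vertex G]] `|`
   \bigcup_(e in [set: edge G]) (edge_pt e @` [set` ts e]))); last first.
  rewrite finite_setU; split; first by apply: finite_image; exact: finite_finset.
  apply: bigcup_finite; first exact: finite_finset.
  by move=> e _; apply: finite_image; exact: finite_seq.
case=> [v|p]; first by move=> _; left; exists v.
rewrite /divf /ord_at /=; case Ep : (val p) => [e t] nz; right; exists e => //.
have pE : edge_pt e t%:E = inr p by rewrite /edge_pt /= -Ep valK.
exists t%:E => //=; apply/negPn/negP => nt.
have := valP p; rewrite /= in Ep *; rewrite Ep /= => /andP[t0 tl].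
have [pth lst aff] := h e.
rewrite -lst in tl.
have [i si /andP[h1 h2]] := path_gap pth t0 tl nt.
have [a [m fm]] := aff i si.
have g0 : (0 <= nth 0%E (0%E :: ts e) i)%E.
  move: pth; rewrite lt_path_sortedE => /andP[/allP al _].
  case: i si {h1 h2 fm} => [|i] si /=; first by [].
  by apply/ltW/al/mem_nth/ltnW.
move: nz; rewrite (slopeR_unique (m:=m) (a:=a) h2) //; last first.
  move=> s /andP[ts1 ts2]; rewrite fm ?(ltW ts2) ?andbT //.
  exact/ltW/(lt_trans h1).
rewrite (slopeL_unique (m:=-m) (a:=a) h1) ?subrr ?eqxx //.
move=> s /andP[ts1 ts2]; rewrite fm ?(ltW ts1) //=; last exact/ltW/(lt_trans ts2).
by rewrite mulrNz mulNr opprK.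
Qed.

End DivFinite.

(* The tropical semifield R \cup {-oo}: addition is max, multiplication is +. *)
Definition tropical (R : realType) : Type := {t : \bar R | t != +oo%E}.

HB.instance Definition _ (R : realType) := Choice.on (tropical R).

Section Tropical.
Variable R : realType.
Implicit Types a b c : tropical R.

Fact trop_zero_subproof : (-oo : \bar R)%E != +oo%E. Proof. by []. Qed.
Fact trop_one_subproof : (0 : \bar R)%E != +oo%E. Proof. by []. Qed.
Fact trop_add_subproof a b : Order.max (val a) (val b) != +oo%E.
Proof. by rewrite maxEle; case: ifP => _; [exact: (svalP b)|exact: (svalP a)]. Qed.
Fact trop_mul_subproof a b : (val a + val b)%E != +oo%E.
Proof. by case: a b => [[a| |] //= _] [[b| |] //= _]. Qed.

Definition Trop (t : \bar R) (ht : t != +oo%E) : tropical R := exist _ t ht.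

Definition trop_zero : tropical R := Trop trop_zero_subproof.
Definition trop_one : tropical R := Trop trop_one_subproof.
Definition trop_add a b : tropical R := Trop (trop_add_subproof a b).
Definition trop_mul a b : tropical R := Trop (trop_mul_subproof a b).

Lemma trop_addA : associative trop_add.
Proof. by move=> a b c; apply: val_inj; rewrite /= maxA. Qed.
Lemma trop_addC : commutative trop_add.
Proof. by move=> a b; apply: val_inj; rewrite /= maxC. Qed.
Lemma trop_add0 : left_id trop_zero trop_add.
Proof. by move=> a; apply: val_inj; rewrite /= maxNye. Qed.

HB.instance Definition _ :=
  GRing.isNmodule.Build (tropical R) trop_addA trop_addC trop_add0.

Lemma trop_mulA : associative trop_mul.
Proof. by move=> a b c; apply: val_inj; rewrite /= addeA. Qed.
Lemma trop_mulC : commutative trop_mul.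
Proof. by move=> a b; apply: val_inj; rewrite /= addeC. Qed.
Lemma trop_mul1 : left_id trop_one trop_mul.
Proof. by move=> a; apply: val_inj; rewrite /= add0e. Qed.

Lemma adde_max_trop (x y z : \bar R) :
  (x + Order.max y z)%E = Order.max (x + y)%E (x + z)%E.
Proof.
have [yz|/ltW zy] := leP y z.
- by rewrite max_r // leeD2l.
- by rewrite max_l // leeD2l.
Qed.

Lemma trop_mulDl : left_distributive trop_mul trop_add.
Proof.
move=> a b c; apply: val_inj => /=.
by rewrite addeC adde_max_trop ![(val c + _)%E]addeC.
Qed.
Lemma trop_mul0 : left_zero trop_zero trop_mul.
Proof. by move=> a; apply: val_inj; rewrite /= addNye. Qed.
Lemma trop_1neq0 : trop_one != trop_zero. Proof. by []. Qed.

HB.instance Definition _ := GRing.Nmodule_isComNzSemiRing.Build (tropical R)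
  trop_mulA trop_mulC trop_mul1 trop_mulDl trop_mul0 trop_1neq0.

Variable G : wgraph R.

HB.instance Definition _ := gen_eqMixin (fct G).
HB.instance Definition _ := gen_choiceMixin (fct G).

Definition fct_add (f g : fct G) : fct G := fun x => Order.max (f x) (g x).
Definition fct_scale a (f : fct G) : fct G := fun x => (val a + f x)%E.
Definition fct_zero : fct G := cst -oo%E.

Lemma fct_addA : associative fct_add.
Proof. by move=> f g h; apply/funext => x; rewrite /fct_add maxA. Qed.
Lemma fct_addC : commutative fct_add.
Proof. by move=> f g; apply/funext => x; rewrite /fct_add maxC. Qed.
Lemma fct_add0 : left_id fct_zero fct_add.
Proof. by move=> f; apply/funext => x; rewrite /fct_add maxNye. Qed.

HB.instance Definition _ :=
  GRing.isNmodule.Build (fct G) fct_addA fct_addC fct_add0.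

Lemma fct_scaleA a b f : fct_scale a (fct_scale b f) = fct_scale (a * b) f.
Proof. by apply/funext => x; rewrite /fct_scale addeA. Qed.
Lemma fct_scale0 f : fct_scale 0 f = 0.
Proof. by apply/funext => x; rewrite /fct_scale addNye. Qed.
Lemma fct_scale1 : left_id 1 fct_scale.
Proof. by move=> f; apply/funext => x; rewrite /fct_scale add0e. Qed.
Lemma fct_scaleDr : right_distributive fct_scale +%R.
Proof. by move=> a f g; apply/funext => x; exact: adde_max_trop. Qed.
Lemma fct_scaleDl f : {morph fct_scale^~ f : a b / a + b}.
Proof.
move=> a b; apply/funext => x; rewrite /fct_scale /=.
by rewrite addeC adde_max_trop ![(f x + _)%E]addeC.
Qed.

(* Functions on the graph form a semimodule over the tropical semifield:
   (f + g) x = max (f x) (g x) and (a *: f) x = a + f x in \bar R, where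
   -oo + +oo = -oo. *)
HB.instance Definition _ := GRing.Nmodule_isLSemiModule.Build (tropical R)
  (fct G) fct_scaleA fct_scale0 fct_scale1 fct_scaleDr fct_scaleDl.

End Tropical.

Definition fin_generated (R : realType) (M : lSemiModType (tropical R))
    (S : set M) : Prop :=
  exists (n : nat) (g : 'I_n -> M),
    (forall i, S (g i)) /\
    forall f, S f -> exists a : 'I_n -> tropical R, f = \sum_(i < n) a i *: g i.

Section Action.
Variables (R : realType) (G : wgraph R) (K : finGroupType).
Variable to : {action K &-> mgraph G}.

Definition isometric_action : Prop :=
  forall sigma : K, isometric (fun x => to x sigma).

Definition K_invariant (T : Type) (h : mgraph G -> T) : Prop :=
  forall (sigma : K) (x : mgraph G), h (to x sigma) = h x.

(* R(D)^K *)
Definition RspaceK (D : divisor G) : set (fct G) :=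
  [set f | Rspace D f /\ K_invariant f].

End Action.

(* Main.v *)
(* On an edge e, a function f of R(D) becomes convex once the convex function
   with divisor D on the interior of e is added to it, so that f is recovered
   from the heights of its supporting lines of integer slope.  These slopes are
   bounded uniformly in f: a function leaving a vertex with a large slope climbs
   to the other end of the edge, where the order condition forces it to climb
   again, and there are finitely many vertices.  The order condition at a vertex
   v says that, for each of the finitely many choices of slopes which would make
   the order too small, the value at v is reached by a steeper line.  Hence R(D)
   is the image under a linear map of the solutions of finitely many tropical
   linear inequalities, and the tropical double description method yields
   generators.
   An isometry maps short rays at a point to short rays at its image, because
   distances along and across rays are bounded below by 1-Lipschitz functions;
   so it preserves piecewise linearity and orders, and summing f o sigma over K
   is a linear retraction of R(D) onto R(D)^K. *)

Require Import Defs.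
From HB Require Import structures.
From mathcomp Require Import all_boot all_order all_algebra all_fingroup finmap.
From mathcomp Require Import all_classical all_reals ereal topology normedtype.
From mathcomp Require Import zify lra.

Set Implicit Arguments.
Unset Strict Implicit.
Unset Printing Implicit Defensive.

Import Order.TTheory GRing.Theory Num.Theory.
Local Open Scope classical_set_scope.
Local Open Scope ring_scope.

(** * Tropical cones *)

(** Interior points impose no inequality: a maximum of lines with the hinges of [D] subtracted has
    order at least [- D] there by itself, so only the vertices have to be controlled and finitely
    many inequalities remain. The passage from [f] to its supporting heights is an infimum and is
    not tropically linear; it serves only as a section of the linear map [combine], and surjectivity
    of [combine] onto R(D) is all that finite generation asks for. The points at infinity shape much
    of the rest. Values there may be +oo, which is no element of the tropical semifield; hence they
    are read off the lines of the leaf edge, and the order condition there becomes the vanishing of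
    the coordinates of too steep lines. Distances do not see how such a point is approached, so
    continuity is what shows that an isometry acts near it as a shift. No quotient graph is formed:
    idempotency of max makes the sum over K a retraction, without division by the order of K. *)

Section TropicalCones.
Variable R : realType.
Local Notation T := (tropical R).
Implicit Types (a b c : T) (M : lSemiModType T).

Definition tval a : \bar R := val a.

Arguments tval a%_R.

Lemma tval_inj : injective tval. Proof. exact: val_inj. Qed.
Lemma tval_noo a : tval a != +oo%E. Proof. exact: (svalP a). Qed.
Lemma trop_val0 : tval (0 : T) = -oo%E. Proof. by []. Qed.
Lemma trop_valD a b : tval (a + b) = Order.max (tval a) (tval b). Proof. by []. Qed.
Lemma trop_valM a b : tval (a * b) = (tval a + tval b)%E. Proof. by []. Qed.

Lemma trop_addE a b : (a + b == b) = (tval a <= tval b)%E.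
Proof. by rewrite -(inj_eq tval_inj) trop_valD eq_maxr. Qed.

Lemma trop_eq0 a : (a == 0) = (tval a == -oo%E).
Proof. by rewrite -(inj_eq tval_inj). Qed.

Lemma tsum_le (I : Type) (r : seq I) (P : pred I) (F : I -> T) (x : \bar R) :
  (forall i, P i -> (tval (F i) <= x)%E) -> (tval (\sum_(i <- r | P i) F i) <= x)%E.
Proof.
move=> h; elim/big_ind: _ => [|a b ha hb|]; [by rewrite leNye| |exact: h].
by rewrite trop_valD ge_max ha.
Qed.

Lemma le_tsum (I : finType) (P : pred I) (F : I -> T) i :
  P i -> (tval (F i) <= tval (\sum_(j | P j) F j))%E.
Proof. by move=> Pi; rewrite (bigD1 i) //= trop_valD le_max lexx. Qed.

Lemma tsum_attained (I : finType) (P : pred I) (F : I -> T) :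
  \sum_(i | P i) F i != 0 -> exists2 i, P i & \sum_(j | P j) F j = F i.
Proof.
elim/big_ind: _ => [|a b ha hb|i Pi _]; [by rewrite eqxx| |by exists i].
have [/eqP ab|ba] := boolP (a + b == b); first by rewrite ab.
have -> : a + b = a.
  by move: ba; rewrite trop_addE -ltNge addrC => /ltW; rewrite -trop_addE => /eqP.
by [].
Qed.

Lemma semimod_addxx M (x : M) : x + x = x.
Proof.
rewrite -[x]scale1r -scalerDl; congr (_ *: _).
by apply/eqP; rewrite trop_addE.
Qed.

(** The natural order of an idempotent semimodule; identities between tropical combinations are
    proved through its antisymmetry. *)
Definition semimod_le M (x y : M) := x + y = y.

Lemma semimod_le_anti M (x y : M) : semimod_le x y -> semimod_le y x -> x = y.
Proof. by rewrite /semimod_le addrC => + e; rewrite e. Qed.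

Lemma semimod_le_trans M (x y z : M) :
  semimod_le x y -> semimod_le y z -> semimod_le x z.
Proof. by rewrite /semimod_le => xy yz; rewrite -yz addrA xy. Qed.

Lemma semimod_le_addl M (x y : M) : semimod_le x (x + y).
Proof. by rewrite /semimod_le addrA semimod_addxx. Qed.

Lemma semimod_le_add M (x y z : M) :
  semimod_le x z -> semimod_le y z -> semimod_le (x + y) z.
Proof. by rewrite /semimod_le -addrA => xz ->. Qed.

Lemma semimod_le_sum M (I : finType) (F : I -> M) i : semimod_le (F i) (\sum_j F j).
Proof. by rewrite (bigD1 i) //=; exact: semimod_le_addl. Qed.

Lemma sum_semimod_le M (I : finType) (F : I -> M) y :
  (forall i, semimod_le (F i) y) -> semimod_le (\sum_j F j) y.
Proof.
move=> h; elim/big_ind: _ => [|u v hu hv|i _]; [exact: add0r| |exact: h].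
exact: semimod_le_add.
Qed.

Lemma scale_semimod_le M a b (x : M) : (tval a <= tval b)%E -> semimod_le (a *: x) (b *: x).
Proof. by rewrite -trop_addE /semimod_le => /eqP ab; rewrite -scalerDl ab. Qed.

Definition cone M (S : set M) :=
  [/\ S 0, forall x y, S x -> S y -> S (x + y) & forall a x, S x -> S (a *: x)].

Lemma cone_sum M (S : set M) (I : finType) (F : I -> M) :
  cone S -> (forall i, S (F i)) -> S (\sum_i F i).
Proof.
by move=> [S0 SD _] SF; elim/big_ind: _ => // x y; exact: SD.
Qed.

Definition tlinear M M' (p : M -> M') :=
  (forall x y, p (x + y) = p x + p y) /\ (forall a x, p (a *: x) = a *: p x).

Lemma tlinear0 M M' (p : M -> M') : tlinear p -> p 0 = 0.
Proof. by move=> [_ pZ]; rewrite -(scale0r (0 : M)) pZ scale0r. Qed.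

Lemma tlinear_sum M M' (p : M -> M') (I : finType) (P : pred I) (F : I -> M) :
  tlinear p -> p (\sum_(i | P i) F i) = \sum_(i | P i) p (F i).
Proof.
move=> hp; rewrite (big_morph p (id1 := 0) (op1 := +%R)) //; last exact: tlinear0.
exact: hp.1.
Qed.

Definition subcone M (S : set M) (p q : M -> T^o) : set M :=
  [set x | S x /\ (tval (p x) <= tval (q x))%E].

Lemma subcone_cone M (S : set M) (p q : M -> T^o) :
  cone S -> tlinear p -> tlinear q -> cone (subcone S p q).
Proof.
move=> [S0 SD SZ] hp hq; split; first by split=> //; rewrite !tlinear0.
- move=> x y [Sx xl] [Sy yl]; split; first exact: SD.
  by rewrite hp.1 hq.1 !trop_valD ge_max !le_max xl yl orbT.
- move=> a x [Sx xl]; split; first exact: SZ.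
  by rewrite hp.2 hq.2 !trop_valM leeD2l.
Qed.

Lemma fin_generated_finType M (S : set M) (J : finType) (g : J -> M) :
  (forall j, S (g j)) ->
  (forall x, S x -> exists c : J -> T, x = \sum_j c j *: g j) ->
  fin_generated S.
Proof.
move=> Sg gen; exists #|J|, (g \o enum_val); split=> [i|x /gen[c ->]]; first exact: Sg.
exists (c \o enum_val).
by rewrite (big_enum_val (A := J) (fun j => c j *: g j)).
Qed.

(* Tropical double description: generators violating p <= q are paired with
   generators satisfying it, at the scale where equality holds. *)
Lemma subcone_fin_generated M (S : set M) (p q : M -> T^o) :
  cone S -> tlinear p -> tlinear q ->
  fin_generated S -> fin_generated (subcone S p q).
Proof.
move=> cS hp hq [n [g [Sg gen]]].
have [S0 SD SZ] := cS; have [T0 TD TZ] := subcone_cone cS hp hq.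
pose good i := (tval (p (g i)) <= tval (q (g i)))%E.
pose h (j : 'I_n + 'I_n * 'I_n) := match j with
  | inl i => if good i then g i else 0
  | inr (i, j) => if good i && ~~ good j then q (g i) *: g j + p (g j) *: g i else 0
  end.
apply: (@fin_generated_finType _ _ _ h) => [[i|[i j]] /=|x].
- by case: ifP => // gi; split.
- case: ifP => // /andP[gi gj]; split; first by apply: SD; exact: SZ.
  rewrite hp.1 hq.1 !hp.2 !hq.2 !trop_valD !trop_valM ge_max !le_max.
  rewrite addeC lexx orbT /=; apply/orP; right.
  by rewrite leeD2l.
move=> [/gen[c xE] xl].
have px : p x = \sum_i (c i * p (g i) : T).
  by rewrite xE tlinear_sum //; apply: eq_bigr => i _; exact: hp.2.
have qx : q x = \sum_i (c i * q (g i) : T).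
  by rewrite xE tlinear_sum //; apply: eq_bigr => i _; exact: hq.2.
(* Since [p x <= q x], the term of [q x] that attains the maximum dominates [c j * p (g j)]. Its
   index is good: otherwise its term in [p x] would exceed [q x]. *)
have partner j : ~~ good j -> c j != 0 ->
    exists i, [/\ good i, tval (q (g i)) != -oo%E &
      (tval (c j) + tval (p (g j)) <= tval (c i) + tval (q (g i)))%E].
  move=> bj cj.
  have lt_oo : (-oo < tval (c j) + tval (p (g j)))%E.
    rewrite ltNye; case E : (tval (c j)) => [r| |] //; last by rewrite trop_eq0 E eqxx in cj.
    - move: bj; rewrite /good -ltNge; case: (tval (p (g j))) => //=.
      by rewrite ltNge leNye.
    - by have := tval_noo (c j); rewrite E eqxx.
  have jp : (tval (c j) + tval (p (g j)) <= tval (p x))%E.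
    by rewrite px -trop_valM; exact: (@le_tsum _ xpredT (fun i => c i * p (g i))).
  have qx0 : q x != 0.
    by rewrite trop_eq0 -ltNye; apply: (lt_le_trans lt_oo); exact: le_trans xl.
  move: (qx0); rewrite {1}qx => /tsum_attained[k _]; rewrite -qx => qk.
  have le1 : (tval (c j) + tval (p (g j)) <= tval (c k) + tval (q (g k)))%E.
    by rewrite -(trop_valM (c k)) -qk; exact: le_trans xl.
  have qk0 : tval (q (g k)) != -oo%E.
    apply/negP => /eqP e; move: (lt_le_trans lt_oo le1).
    by rewrite e addeC addNye ltxx.
  exists k; split=> //; rewrite /good leNgt; apply/negP => bk.
  have ck : tval (c k) \is a fin_num.
    move: (lt_le_trans lt_oo le1) (tval_noo (c k)); rewrite -/(tval (c k)).
    by case: (tval (c k)) => //; rewrite addNye ltxx.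
  have : (tval (p x) < tval (p x))%E.
    apply: (le_lt_trans xl); rewrite qk trop_valM.
    apply: (@lt_le_trans _ _ (tval (c k) + tval (p (g k)))%E).
      by rewrite lteD2lE.
    by rewrite px -trop_valM; exact: (@le_tsum _ xpredT (fun i => c i * p (g i))).
  by rewrite ltxx.
pose pt j i := [/\ good i, tval (q (g i)) != -oo%E &
  (tval (c j) + tval (p (g j)) <= tval (c i) + tval (q (g i)))%E].
pose s j := xget j (pt j).
have sP j : ~~ good j -> c j != 0 -> pt j (s j).
  by move=> bj cj; rewrite /s; case: xgetP => [i _ //|no]; have [i /no] := partner j bj cj.
(* Tropical division. The value -oo for a zero divisor is a default, and [difE] excludes that
   case. *)
have dif_proof (a b : T) : (if (tval b) is r%:E then (tval a - r%:E)%E else -oo%E) != +oo%E.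
  by case: (b) (a) => [[r| |] //= _] [[r'| |]].
pose dif a b : T := Trop (dif_proof a b).
have difV a b : tval (dif a b) = if tval b is r%:E then (tval a - r%:E)%E else -oo%E by [].
have difE a b : tval b != -oo%E -> dif a b * b = a.
  move=> b0; apply: tval_inj; rewrite trop_valM difV.
  by move: b0 (tval_noo b); case: (tval b) => [r| |] // _ _; rewrite subeK.
(* Scaling the pair generator of [(s j, j)] by [c j / q (g (s j))] yields [c j *: g j] plus a
   multiple of [g (s j)], and the choice of the partner keeps that multiple below
   [c (s j) *: g (s j)]. *)
pose d (j : 'I_n + 'I_n * 'I_n) : T := match j with
  | inl i => c i
  | inr (i, j) => if (i == s j) && (c j != 0) then dif (c j) (q (g i)) else 0
  end.
exists d; apply: semimod_le_anti.
- rewrite {1}xE; apply: sum_semimod_le => i.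
  have [ci0|ci] := eqVneq (c i) 0; first by rewrite ci0 scale0r; exact: add0r.
  have [gi|bi] := boolP (good i).
    by have := semimod_le_sum (fun j => d j *: h j) (inl i); rewrite /= gi.
  have [gs qs _] := sP i bi ci.
  have := semimod_le_sum (fun j => d j *: h j) (inr (s i, i)).
  rewrite /= gs bi eqxx ci /= scalerDr scalerA difE //.
  by apply: semimod_le_trans; exact: semimod_le_addl.
- apply: sum_semimod_le => -[i|[i j]] /=.
    case: ifP => _; last by rewrite scaler0; exact: add0r.
    by rewrite xE; exact: (semimod_le_sum (fun i => c i *: g i) i).
  case: ifP => [/andP[/eqP -> cj]|]; last by rewrite scale0r => _; exact: add0r.
  case: ifP => [/andP[gs bj]|]; last by rewrite scaler0 => _; exact: add0r.
  have [_ qs le1] := sP j bj cj.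
  rewrite scalerDr !scalerA difE //; apply: semimod_le_add.
    by rewrite xE; exact: (semimod_le_sum (fun i => c i *: g i) j).
  apply: (@semimod_le_trans _ _ (c (s j) *: g (s j))).
    apply: scale_semimod_le; rewrite trop_valM difV.
    have qT := tval_noo (q (g (s j))).
    move: qs le1 qT; rewrite -/(tval (q (g (s j)))); case: (tval (q _)) => [r| |] //= _ le1 _.
    by rewrite addeAC EFinN leeBlDr.
  by rewrite xE; exact: (semimod_le_sum (fun i => c i *: g i) (s j)).
Qed.

Lemma subcones_fin_generated M (S : set M) (J : finType) (p q : J -> M -> T^o) :
  cone S -> fin_generated S -> (forall j, tlinear (p j)) -> (forall j, tlinear (q j)) ->
  let S' := [set x | S x /\ forall j, (tval (p j x) <= tval (q j x))%E] in
  cone S' /\ fin_generated S'.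
Proof.
move=> cS fS lp lq /=.
have: let S' := [set x | S x /\ forall j, j \in enum J -> (tval (p j x) <= tval (q j x))%E] in
  cone S' /\ fin_generated S'.
  elim: (enum J) => [|i r /= [cS' fS']].
    rewrite (_ : [set x | _] = S) //=; apply/seteqP; split=> x; [by case|by []].
  set S' := [set x | _] in cS' fS' *.
  rewrite (_ : [set x | _] = subcone S' (p i) (q i)).
    by split; [exact: subcone_cone|exact: subcone_fin_generated].
  apply/seteqP; split=> x /=.
    move=> [Sx h]; split; last by apply: h; rewrite inE eqxx.
    by split=> // j jr; apply: h; rewrite inE jr orbT.
  by move=> [[Sx h] h0]; split=> // j; rewrite inE => /predU1P[->|/h].
rewrite /= (_ : [set x | _] = [set x | S x /\ forall j, (tval (p j x) <= tval (q j x))%E]) //.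
by apply/seteqP; split=> x /= [Sx h]; split=> // j *; apply: h; rewrite ?mem_enum.
Qed.

Lemma image_fin_generated M M' (S : set M) (p : M -> M') :
  tlinear p -> fin_generated S -> fin_generated (p @` S).
Proof.
move=> hp [n [g [Sg gen]]]; exists n, (p \o g); split=> [i|_ [x /gen[c ->] <-]].
  by exists (g i).
exists c; rewrite tlinear_sum //; apply: eq_bigr => i _; exact: hp.2.
Qed.

Section Coordinates.
Variable I : finType.
Local Notation V := {ffun I -> T^o}.

Lemma setT_fin_generated : fin_generated [set: V].
Proof.
apply: (@fin_generated_finType _ _ I (fun i => [ffun j => if j == i then 1 else 0])) => //.
move=> x _; exists x; apply/ffunP => j; rewrite sum_ffunE (bigD1 j) //= big1 => [|i ij].
  by rewrite addr0 !ffunE eqxx; rewrite [_ *: _]mulr1.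
by rewrite !ffunE eq_sym (negPf ij); exact: mulr0.
Qed.

Lemma tlinear_coord i : tlinear (fun x : V => x i).
Proof. by split=> [x y|a x]; rewrite ffunE. Qed.

Lemma tlinear_zero M M' : tlinear (fun _ : M => 0 : M').
Proof. by split=> [x y|a x]; rewrite ?addr0 ?scaler0. Qed.

Lemma tlinear_scale M M' a (p : M -> M') : tlinear p -> tlinear (fun x => a *: p x).
Proof.
move=> [pD pZ]; split=> [x y|b x]; first by rewrite pD scalerDr.
by rewrite pZ !scalerA mulrC.
Qed.

Lemma tlinear_bigsum M M' (J : finType) (P : pred J) (p : J -> M -> M') :
  (forall j, tlinear (p j)) -> tlinear (fun x => \sum_(j | P j) p j x).
Proof.
move=> hp; split=> [x y|a x].
  by rewrite -big_split; apply: eq_bigr => j _; exact: (hp j).1.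
by rewrite scaler_sumr; apply: eq_bigr => j _; exact: (hp j).2.
Qed.

End Coordinates.
End TropicalCones.

(** * Germs of affine functions *)

Section Germs.
Variable R : realType.
Implicit Types (b : bool) (t u w l : \bar R) (a c : R) (k m : int) (P Q : \bar R -> Prop)
  (F : \bar R -> \bar R).

(* [b] tells on which side of [t] we look: the right if [b = false], the left
   if [b = true]. *)
Definition side b t w := if b then (w < t)%E else (t < w)%E.
Definition between b t w u := if b then (w <= u <= t)%E else (t <= u <= w)%E.
(** The one-sided neighbourhood contains [t], so a germ also fixes the value at [t]; this encodes
    continuity, including at +oo. *)
Definition nearby b t P := exists w, side b t w /\ forall u, between b t w u -> P u.
Definition in_dom l b t := ((0 <= t <= l) && (if b then 0 < t else t < l))%E.

Lemma nearbyW b t P Q : (forall u, P u -> Q u) -> nearby b t P -> nearby b t Q.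
Proof. by move=> h [w [sw bw]]; exists w; split=> // u /bw/h. Qed.

Lemma nearby_and b t P Q :
  nearby b t P -> nearby b t Q -> nearby b t (fun u => P u /\ Q u).
Proof.
case: b => -[w [/= sw hw]] [w' [/= sw' hw']].
- exists (Order.max w w'); rewrite /= gt_max sw; split=> // u.
  by rewrite ge_max => /andP[/andP[h1 h2] h3]; split; [apply: hw|apply: hw']; apply/andP.
- exists (Order.min w w'); rewrite /= lt_min sw; split=> // u.
  by rewrite le_min => /andP[h3 /andP[h1 h2]]; split; [apply: hw|apply: hw']; apply/andP.
Qed.

Lemma nearby_at b t P : nearby b t P -> P t.
Proof. by case: b => -[w [/= sw]]; apply => /=; rewrite lexx ?andbT ltW. Qed.

Lemma nearby_side b t w : side b t w -> nearby b t (between b t w).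
Proof. by move=> sw; exists w. Qed.

Lemma nearby_dom l b t : in_dom l b t -> nearby b t (fun u => 0 <= u <= l)%E.
Proof.
case: b => /andP[/andP[t0 tl] h].
- by exists 0%E; split=> // u /andP[-> ut] /=; exact: le_trans tl.
- by exists l; split=> // u /andP[ut ->]; rewrite (le_trans t0).
Qed.

Lemma in_dom_fin l b t : in_dom l b t -> b = false -> t \is a fin_num.
Proof.
move=> + bE; rewrite {}bE => /andP[/andP[t0 _] tl].
by case: t t0 tl => // _; rewrite ltNge leey.
Qed.

Lemma side_pick l b t w : in_dom l b t -> side b t w ->
  exists r : R, side b t r%:E /\ between b t w r%:E.
Proof.
case: b => /= /andP[/andP[t0 _] h] sw.
- have : (Order.max 0 w < t)%E by rewrite gt_max h.
  have : (0 <= Order.max 0 w)%E by rewrite le_max lexx.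
  have wm : (w <= Order.max 0 w)%E by rewrite le_max lexx orbT.
  case: (Order.max 0 w)%E wm => [r| |] // wr r0 rt; last by rewrite ltNge leey in rt.
  case: t {t0 h sw} rt => [t| |] // rt.
  + exists ((r + t) / 2); rewrite !lte_fin !lee_fin; rewrite lte_fin in rt.
    split; first by lra.
    by apply/andP; split; [apply: le_trans wr _; rewrite lee_fin; lra|lra].
  + by exists r; rewrite ltry leey wr.
- have {h t0} : t \is a fin_num by case: t t0 h sw => // _; rewrite ltNge leey.
  case: t sw => [t| |] // tw _; case: w tw => [w| |] // tw.
  + by exists w; rewrite !lee_fin !lexx; rewrite lte_fin in tw; rewrite ltW.
  + by exists (t + 1); rewrite lte_fin lee_fin leey; split; [lra|apply/andP; split => //; lra].
Qed.

Lemma nearby_pick l b t P : in_dom l b t -> nearby b t P ->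
  exists r : R, side b t r%:E /\ P r%:E.
Proof.
move=> d [w [sw hw]]; have [r [sr br]] := side_pick d sw.
by exists r; split=> //; exact: hw.
Qed.

Definition aff a k u : \bar R := (a%:E + k%:~R%:E * u)%E.

Definition germ F b t a k := nearby b t (fun u => F u = aff a k u).

Definition outgoing b k : int := if b then - k else k.

Lemma aff_fin a k (r : R) : aff a k r%:E = (a + k%:~R * r)%:E.
Proof. by []. Qed.

Lemma aff_oo a k : aff a k +oo%E =
  if k == 0 then a%:E else if 0 < k then +oo%E else -oo%E.
Proof.
rewrite /aff; have [k0|k0|->] := ltgtP k 0; last by rewrite mul0e adde0.
- by rewrite lt0_muley ?lte_fin ?ltrz0.
- by rewrite gt0_muley ?lte_fin ?ltr0z.
Qed.

Lemma aff_compare l b t a k a' k' : in_dom l b t ->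
  nearby b t (fun u => aff a k u <= aff a' k' u)%E \/
  nearby b t (fun u => aff a' k' u <= aff a k u)%E.
Proof.
case: t => [t| |] d; last by case/andP: d => /andP[].
  (* the two lines are compared at a point s > t (or s < t) close to t, before
     they can cross again *)
  have main (a1 a2 : R) (k1 k2 : int) : a1 + k1%:~R * t < a2 + k2%:~R * t \/
      a1 + k1%:~R * t = a2 + k2%:~R * t /\ outgoing b k1 <= outgoing b k2 ->
      nearby b t%:E (fun u => aff a1 k1 u <= aff a2 k2 u)%E.
    move=> [lt12|[e12 k12]].
    (* [g] is the gap at [t] and [K] bounds the rate at which it closes, so the order persists
       within [g / K]; the [+ 1] keeps [K] positive. *)
    - pose K : R := `|k1%:~R - k2%:~R| + 1; pose g := a2 + k2%:~R * t - (a1 + k1%:~R * t).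
      have K0 : 0 < K by rewrite ltr_wpDl.
      have g0 : 0 < g by rewrite subr_gt0.
      have gK : g / K * K = g by rewrite divfK // gt_eqF.
      have gK0 : 0 < g / K by rewrite divr_gt0.
      have key (r : R) : `|r - t| <= g / K -> (aff a1 k1 r%:E <= aff a2 k2 r%:E)%E.
        move=> rt; rewrite !aff_fin lee_fin.
        have : (k1%:~R - k2%:~R) * (r - t) <= g.
          apply: le_trans (ler_norm _) _; rewrite normrM -gK mulrC.
          by apply: ler_pM => //; rewrite /K lerDl.
        by rewrite /g; lra.
      case: b {d} => [|].
      + exists (t - g / K)%:E; split => [/=|u /=]; first by rewrite lte_fin ltrBlDr ltrDl.
        case: u => [r| |]; rewrite ?leye_eq ?leeNy_eq ?andbF // !lee_fin => /andP[h1 h2].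
        by apply: key; rewrite ler_norml; lra.
      + exists (t + g / K)%:E; split => [/=|u /=]; first by rewrite lte_fin ltrDl.
        case: u => [r| |]; rewrite ?leye_eq ?leeNy_eq ?andbF // !lee_fin => /andP[h1 h2].
        by apply: key; rewrite ler_norml; lra.
    - case: b d k12 => /= d k12.
      + exists (t - 1)%:E; split => [/=|u /=]; first by rewrite lte_fin ltrBlDr ltrDl.
        case: u => [r| |]; rewrite ?leye_eq ?leeNy_eq ?andbF // !lee_fin => /andP[h1 h2].
        rewrite lerN2 -(ler_int R) in k12.
        have : (k2%:~R - k1%:~R) * (t - r) <= 0 by rewrite mulr_le0_ge0 ?subr_le0 ?subr_ge0.
        by lra.
      + exists (t + 1)%:E; split => [/=|u /=]; first by rewrite lte_fin ltrDl.
        case: u => [r| |]; rewrite ?leye_eq ?leeNy_eq ?andbF // !lee_fin => /andP[h1 h2].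
        rewrite -(ler_int R) in k12.
        have : (k1%:~R - k2%:~R) * (r - t) <= 0 by rewrite mulr_le0_ge0 ?subr_le0 ?subr_ge0.
        by lra.
  have [h|h|h] := ltgtP (a + k%:~R * t) (a' + k'%:~R * t).
  - by left; apply: main; left.
  - by right; apply: main; left.
  - have [h'|/ltW h'] := leP (outgoing b k) (outgoing b k').
      by left; apply: main; right.
    by right; apply: main; right.
have bE : b by case: b d => // /andP[_]; rewrite ltNge leey.
rewrite {}bE in d *.
have main (a1 a2 : R) (k1 k2 : int) : k1 < k2 \/ k1 = k2 /\ a1 <= a2 ->
    nearby true +oo%E (fun u => aff a1 k1 u <= aff a2 k2 u)%E.
  move=> [k12|[-> a12]]; last first.
    by exists 0%E; split=> [|u _]; [exact: ltry|rewrite /aff leeD2r // lee_fin].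
  (* Integer slopes differ by at least 1, so [(k2 - k1) * r >= r >= a1 - a2] from here on. *)
  exists (Num.max 0 (a1 - a2))%:E; split => [|u /=]; first by rewrite /side ltry.
  rewrite leey andbT; case: u => [r| |] //.
  - rewrite lee_fin ge_max => /andP[r0 ra]; rewrite !aff_fin lee_fin.
    have : 1 <= (k2%:~R - k1%:~R : R) by rewrite -intrB ler1z -gtz0_ge1 subr_gt0.
    by move=> h; have := ler_wpM2r r0 h; lra.
  - rewrite !aff_oo => _; have [k1n|k1p|k1z] := ltgtP k1 0; rewrite ?leNye //.
    + by have k2p := lt_trans k1p k12; rewrite gt_eqF // k2p.
    + by rewrite k1z in k12; rewrite gt_eqF // k12 leey.
have [h|h|h] := ltgtP k k'.
- by left; apply: main; left.
- by right; apply: main; left.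
- have [h'|/ltW h'] := leP a a'.
    by left; apply: main; right.
  by right; apply: main; right.
Qed.

Lemma aff_slope_le l b (t : R) a k a' k' : in_dom l b t%:E ->
  nearby b t%:E (fun u => aff a k u <= aff a' k' u)%E ->
  aff a k t%:E = aff a' k' t%:E -> outgoing b k <= outgoing b k'.
Proof.
move=> d n; rewrite !aff_fin => -[e].
have [r [sr]] := nearby_pick d n; rewrite !aff_fin lee_fin => le.
case: b sr {d n} => /=; rewrite lte_fin => tr; rewrite ?lerN2 -(ler_int R) leNgt;
  apply/negP; rewrite -subr_gt0 => h.
- by have := mulr_gt0 h (_ : 0 < t - r); rewrite subr_gt0 => /(_ tr); lra.
- by have := mulr_gt0 h (_ : 0 < r - t); rewrite subr_gt0 => /(_ tr); lra.
Qed.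

(** Continuous induction: the supremum of the initial segments on which [P] holds satisfies [P] by
    the limit hypothesis, and below [l] the step hypothesis would push past it. It plays the role of
    compactness when local pieces are glued. *)
Lemma ereal_induction (x l : \bar R) P : P x ->
  (forall t, (x <= t < l)%E -> P t -> exists2 w, (t < w)%E & forall u, (t <= u <= w)%E -> P u) ->
  (forall t, (x < t <= l)%E -> (forall u, (x <= u < t)%E -> P u) -> P t) ->
  forall t, (x <= t <= l)%E -> P t.
Proof.
move=> Px step clos t0 /andP[xt0 t0l].
pose A : set (\bar R) := [set t | (x <= t <= l)%E /\ forall u, (x <= u <= t)%E -> P u].
have xl := le_trans xt0 t0l.
have Ax : A x.
  by split=> [|u]; [rewrite lexx xl|rewrite -eq_le eq_sym => /eqP ->].
have ub t : A t -> (t <= ereal_sup A)%E by exact: ereal_sup_ubound.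
have xT : (x <= ereal_sup A)%E by exact: ub.
have Tl : (ereal_sup A <= l)%E by apply: ge_ereal_sup => t [/andP[]].
have below u : (x <= u < ereal_sup A)%E -> P u.
  move=> /andP[xu /ereal_sup_gt[y [_ hy] uy]]; apply: hy.
  by rewrite xu ltW.
have PT : P (ereal_sup A).
  move: xT; rewrite le_eqVlt => /predU1P[<- //|xT].
  by apply: clos => //; rewrite xT.
have AT : A (ereal_sup A).
  split=> [|u /andP[xu]]; first by rewrite xT.
  by rewrite le_eqVlt => /predU1P[-> //|uT]; apply: below; rewrite xu.
move: Tl; rewrite le_eqVlt => /predU1P[Tl|Tl].
  by have [_] := AT; apply; rewrite xt0 Tl.
have [w Tw hw] := step _ (introT andP (conj xT Tl)) PT.
have : A (Order.min w l).
  split=> [|u]; first by rewrite le_min ge_min lexx orbT andbT (le_trans xT (ltW Tw)).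
  move=> /andP[xu]; rewrite le_min => /andP[uw ul].
  have [uT|/ltW Tu] := leP u (ereal_sup A).
    by have [_] := AT; apply; rewrite xu.
  by apply: hw; rewrite Tu.
by move=> /ub; rewrite leNgt lt_min Tw Tl.
Qed.

End Germs.

(** * Directions, one-sided slopes and orders at the points of the graph *)

Section GermsOnGraphs.
Variables (R : realType) (G : wgraph R).
Implicit Types (f g : fct G) (e : edge G) (d : edge G * bool) (b : bool) (t : \bar R)
  (x : mgraph G) (v : vertex G).

Lemma edge_pt0 e : edge_pt e 0%E = inl (src e).
Proof. by rewrite /edge_pt; case: insubP => [p|_]; rewrite /= ?lexx // ltxx. Qed.

Lemma edge_pt_len e : edge_pt e (len e) = inl (tgt e).
Proof.
have := len_gt0 e; rewrite /edge_pt; case: insubP => [p /=|_]; last first.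
  by rewrite ltNge => /negbTE ->.
by case: (len e) => [l| |] //=; rewrite ?ltxx ?andbF.
Qed.

Lemma edge_pt_inr (p : {p : edge G * R | (0 < p.2%:E < len p.1)%E}) :
  edge_pt (val p).1 (val p).2%:E = inr p.
Proof. by rewrite /edge_pt -surjective_pairing valK. Qed.

Lemma edge_pt_interior e (r : R) : (0 < r%:E < len e)%E ->
  exists p, edge_pt e r%:E = inr p /\ val p = (e, r).
Proof. by move=> h; exists (Sub (e, r) h); rewrite /edge_pt insubT SubK. Qed.

(* The pairs [(e, false)] and [(e, true)] are the directions along [e] away
   from [src e] and away from [tgt e]. *)
Definition at_pt x d : bool :=
  match x with
  | inl v => (if d.2 then tgt d.1 else src d.1) == v
  | inr p => d.1 == (val p).1
  end.

Definition pos x d : \bar R :=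
  match x with
  | inl _ => if d.2 then len d.1 else 0%E
  | inr p => (val p).2%:E
  end.

Lemma edge_pt_pos x d : at_pt x d -> edge_pt d.1 (pos x d) = x.
Proof.
case: x d => [v|p] [e b] /= /eqP h; last by rewrite h edge_pt_inr.
by case: b h => <-; rewrite ?edge_pt_len ?edge_pt0.
Qed.

Lemma in_dom_pos x d : at_pt x d -> in_dom (len d.1) d.2 (pos x d).
Proof.
rewrite /in_dom; case: x d => [v|p] [e b] /= /eqP eE.
  by have := len_gt0 e; case: b eE => _ h; rewrite lexx h ?ltW.
by have := valP p; rewrite eE => /andP[h1 h2]; case: b; rewrite !ltW //.
Qed.

Lemma at_pt_edge_pt e b t : in_dom (len e) b t ->
  at_pt (edge_pt e t) (e, b) /\ pos (edge_pt e t) (e, b) = t.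
Proof.
move=> /andP[/andP[t0 tl] h].
have [te|/eqP tne] := eqVneq t (len e).
  by case: b h => h; [rewrite te edge_pt_len /= eqxx|rewrite te ltxx in h].
have [te|/eqP tn0] := eqVneq t 0%E.
  by case: b h => h; [rewrite te ltxx in h|rewrite te edge_pt0 /= eqxx].
have {}t0 : (0 < t)%E by rewrite lt_neqAle t0 eq_sym andbT; apply/eqP.
have {}tl : (t < len e)%E by rewrite lt_neqAle tl andbT; apply/eqP.
case: t t0 tl {h tne tn0} => [r| |] // r0 rl; last by rewrite ltNge leey in rl.
have [|p [-> pE]] := @edge_pt_interior e r; first by rewrite r0.
by rewrite /= pE eqxx.
Qed.

Lemma pt_cases x : (exists v, x = inl v) \/ (exists d, at_pt x d).
Proof.
case: x => [v|p]; first by left; exists v.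
by right; exists ((val p).1, false); rewrite /= eqxx.
Qed.

Definition along f e : \bar R -> \bar R := fun t => f (edge_pt e t).

Definition oslope f d t : int := if d.2 then slopeL f d.1 t else slopeR f d.1 t.

Lemma germ_oslope f e b t a k : in_dom (len e) b t ->
  germ (along f e) b t a k -> oslope f (e, b) t = outgoing b k.
Proof.
move=> dt; have nd := nearby_dom dt.
move=> /(nearby_and nd) [w [sw hw]]; rewrite /oslope /outgoing /=.
case: b dt sw hw {nd} => /= dt sw hw.
- have /andP[/andP[t0 tl] tp] := dt.
  apply: (@slopeL_unique _ _ f e t (- k) a (Order.max 0%E w)) => [||s].
  + by rewrite gt_max tp.
  + by rewrite le_max lexx.
  + rewrite gt_max => /andP[/andP[s0 ws] st]; have [] := hw s%:E.
      by rewrite !ltW.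
    by move=> _; rewrite /along => ->; rewrite aff_fin mulrNz mulNr opprK.
- apply: (@slopeR_unique _ _ _ _ _ _ a w) => //; first exact: (in_dom_fin dt).
  move=> s /andP[ts su]; have [] := hw s%:E; first by rewrite !ltW.
  by move=> _; rewrite /along => ->.
Qed.

Lemma ord_atE f x : ord_at f x = \sum_(d | at_pt x d) oslope f d (pos x d).
Proof.
rewrite big_mkcond -(pair_bigA _ (fun e b => if at_pt x (e, b) then oslope f (e, b) (pos x (e, b)) else 0)) /=.
case: x => [v|p] /=.
  rewrite [in LHS]big_mkcond [X in _ + X]big_mkcond -big_split; apply: eq_bigr => e _.
  by rewrite /= big_bool /= addrC.
case: (val p) => e0 r; rewrite (bigD1 e0) //= [X in _ = _ + X]big1 => [|e /negPf eN].
  by rewrite big_bool /= eqxx addr0 addrC.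
by rewrite big_bool /= eN.
Qed.

Lemma path_cover (ts : seq (\bar R)) z b t : path <%O z ts ->
  (if b then z < t <= last z ts else z <= t < last z ts)%E ->
  exists2 i, (i < size ts)%N &
   (if b then nth 0 (z :: ts) i < t <= nth 0 ts i else nth 0 (z :: ts) i <= t < nth 0 ts i)%E.
Proof.
elim: ts z => [|c ts IH] z /=.
  by move=> _; case: b => /andP[h1 h2]; [move: (lt_le_trans h1 h2)|move: (le_lt_trans h1 h2)]; rewrite ltxx.
move=> /andP[zc p] h.
have [tc|ct] := boolP (if b then t <= c else t < c)%E.
  by exists 0%N => //=; case: (b) h tc => /andP[-> _] ->.
have [|i si hi] := IH c p; last by exists i.+1.
by case: b h ct {IH} => /andP[_ ->]; [rewrite -ltNge => ->|rewrite -leNgt => ->].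
Qed.

(** Finiteness of the pieces comes from continuous induction along the edge: a subdivision up to [t]
    extends past [t] by the right germ, and one that stops shortly before [t] reaches [t] by the
    left germ. *)
Lemma piecewise_linearP f : piecewise_linear f <->
  forall e b t, in_dom (len e) b t -> exists a k, germ (along f e) b t a k.
Proof.
split=> [pl e b t /andP[/andP[t0 tl] h]|loc e].
  have [ts [pth lst aff]] := pl e.
  have [|i si hi] := @path_cover ts 0%E b t pth.
    by rewrite lst; case: b h => ->; rewrite ?t0 ?tl.
  have [a [k fE]] := aff i si; exists a, k.
  exists (if b then nth 0%E (0%E :: ts) i else nth 0%E ts i); split.
    by case: b {h} hi => /= /andP[].
  by move=> u; case: b {h} hi => /= /andP[h1 h2] /andP[h3 h4]; apply: fE; apply/andP; split=> //;
    [exact: le_trans h2|exact: le_trans h3].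
pose P t := exists ts : seq (\bar R), [/\ path <%O 0%E ts, last 0%E ts = t &
  forall i, (i < size ts)%N -> affine_on f e (nth 0%E (0%E :: ts) i) (nth 0%E ts i)].
have extend t u : P t -> (t < u)%E ->
    (exists a k, forall s, (t <= s <= u)%E -> along f e s = aff a k s) -> P u.
  move=> [ts [pth lst hts]] tu [a [k fE]]; exists (rcons ts u); split.
  - by rewrite rcons_path pth lst.
  - by rewrite last_rcons.
  move=> i; rewrite size_rcons ltnS leq_eqVlt => /predU1P[->|si].
    rewrite nth_rcons ltnn eqxx -rcons_cons nth_rcons /= ltnSn.
    have -> : nth 0%E (0%E :: ts) (size ts) = t by rewrite -lst (last_nth 0%E).
    by exists a, k.
  rewrite -rcons_cons !nth_rcons si /= ltnS (ltnW si); exact: hts.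
apply: (@ereal_induction R 0%E (len e) P) => [||t|]; last by rewrite lexx ltW ?len_gt0.
- by exists [::].
- move=> t /andP[t0 tl] Pt.
  have dt : in_dom (len e) false t by rewrite /in_dom t0 tl ltW.
  have [a [k [w [sw hw]]]] := loc e false t dt.
  exists w => // u /andP[tu uw]; move: tu; rewrite le_eqVlt => /predU1P[<- //|tu].
  apply: extend Pt tu _; exists a, k => s /andP[ts su]; apply: hw => /=.
  by rewrite ts (le_trans su).
- move=> /andP[t0 tl] Pt.
  have dt : in_dom (len e) true t by rewrite /in_dom t0 tl ltW.
  have [a [k [w [sw hw]]]] := loc e true t dt.
  have wt : (Order.max 0 w < t)%E by rewrite gt_max t0.
  apply: (extend (Order.max 0 w)%E) => //; first by apply: Pt; rewrite wt le_max lexx.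
  by exists a, k => s; rewrite ge_max => /andP[/andP[_ ws] st]; apply: hw; rewrite /= ws.
Qed.

(** Valence one leaves room for a single edge end, that of [e] itself; in particular [e] is no
    loop. *)
Lemma at_infinity_dir e d : len e = +oo%E -> at_pt (inl (tgt e)) d -> d = (e, true).
Proof.
move=> eoo; have val1 := len_leaf eoo; rewrite /valence in val1.
have eB : e \in [set e' | tgt e' == tgt e]%SET by rewrite inE.
have B1 : (0 < #|[set e' | tgt e' == tgt e]%SET|)%N.
  by rewrite card_gt0; apply/finset.set0Pn; exists e.
move/eqP: val1; rewrite -(prednK B1) addnS eqSS addn_eq0 => /andP[/eqP/cards0_eq A0 /eqP B0].
have {B1} /cards1P[e' BE] : #|[set e' | tgt e' == tgt e]%SET| == 1%N by rewrite -(prednK B1) B0.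
have ee' : e = e' by move: eB; rewrite BE inE => /eqP.
case: d => e2 [|] /= h.
  by have : e2 \in [set e']%SET; [rewrite -BE inE|rewrite ee' inE => /eqP ->].
by have : e2 \in finset.set0; [rewrite -A0 inE|rewrite inE].
Qed.

Lemma at_infinity_pos x d : at_pt x d -> at_infinity x -> pos x d = +oo%E.
Proof.
move=> + [e [eoo xE]]; rewrite {}xE => /(at_infinity_dir eoo) -> /=.
exact: eoo.
Qed.

Lemma pos_at_infinity x d : at_pt x d -> pos x d = +oo%E -> at_infinity x.
Proof.
case: x d => [v|p] [e [|]] //= /eqP <- eoo; by exists e.
Qed.

Lemma pos_fin x d : at_pt x d -> ~ at_infinity x -> pos x d \is a fin_num.
Proof.
move=> dx nx; have := in_dom_pos dx => /andP[/andP[+ _] _].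
by case E : (pos x d) => [r| |] // _; case: nx; exact: pos_at_infinity E.
Qed.

End GermsOnGraphs.

(** * The semimodule R(D) *)

Section LinearSystems.
Variables (R : realType) (G : wgraph R).
Implicit Types (f g : fct G) (e : edge G) (d : edge G * bool) (b : bool) (t : \bar R)
  (x : mgraph G) (v : vertex G) (D : mgraph G -> int).

Definition has_slope f x d (m : int) :=
  exists a k, germ (along f d.1) d.2 (pos x d) a k /\ m = outgoing d.2 k.

Lemma has_slope_oslope f x d m : at_pt x d -> has_slope f x d m -> oslope f d (pos x d) = m.
Proof.
case: d => e b dx [a [k [fg ->]]]; apply: germ_oslope fg.
exact: (in_dom_pos dx).
Qed.

Lemma piecewise_linear_slopes f :
  piecewise_linear f <-> forall x d, at_pt x d -> exists m, has_slope f x d m.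
Proof.
rewrite piecewise_linearP; split=> [h x [e b] dx|h e b t dt].
  have [a [k fg]] := h e b _ (in_dom_pos dx); exists (outgoing b k), a, k; split=> //.
have [dx tE] := at_pt_edge_pt dt; have [m [a [k [fg _]]]] := h _ _ dx.
by exists a, k; rewrite tE in fg.
Qed.

(** Membership in R(D) for functions other than the constant -oo, with the slopes as witnesses
    instead of the chosen values [slopeR] and [slopeL]. Piecewise linearity is contained in the
    existence of the slopes. *)
Definition in_system D f :=
  (forall x, ~ at_infinity x -> f x \is a fin_num) /\
  forall x, exists m : edge G * bool -> int,
    (forall d, at_pt x d -> has_slope f x d (m d)) /\ 0 <= D x + \sum_(d | at_pt x d) m d.

(** Functions of [in_system] are finite at such a point, which separates them from the constant
    -oo. *)
Lemma ex_finite_point : exists x : mgraph G, ~ at_infinity x.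
Proof.
have [[e _]|noinf] := pselect (exists e : edge G, len e = +oo%E); last first.
  have /card_gt0P[v _] := vertex_gt0 G.
  by exists (inl v) => -[e [eoo _]]; apply: noinf; exists e.
have [r [r0 rl]] : exists r : R, (0 < r%:E < len e)%E /\ True.
  case: (len e) (len_gt0 e) => [l| |] //; rewrite ?lte_fin => l0.
  - by exists (l / 2); rewrite !lte_fin; split=> //; lra.
  - by exists 1; rewrite ltry lte_fin ltr01.
have [p [_ _]] := edge_pt_interior r0.
by exists (inr p) => -[e' []].
Qed.

Lemma RspaceP (D : divisor G) f : Rspace D f <-> f = cst -oo%E \/ in_system D f.
Proof.
split=> [[[[fE|[pl fin]] [_ eff]]|fE]|[->|[fin loc]]]; first by left.
- right; split=> // x; exists (fun d => oslope f d (pos x d)); split=> [d dx|].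
    have [m sm] := (piecewise_linear_slopes f).1 pl x d dx.
    by rewrite (has_slope_oslope dx sm).
  by have := eff x; rewrite /divf ord_atE.
- by left.
- by right.
- left; split; last split.
- right; split=> //; apply/piecewise_linear_slopes => x d dx.
  by have [m [h _]] := loc x; exists (m d); exact: h.
- by have [x nx] := ex_finite_point => fE; have := fin x nx; rewrite fE.
- move=> x; have [m [h le0]] := loc x.
  rewrite /divf ord_atE (eq_bigr m) // => d dx.
  by apply: has_slope_oslope => //; exact: h.
Qed.

Lemma sum_at_infinity e (F : edge G * bool -> int) : len e = +oo%E ->
  \sum_(d | at_pt (inl (tgt e)) d) F d = F (e, true).
Proof.
move=> eoo; apply: big_pred1 => d; apply/idP/eqP => [|->]; last by rewrite /= eqxx.
exact: at_infinity_dir.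
Qed.

Lemma has_slope_ext f g x d m :
  nearby d.2 (pos x d) (fun u => along f d.1 u = along g d.1 u) ->
  has_slope f x d m -> has_slope g x d m.
Proof.
move=> fg [a [k [h ->]]]; exists a, k; split=> //.
by apply: nearbyW (nearby_and fg h) => u [<-].
Qed.

Lemma has_slope_le f g x d m m' : at_pt x d -> ~ at_infinity x ->
  has_slope f x d m -> has_slope g x d m' ->
  nearby d.2 (pos x d) (fun u => along f d.1 u <= along g d.1 u)%E ->
  (g x <= f x)%E -> m <= m'.
Proof.
move=> dx nx [a [k [fg ->]]] [a' [k' [gg ->]]] fleg gf.
have := nearby_and fg (nearby_and gg fleg).
move=> /(nearbyW (Q := fun u => aff a k u <= aff a' k' u)%E) le1.
have {}le1 := le1 (fun u => ltac:(by move=> [<- [<-]])).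
have fx := nearby_at fg; have gx := nearby_at gg.
have := nearby_at le1; rewrite -fx -gx /along edge_pt_pos // => fx'.
have eqx : aff a k (pos x d) = aff a' k' (pos x d).
  by rewrite -fx -gx /along edge_pt_pos //; apply/eqP; rewrite eq_le fx'.
have := pos_fin dx nx; have := in_dom_pos dx.
case: (pos x d) le1 eqx => [r| |] // le1 eqx di _.
exact: aff_slope_le di le1 eqx.
Qed.

Lemma nearby_compare f g x d m m' : at_pt x d ->
  has_slope f x d m -> has_slope g x d m' ->
  nearby d.2 (pos x d) (fun u => along f d.1 u <= along g d.1 u)%E \/
  nearby d.2 (pos x d) (fun u => along g d.1 u <= along f d.1 u)%E.
Proof.
move=> dx [a [k [fg _]]] [a' [k' [gg _]]].
by have [h|h] := aff_compare a k a' k' (in_dom_pos dx); [left|right];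
  apply: nearbyW (nearby_and fg (nearby_and gg h)) => u [-> [->]].
Qed.

(** On one side of [x] one germ stays above the other, so it is the germ of the maximum. If the
    lower function attains the maximum at [x], both agree there and the upper one leaves faster.
    This comparison of slopes needs finite values, hence the restriction to points not at
    infinity. *)
Lemma max_slope f g x d m m' : at_pt x d -> has_slope f x d m -> has_slope g x d m' ->
  exists n, [/\ has_slope (f + g) x d n, n = m \/ n = m',
    ~ at_infinity x -> (g x <= f x)%E -> m <= n &
    ~ at_infinity x -> (f x <= g x)%E -> m' <= n].
Proof.
move=> dx fm gm.
have [h|h] := nearby_compare dx fm gm.
- exists m'; split; [| by right | by move=> nx; exact: has_slope_le fm gm h | by []].
  apply: has_slope_ext gm; apply: nearbyW h => u h.
  by rewrite {2}/along; apply/esym/max_r.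
- exists m; split; [| by left | by [] | by move=> nx; exact: has_slope_le gm fm h].
  apply: has_slope_ext fm; apply: nearbyW h => u h.
  by rewrite {2}/along; apply/esym/max_l.
Qed.

Lemma in_systemD D f g : in_system D f -> in_system D g -> in_system D (f + g).
Proof.
move=> [ff fl] [gf gl]; split=> [x nx|x].
  have := ff x nx; have := gf x nx; rewrite /GRing.add /= /fct_add.
  by case: (f x) => [r| |] //; case: (g x) => [r'| |] //= _ _; rewrite /Order.max; case: ifP.
have [m [fm mD]] := fl x; have [m' [gm mD']] := gl x.
have /choice[n nP] : forall d, exists n, at_pt x d -> [/\ has_slope (f + g) x d n, n = m d \/ n = m' d,
    ~ at_infinity x -> (g x <= f x)%E -> m d <= n &
    ~ at_infinity x -> (f x <= g x)%E -> m' d <= n].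
  move=> d; have [dx|_] := boolP (at_pt x d); last by exists 0.
  by have [n h] := max_slope dx (fm d dx) (gm d dx); exists n.
exists n; split=> [d dx|]; first by have [] := nP d dx.
(* At infinity there is one direction only, and the slope of the maximum is that of [f] or that of
   [g]; either satisfies the order condition. *)
have [[e [eoo xE]]|nx] := pselect (at_infinity x).
  subst x; rewrite !sum_at_infinity // in mD mD' *.
  by have [|_ [] -> //] := nP (e, true); rewrite /= ?eqxx.
have [gf'|/ltW gf'] := leP (g x) (f x).
- apply: (le_trans mD); rewrite lerD2l; apply: ler_sum => d dx.
  by have [_ _ h _] := nP d dx; exact: h.
- apply: (le_trans mD'); rewrite lerD2l; apply: ler_sum => d dx.
  by have [_ _ _ h] := nP d dx; exact: h.
Qed.

Lemma in_system_shift D (c : R) f g : (forall x, g x = c%:E + f x)%E ->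
  in_system D f -> in_system D g.
Proof.
move=> gE [ff fl]; split=> [x /ff fx|x]; first by rewrite gE fin_numD fx.
have [m [fm mD]] := fl x; exists m; split=> // d /fm[a [k [h ->]]].
exists (c + a), k; split=> //; apply: nearbyW h => u.
by rewrite /along gE => ->; rewrite /aff EFinD addeA.
Qed.

Lemma Rspace_cone (D : divisor G) : cone (Rspace D).
Proof.
have c0 : cst -oo%E = 0 :> fct G by [].
split=> [|f g|a f]; first by right.
- move=> /RspaceP[->|fD]; first by rewrite c0 add0r.
  move=> /RspaceP[->|gD]; first by rewrite c0 addr0; apply/RspaceP; right.
  by apply/RspaceP; right; exact: in_systemD.
- move=> /RspaceP[->|fD]; first by rewrite c0 scaler0; right.
  case E : (tval a) (tval_noo a) => [c| |] // _.
    apply/RspaceP; right; apply: (in_system_shift (c := c) _ fD) => x.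
    by rewrite -E.
  have -> : a = 0 by apply/eqP; rewrite trop_eq0 E.
  by rewrite scale0r; right.
Qed.

End LinearSystems.

(** * Convexity along an edge *)

Section ConvexGerms.
Variable R : realType.
Implicit Types (G rho lam : R -> R) (x y r s t u w : R).

Lemma real_induction (P : R -> Prop) x y : P x ->
  (forall t, x <= t < y -> P t -> exists2 w, t < w & forall u, t <= u <= w -> P u) ->
  (forall t, x < t <= y -> (forall u, x <= u < t -> P u) -> P t) ->
  forall t, x <= t <= y -> P t.
Proof.
move=> Px step clos t txy.
apply: (@ereal_induction R x%:E y%:E (P \o fine) _ _ _ t%:E) => //=.
- case=> [u| |]; rewrite ?ltye ?leeNy_eq ?andbF // => h Pu.
  have [w uw hw] := step u h Pu; exists w%:E; rewrite ?lte_fin //.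
  by case=> [v| |]; rewrite ?leye_eq ?leeNy_eq ?andbF // => ?; exact: hw.
- case=> [u| |]; rewrite ?leye_eq ?ltNge ?leNye ?andbF // -?ltNge => h hu.
  by apply: clos => // v hv; exact: (hu v%:E).
Qed.

(** [rho] and [lam] are the one-sided derivatives, both in the direction of growing [t]. Convexity
    is stated locally here and made global by [convex_growth]. *)
Definition convex_germs G rho lam x y :=
  [/\ forall t, x <= t < y -> exists2 w, t < w & forall u, t <= u <= w -> G u = G t + rho t * (u - t),
      forall t, x < t <= y -> exists2 w, w < t & forall u, w <= u <= t -> G u = G t + lam t * (u - t)
    & forall t, x < t < y -> lam t <= rho t].

Lemma convex_germs_sub G rho lam x y x' y' : x <= x' -> y' <= y ->
  convex_germs G rho lam x y -> convex_germs G rho lam x' y'.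
Proof.
move=> xx yy [h1 h2 h3]; split=> t /andP[a b].
- by apply: h1; apply/andP; split; lra.
- by apply: h2; apply/andP; split; lra.
- by apply: h3; apply/andP; split; lra.
Qed.

Lemma slope_uniq (p q c c' u v : R) : u < v ->
  c + p * u = c' + q * u -> c + p * v = c' + q * v -> p = q.
Proof.
move=> uv e1 e2; have : (p - q) * (v - u) = 0 by lra.
by move/eqP; rewrite mulf_eq0 !subr_eq0 [v == u]gt_eqF // orbF => /eqP.
Qed.

(** By continuous induction the initial slope bounds all later ones from below: slopes are constant
    on affine pieces and can only go up where two pieces meet. *)
Lemma convex_growth G rho lam x y : x < y -> convex_germs G rho lam x y ->
  rho x <= lam y /\ rho x * (y - x) <= G y - G x.
Proof.
move=> xy [h1 h2 h3].
(* [lam] carries no information at [x] and [rho] none at [y], hence the two guards. *)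
pose P t := (x < t -> rho x <= lam t /\ rho x * (t - x) <= G t - G x) /\
            (t < y -> rho x <= rho t).
suff H : forall t, x <= t <= y -> P t.
  by have [|/(_ xy)] := H y; first by rewrite lexx ltW.
have right_slope t w u : (forall s, t <= s <= w -> G s = G t + rho t * (s - t)) ->
    x <= t -> t < u -> u < w -> u < y -> rho u = rho t.
  move=> hw xt tu uw uy; have [|w' uw' hw'] := h1 u; first by rewrite uy (le_trans xt) ?ltW.
  pose v := Num.min w w'.
  have uv : u < v by rewrite lt_min uw.
  have vw : v <= w by rewrite ge_min lexx.
  have vw' : v <= w' by rewrite ge_min lexx orbT.
  have e1 : G v = G t + rho t * (v - t) by apply: hw; rewrite vw andbT; lra.
  have e2 : G u = G t + rho t * (u - t) by apply: hw; apply/andP; lra.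
  have e3 : G v = G u + rho u * (v - u) by apply: hw'; rewrite vw' andbT; lra.
  by apply: (@slope_uniq _ _ (G u - rho u * u) (G t - rho t * t) u v uv); lra.
have left_slope t w u : (forall s, t <= s <= w -> G s = G t + rho t * (s - t)) ->
    x <= t -> t < u -> u <= w -> u <= y -> lam u = rho t.
  move=> hw xt tu uw uy; have [|w' uw' hw'] := h2 u; first by rewrite uy (le_lt_trans xt).
  pose v := Num.max t w'.
  have uv : v < u by rewrite gt_max uw' tu.
  have vw : t <= v by rewrite le_max lexx.
  have vw' : w' <= v by rewrite le_max lexx orbT.
  have e1 : G v = G t + rho t * (v - t) by apply: hw; rewrite vw; lra.
  have e2 : G u = G t + rho t * (u - t) by apply: hw; rewrite uw; lra.
  have e3 : G v = G u + lam u * (v - u) by apply: hw'; rewrite vw'; lra.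
  by apply: (@slope_uniq _ _ (G u - lam u * u) (G t - rho t * t) v u uv); lra.
apply: real_induction.
- by split=> //; rewrite ltxx.
- move=> t /andP[xt ty] [Pt1 Pt2]; have rt := Pt2 ty.
  have [|w tw hw] := h1 t; first by rewrite xt.
  pose v := (t + Num.min w y) / 2.
  have tv : t < Num.min w y by rewrite lt_min tw.
  have mw : Num.min w y <= w by rewrite ge_min lexx.
  have my : Num.min w y <= y by rewrite ge_min lexx orbT.
  exists v => [|u /andP[tu uv]]; first by rewrite /v; lra.
  move: tu; rewrite le_eqVlt => /predU1P[<- //|tu].
  have uw : u < w by move: uv; rewrite /v; lra.
  have uy : u < y by move: uv; rewrite /v; lra.
  split=> [_|_]; last by rewrite (right_slope t w u hw xt tu uw uy).
  rewrite (left_slope t w u hw xt tu (ltW uw) (ltW uy)); split=> //.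
  have tx : rho x * (t - x) <= G t - G x.
    move: xt; rewrite le_eqVlt => /predU1P[<-|/Pt1[]//].
    by rewrite !subrr mulr0.
  have -> : G u = G t + rho t * (u - t) by apply: hw; rewrite !ltW.
  have : rho x * (u - t) <= rho t * (u - t) by rewrite ler_wpM2r // subr_ge0 ltW.
  by lra.
- move=> t /andP[xt ty] Pu; have [|w wt hw] := h2 t; first by rewrite xt.
  pose u := (Num.max x w + t) / 2.
  have mt : Num.max x w < t by rewrite gt_max xt.
  have mw : w <= Num.max x w by rewrite le_max lexx orbT.
  have mx : x <= Num.max x w by rewrite le_max lexx.
  have ut : u < t by rewrite /u; lra.
  have xu : x < u by rewrite /u; lra.
  have wu : w < u by rewrite /u; lra.
  have [] := Pu u; first by rewrite ut ltW.
  move=> /(_ xu)[_ gu] /(_ (lt_le_trans ut ty)) ru.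
  have lu : rho u = lam t.
    have [|w' uw' hw'] := h1 u; first by rewrite (ltW xu) (lt_le_trans ut).
    pose v := Num.min w' t.
    have uv : u < v by rewrite lt_min uw' ut.
    have vw : v <= t by rewrite ge_min lexx orbT.
    have vw' : v <= w' by rewrite ge_min lexx.
    have e1 : G v = G t + lam t * (v - t) by apply: hw; rewrite vw andbT; lra.
    have e2 : G u = G t + lam t * (u - t) by apply: hw; apply/andP; lra.
    have e3 : G v = G u + rho u * (v - u) by apply: hw'; rewrite vw' andbT; lra.
    by apply: (@slope_uniq _ _ (G u - rho u * u) (G t - lam t * t) u v uv); lra.
  have le1 : rho x <= lam t by rewrite -lu.
  split=> [_|ty']; last by apply: (le_trans le1); apply: h3; rewrite xt.
  split=> //.
  have e2 : G u = G t + lam t * (u - t) by apply: hw; apply/andP; lra.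
  have : rho x * (t - u) <= lam t * (t - u) by rewrite ler_wpM2r // subr_ge0 ltW.
  by lra.
Qed.

Lemma convex_growth_le G rho lam x y : x < y -> convex_germs G rho lam x y ->
  G y - G x <= lam y * (y - x).
Proof.
move=> xy [h1 h2 h3].
(* The reflection [r -> - r] exchanges the one-sided slopes up to sign. *)
have [||_] := @convex_growth (fun r => G (- r)) (fun r => - lam (- r)) (fun r => - rho (- r)) (- y) (- x).
- by rewrite ltrN2.
- split=> t /andP[a b].
  + have [|w wt hw] := h2 (- t); first by apply/andP; split; lra.
    exists (- w) => [|u /andP[tu uw]]; first by lra.
    by rewrite hw; [lra|apply/andP; split; lra].
  + have [|w wt hw] := h1 (- t); first by apply/andP; split; lra.
    exists (- w) => [|u /andP[tu uw]]; first by lra.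
    by rewrite hw; [lra|apply/andP; split; lra].
  + by rewrite lerN2; apply: h3; apply/andP; split; lra.
by rewrite !opprK; lra.
Qed.

Lemma tangent_below G rho lam x y t k : x <= t <= y -> convex_germs G rho lam x y ->
  (x < t -> lam t <= k) -> (t < y -> k <= rho t) ->
  forall r, x <= r <= y -> G t + k * (r - t) <= G r.
Proof.
move=> /andP[xt ty] cv lk kr r /andP[xr ry].
have [rt|tr|->] := ltgtP r t; last by rewrite subrr mulr0 addr0.
- have := convex_growth_le rt (convex_germs_sub xr ty cv).
  have : lam t * (t - r) <= k * (t - r).
    by apply: ler_wpM2r; [rewrite subr_ge0 ltW|apply: lk; exact: le_lt_trans rt].
  by lra.
- have [_] := convex_growth tr (convex_germs_sub xt ry cv).
  have : k * (r - t) <= rho t * (r - t).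
    by apply: ler_wpM2r; [rewrite subr_ge0 ltW|apply: kr; exact: lt_le_trans ry].
  by lra.
Qed.

End ConvexGerms.

(** * Hinge functions of finitely many chips on a segment *)

Section Hinges.
Variable R : realType.
Implicit Types (P : seq (R * int)) (p : R * int) (b : bool) (t u l : \bar R) (r s : R) (m : int).

(* The chip [p] sits at the position [p.1] with multiplicity [p.2]. *)
Definition hinge P r : R := \sum_(p <- P) p.2%:~R * Num.max 0 (r - p.1).

(** A chip sitting at [t] counts when seen from the right and not from the left; the slope of
    [hinge] jumps by its multiplicity. *)
Definition passed b t p := if b then (p.1%:E < t)%E else (p.1%:E <= t)%E.
Definition chips b t P : int := \sum_(p <- P | passed b t p) p.2.
Definition moment b t P : R := \sum_(p <- P | passed b t p) p.2%:~R * p.1.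

Lemma hinge_germ P l b t : in_dom l b t ->
  nearby b t (fun u => forall s, u = s%:E ->
    hinge P s = (chips b t P)%:~R * s - moment b t P).
Proof.
move=> dt; elim: P => [|p P IH].
  apply: nearbyW (nearby_dom dt) => u _ s _.
  by rewrite /hinge /chips /moment !big_nil mul0r subr0.
have : nearby b t (fun u => forall s, u = s%:E ->
    Num.max 0 (s - p.1) = if passed b t p then s - p.1 else 0).
  rewrite /passed; case: b dt {IH} => dt.
  - have [pt|tp] := ltP p.1%:E t.
      exists p.1%:E; split=> // u /andP[pu ut] s us.
      by rewrite us lee_fin in pu; apply/max_r; rewrite subr_ge0.
    have [w [sw _]] := nearby_dom dt; exists w; split=> // u /andP[wu ut] s us.
    have := le_trans ut tp; rewrite us lee_fin => sp.
    by apply/max_l; rewrite subr_le0.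
  - have [pt|tp] := leP p.1%:E t.
      have [w [sw _]] := nearby_dom dt; exists w; split=> // u /andP[tu uw] s us.
      have := le_trans pt tu; rewrite us lee_fin => sp.
      by apply/max_r; rewrite subr_ge0.
    exists p.1%:E; split=> // u /andP[tu up] s us.
    by rewrite us lee_fin in up; apply/max_l; rewrite subr_le0.
move=> /(nearby_and IH); apply: nearbyW => u [h1 h2] s us.
rewrite /hinge /chips /moment !big_cons -/(hinge P s) (h1 _ us) (h2 _ us) /chips /moment.
by case: ifP => _; rewrite ?rmorphD /=; lra.
Qed.

(** Subtracting the hinges gives order minus the multiplicity at each chip, so [ell] uses up the
    divisor exactly. At +oo it takes the limit of its last affine piece. *)
Definition ell P m t : \bar R :=
  match t with
  | r%:E => (m%:~R * r - hinge P r)%:E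
  | +oo => aff (moment true +oo P) (m - chips true +oo P) +oo
  | -oo => -oo
  end%E.

Lemma ell_germ P m l b t : in_dom l b t ->
  germ (ell P m) b t (moment b t P) (m - chips b t P).
Proof.
move=> dt; have := nearby_and (nearby_dom dt) (hinge_germ P dt).
case: t dt => [t| |] dt; last by case/andP: dt => /andP[].
- have [w [sw _]] := nearby_dom dt; have [r [sr _]] := side_pick dt sw.
  move=> /(nearby_and (nearby_side sr)).
  apply: nearbyW => -[u| |]; last by move=> [_ []].
    by move=> [_ [_ /(_ u erefl) h]]; rewrite aff_fin /= h rmorphB /=; congr _%:E; lra.
  by rewrite /between; case: (b) => -[/andP[]]; rewrite ?leye_eq.
- have bE : b by case: b dt => // /andP[_]; rewrite ltNge leey.
  rewrite bE; apply: nearbyW => -[u| |] //; last by move=> [].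
  by move=> [_ /(_ u erefl) h]; rewrite aff_fin /= h rmorphB /=; congr _%:E; lra.
Qed.

Lemma hinge_ge0 P r : all (fun p => 0 <= p.2) P -> 0 <= hinge P r.
Proof.
move=> /allP h; rewrite /hinge big_seq; apply: sumr_ge0 => p /h p0.
by rewrite mulr_ge0 ?ler0z // le_max lexx.
Qed.

Lemma hinge0 P : all (fun p => 0 < p.1) P -> hinge P 0 = 0.
Proof.
move=> /allP h; rewrite /hinge big_seq big1 // => p /h p0.
by rewrite max_l ?mulr0 // sub0r oppr_le0 ltW.
Qed.

Definition total P : int := \sum_(p <- P) p.2.

Lemma hinge_le P r : 0 <= r -> all (fun p => 0 < p.1) P -> all (fun p => 0 <= p.2) P ->
  hinge P r <= (total P)%:~R * r.
Proof.
move=> r0 /allP h /allP h2; rewrite /hinge /total rmorph_sum /= mulr_suml.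
rewrite big_seq [leRHS]big_seq; apply: ler_sum => p pP.
rewrite ler_wpM2l ?ler0z ?h2 // ge_max r0 /= gerBl ltW //; exact: h.
Qed.

Lemma chips0 P : all (fun p => 0 < p.1) P -> chips false 0 P = 0.
Proof.
move=> /allP h; rewrite /chips big_seq_cond big1 // => p /andP[/h p0].
by rewrite /passed lee_fin leNgt p0.
Qed.

Lemma chips_jump P (r : R) : chips false r%:E P = chips true r%:E P + \sum_(p <- P | p.1 == r) p.2.
Proof.
rewrite /chips [LHS](bigID (fun p => p.1 == r)) /= addrC; congr (_ + _); apply: eq_bigl => p.
- by rewrite /passed lte_fin lee_fin lt_neqAle andbC.
- by rewrite /passed lee_fin; case: eqP => [->|]; rewrite ?lexx ?andbF.
Qed.

Lemma chips_all P t : all (fun p => p.1%:E < t)%E P -> chips true t P = total P.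
Proof.
move=> /allP h; rewrite /chips /total big_seq_cond [RHS]big_seq; apply: eq_bigl => p.
by rewrite /passed; case: (boolP (p \in P)) => //= /h ->.
Qed.

End Hinges.

(** * The order condition inside an edge as convexity *)

Section EdgeConvexity.
Variables (R : realType) (G : wgraph R) (D : divisor G).
Hypothesis D_ge0 : effective D.
Implicit Types (f g : fct G) (e : edge G) (d : edge G * bool) (b : bool) (t : \bar R)
  (x : mgraph G) (v w : vertex G).

Definition echips e : seq (R * int) :=
  pmap (fun x : mgraph G => if x is inr p then
          if (val p).1 == e then Some ((val p).2, D x) else None else None)
       (enum_fset (finsupp D)).

Lemma echipsP e q : q \in echips e ->
  exists p, [/\ (val p).1 = e, (val p).2 = q.1 & q.2 = D (inr p)].
Proof.
rewrite mem_pmap => /mapP[[v|p] // _]; case: eqP => // pe [->].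
by exists p.
Qed.

Lemma echips_gt0 e : all (fun q => 0 < q.1) (echips e).
Proof.
apply/allP => q /echipsP[p [_ <- _]].
by have := valP p => /andP[]; rewrite lte_fin.
Qed.

Lemma echips_lt e : all (fun q => q.1%:E < len e)%E (echips e).
Proof. by apply/allP => q /echipsP[p [<- <- _]]; have := valP p => /andP[]. Qed.

Lemma echips_ge0 e : all (fun q => 0 <= q.2) (echips e).
Proof. by apply/allP => q /echipsP[p [_ _ ->]]; exact: D_ge0. Qed.

Lemma echips_at (p : {p : edge G * R | (0 < p.2%:E < len p.1)%E}) :
  \sum_(q <- echips (val p).1 | q.1 == (val p).2) q.2 = D (inr p).
Proof.
rewrite /echips big_mkcond big_pmap.
pose F (x : mgraph G) := if x == inr p then D x else 0.
rewrite (eq_bigr F) => [|[v|q] _]; rewrite /F //; last first.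
  rewrite (inj_eq (@inr_inj _ _)) -val_eqE.
  case: (val q) (val p) => [e r] [e' r'] /=; rewrite xpair_eqE.
  by case: eqP => //= _; case: eqP.
have [pD|pD] := boolP (inr p \in finsupp D).
  rewrite (bigD1_seq (inr p)) ?fset_uniq //= eqxx big1 ?addr0 // => x.
  by move=> /negPf ->.
rewrite fsfun_dflt // big_seq big1 // => x xD; case: eqP => // xp.
by move: pD; rewrite -xp xD.
Qed.

Lemma total_ge0 e : 0 <= total (echips e).
Proof.
rewrite /total big_seq; apply: sumr_ge0 => q; exact: (allP (echips_ge0 e)).
Qed.

Lemma outgoingK b : involutive (outgoing b).
Proof. by move=> k; case: b; rewrite //= opprK. Qed.

Lemma system_germ f e b t : in_system D f -> in_dom (len e) b t ->
  exists a, germ (along f e) b t a (outgoing b (oslope f (e, b) t)).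
Proof.
move=> [_ fl] dt; have [dx tE] := at_pt_edge_pt dt.
have [m [fm _]] := fl (edge_pt e t); have sm := fm _ dx.
have := has_slope_oslope dx sm; rewrite tE => ->.
case: sm => a [k [+ ->]]; rewrite tE => h.
by exists a; rewrite outgoingK.
Qed.

Lemma system_ord f x : in_system D f ->
  0 <= D x + \sum_(d | at_pt x d) oslope f d (pos x d).
Proof.
move=> [_ fl]; have [m [fm mD]] := fl x; rewrite (eq_bigr m) // => d dx.
by apply: has_slope_oslope => //; exact: fm.
Qed.

Lemma sum_interior p (F : edge G * bool -> int) :
  \sum_(d | at_pt (inr p) d) F d = F ((val p).1, false) + F ((val p).1, true).
Proof.
rewrite big_mkcond (eq_bigr (fun d => if at_pt (inr p) (d.1, d.2) then F (d.1, d.2) else 0));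
  last by case.
rewrite -(pair_bigA _ (fun e b => if at_pt (inr p) (e, b) then F (e, b) else 0)) /=.
rewrite (bigD1 (val p).1) //= [X in _ + X = _]big1 => [|e /negPf eN].
  by rewrite big_bool /= eqxx addr0 addrC.
by rewrite big_bool /= eN.
Qed.

(* Adding the hinges at the chips makes the restriction of f to e convex. *)
Definition convexified f e (r : R) : R := fine (along f e r%:E) + hinge (echips e) r.

(** The one-sided derivative of [convexified f e] at [r], in the direction from [src e] to [tgt e]
    on both sides. *)
Definition cslope f e b (r : R) : int :=
  outgoing b (oslope f (e, b) r%:E) + chips b r%:E (echips e).

Lemma in_dom_not_infinity e b (r : R) : in_dom (len e) b r%:E -> ~ at_infinity (edge_pt e r%:E).
Proof. by move=> /at_pt_edge_pt[dx + /(at_infinity_pos dx)] => ->. Qed.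

Lemma in_dom_ex e t : (0 <= t <= len e)%E -> exists b, in_dom (len e) b t.
Proof.
move=> /andP[t0 tl]; have [tp|tn] := boolP (0 < t)%E.
  by exists true; rewrite /in_dom t0 tl.
exists false; rewrite /in_dom t0 tl /=; apply: le_lt_trans (len_gt0 e).
by rewrite leNgt.
Qed.

Lemma along_fine f e (r : R) : in_system D f -> (0 <= r%:E <= len e)%E ->
  along f e r%:E = (fine (along f e r%:E))%:E.
Proof.
move=> [ff _] /in_dom_ex[b /in_dom_not_infinity nx].
by rewrite fineK //; exact: ff.
Qed.

Lemma convexified_germ f e b (r : R) : in_system D f -> in_dom (len e) b r%:E ->
  exists w : R, side b r%:E w%:E /\ forall u : R, between b r%:E w%:E u%:E ->
    convexified f e u = convexified f e r + (cslope f e b r)%:~R * (u - r).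
Proof.
move=> fS dr; have [a fg] := system_germ fS dr.
have [w [sw hw]] := nearby_and fg (hinge_germ (echips e) dr).
have [s [sr bs]] := side_pick dr sw.
exists s; split=> // u bu.
have buw : between b r%:E w u%:E.
  case: (b) bs bu => /= /andP[h1 h2] /andP[h3 h4]; apply/andP; split=> //.
    exact: le_trans h3.
  exact: le_trans h2.
have brw : between b r%:E w r%:E.
  by case: (b) sw => /= /ltW; rewrite lexx ?andbT.
have [f1 /(_ u erefl) h1] := hw _ buw; have [f2 /(_ r erefl) h2] := hw _ brw.
rewrite /convexified f1 f2 h1 h2 !aff_fin /= /cslope rmorphD /=.
by lra.
Qed.

(** At an interior point the jump from the left to the right slope is the order of [f] plus the chip
    of [D], hence nonnegative. The real bound [y] stands in for [len e], which may be infinite. *)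
Lemma convexified_convex f e (y : R) : in_system D f -> (y%:E <= len e)%E ->
  convex_germs (convexified f e) (fun r => (cslope f e false r)%:~R)
    (fun r => (cslope f e true r)%:~R) 0 y.
Proof.
move=> fS yl; split=> t /andP[t0 ty].
- have [|w [sw hw]] := @convexified_germ f e false t fS.
    by rewrite /in_dom lee_fin t0 /=; apply/andP; split; [apply: le_trans yl|apply: lt_le_trans yl];
      rewrite ?lee_fin ?lte_fin // ltW.
  by exists w; rewrite -?lte_fin // => u; rewrite -!lee_fin => /hw.
- have [|w [sw hw]] := @convexified_germ f e true t fS.
    by rewrite /in_dom lee_fin lte_fin t0 ltW //= andbT; apply: le_trans yl; rewrite lee_fin.
  by exists w; rewrite -?lte_fin // => u; rewrite -!lee_fin => /hw.
- have [|p [pE vp]] := @edge_pt_interior _ _ e t.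
    by rewrite lte_fin t0; apply: lt_le_trans yl; rewrite lte_fin.
  have := system_ord (inr p) fS; rewrite sum_interior -echips_at /= vp /=.
  by rewrite /cslope /= chips_jump ler_int; lra.
Qed.

Lemma convexified0 f e : convexified f e 0 = fine (f (inl (src e))).
Proof. by rewrite /convexified hinge0 ?echips_gt0 // addr0 /along edge_pt0. Qed.

Lemma cslope0 f e : cslope f e false 0 = oslope f (e, false) 0.
Proof. by rewrite /cslope chips0 ?echips_gt0 // addr0. Qed.

Lemma cslope_len f e (l : R) : len e = l%:E ->
  cslope f e true l = - oslope f (e, true) l%:E + total (echips e).
Proof.
move=> el; rewrite /cslope chips_all //; have := echips_lt e.
by rewrite el.
Qed.

Lemma cslope_mono f e (r s : R) : in_system D f -> 0 <= r -> r < s -> (s%:E <= len e)%E ->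
  cslope f e false r <= cslope f e true s.
Proof.
move=> fS r0 rs sl; rewrite -(ler_int R).
have cv := convex_germs_sub r0 (lexx s) (convexified_convex fS sl).
by have [] := convex_growth rs cv.
Qed.

Lemma cslope_le f e (r : R) : in_system D f -> 0 < r -> (r%:E < len e)%E ->
  cslope f e true r <= cslope f e false r.
Proof.
move=> fS r0 rl; rewrite -(ler_int R).
have [y [ry yl]] : exists y : R, r < y /\ (y%:E <= len e)%E.
  case: (len e) rl => [l| |] // rl; first by exists l.
  by exists (r + 1); rewrite leey; split=> //; lra.
by have [_ _] := convexified_convex fS yl; apply; rewrite r0.
Qed.

Lemma cslope_final f e (r : R) (w : \bar R) : in_system D f -> len e = +oo%E -> (w < +oo)%E ->
  exists y : R, [/\ 0 < y, r < y, (w < y%:E)%E &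
    cslope f e true y = - oslope f (e, true) +oo%E + total (echips e)].
Proof.
move=> fS eoo w0oo.
have dt : in_dom (len e) true +oo%E by rewrite /in_dom eoo lexx leey ltry.
have [a [w1 [sw1 hw]]] := system_germ fS dt.
have [w' ww'] : exists w' : R, (Order.max w w1 <= w'%:E)%E.
  have : (Order.max w w1 < +oo)%E by rewrite gt_max w0oo.
  by case: (Order.max w w1) => [z| |] //= _; [exists z|exists 0; rewrite leNye].
move: ww'; rewrite ge_max => /andP[ww' w1w'].
have S0 : 0 <= \sum_(q <- echips e) q.1.
  by rewrite big_seq; apply: sumr_ge0 => q qe; rewrite ltW // (allP (echips_gt0 e)).
pose m := Num.max (Num.max r 0) w'.
have [m0 m1 m2] : [/\ 0 <= m, r <= m & w' <= m].
  by rewrite /m !le_max !lexx !orbT.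
(* Chip positions are positive, so their sum bounds each of them and [y] lies beyond every chip as
   well as beyond [r], [w] and the start of the last affine piece. *)
pose y := m + 1 + \sum_(q <- echips e) q.1.
have wy : (w1 < y%:E)%E by apply: le_lt_trans w1w' _; rewrite lte_fin /y; lra.
exists y; split; [by rewrite /y; lra|by rewrite /y; lra| |].
  by apply: le_lt_trans ww' _; rewrite lte_fin /y; lra.
rewrite /cslope chips_all; last first.
  apply/allP => q qe; rewrite lte_fin.
  suff : q.1 <= \sum_(q <- echips e) q.1 by rewrite /y; lra.
  rewrite (big_rem _ qe) /= lerDl big_seq; apply: sumr_ge0 => q' /mem_rem qe'.
  by rewrite ltW // (allP (echips_gt0 e)).
suff -> : oslope f (e, true) y%:E = oslope f (e, true) +oo%E by [].
have y0 : 0 < y by rewrite /y; lra.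
have dy : in_dom (len e) true y%:E.
  by rewrite /in_dom eoo lee_fin lte_fin leey y0 ltW.
have fy : germ (along f e) true y%:E a (outgoing true (oslope f (e, true) +oo%E)).
  by exists w1; split=> // u /andP[wu uy]; apply: hw; rewrite /= wu leey.
by rewrite (germ_oslope dy fy) outgoingK.
Qed.

Lemma cslope_infinite f e (r : R) : in_system D f -> len e = +oo%E -> 0 <= r ->
  cslope f e false r <= - oslope f (e, true) +oo%E + total (echips e).
Proof.
move=> fS eoo r0; have [y [_ ry _ <-]] := cslope_final r fS eoo (ltry 0).
by apply: cslope_mono => //; rewrite eoo leey.
Qed.

End EdgeConvexity.

(** * The slope bound *)

Section SlopeBound.
Variables (R : realType) (G : wgraph R) (D : divisor G).
Hypothesis D_ge0 : effective D.
Implicit Types (f g : fct G) (e : edge G) (d : edge G * bool) (b : bool) (t : \bar R)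
  (x : mgraph G) (v w : vertex G).

Definition edge_end d : vertex G := if d.2 then tgt d.1 else src d.1.
Definition end_pos d : \bar R := if d.2 then len d.1 else 0%E.
Definition opposite d : edge G * bool := (d.1, ~~ d.2).

Lemma at_pt_end d : at_pt (inl (edge_end d)) d.
Proof. exact: eqxx. Qed.

Lemma edge_pt_end d : edge_pt d.1 (end_pos d) = inl (edge_end d).
Proof. by rewrite -(edge_pt_pos (at_pt_end d)). Qed.

Lemma end_pos_fin d : ~ at_infinity (inl (edge_end d) : mgraph G) <-> end_pos d \is a fin_num.
Proof.
split=> [|fin /(at_infinity_pos (at_pt_end d)) dE]; first exact: (pos_fin (at_pt_end d)).
by move: fin; rewrite (_ : end_pos d = +oo%E).
Qed.

(** Along the edge the convexified function keeps at least its initial slope, and the hinges account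
    for at most [total] of it. What remains is a positive rise of [f], and a steep descent when
    looking back from the other end. *)
Lemma climb f d : in_system D f ->
  ~ at_infinity (inl (edge_end d) : mgraph G) ->
  ~ at_infinity (inl (edge_end (opposite d)) : mgraph G) ->
  let s := oslope f d (end_pos d) in
  total (echips D d.1) < s ->
  (f (inl (edge_end d)) < f (inl (edge_end (opposite d))))%E /\
  oslope f (opposite d) (end_pos (opposite d)) <= total (echips D d.1) - s.
Proof.
move=> fS nd nd' /=.
have [l el] : exists l : R, len d.1 = l%:E.
  have : len d.1 \is a fin_num.
    by case: (d) nd nd' => e [|] /end_pos_fin + /end_pos_fin.
  by case: (len d.1) => // l _; exists l.
have l0 : 0 < l by have := len_gt0 d.1; rewrite el lte_fin.
have ll : (l%:E <= len d.1)%E by rewrite el.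
have cv := convexified_convex fS ll.
have [sl gr] := convex_growth l0 cv; have gr' := convex_growth_le l0 cv.
rewrite ler_int in sl.
have fe0 : along f d.1 0%:E = (fine (along f d.1 0%:E))%:E.
  by apply: along_fine fS _; rewrite el !lee_fin lexx ltW.
have fel : along f d.1 l%:E = (fine (along f d.1 l%:E))%:E.
  by apply: along_fine fS _; rewrite el !lee_fin lexx ltW.
have hl := hinge_le (ltW l0) (echips_gt0 D d.1) (echips_ge0 D_ge0 d.1).
have hl0 := hinge_ge0 l (echips_ge0 D_ge0 d.1).
have conE : convexified D f d.1 l = fine (along f d.1 l%:E) + hinge (echips D d.1) l by [].
rewrite convexified0 conE {conE} in gr gr'.
rewrite cslope0 ?(cslope_len _ _ el) in sl gr gr'.
have src0 : f (inl (src d.1)) = (fine (along f d.1 0%E))%:E by rewrite -fe0 /along edge_pt0.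
have tgtl : f (inl (tgt d.1)) = (fine (along f d.1 l%:E))%:E by rewrite -fel /along -el edge_pt_len.
rewrite /along edge_pt0 in src0.
case: d el cv sl gr gr' fe0 fel hl hl0 src0 tgtl {nd nd' ll} => e b /= el cv sl gr gr' fe0 fel hl hl0 src0 tgtl.
rewrite /opposite /edge_end /end_pos /=; case: b => /= ts.
- rewrite el in ts *; split; last by move: sl; clear; lra.
  rewrite src0 tgtl lte_fin.
  have : 0 < ((oslope f (e, true) l%:E)%:~R - (total (echips D e))%:~R : R) * l.
    by rewrite mulr_gt0 // subr_gt0 ltr_int.
  by move: gr' hl0; rewrite rmorphD rmorphN /=; clear; lra.
- rewrite el; split; last by move: sl; clear; lra.
  rewrite src0 tgtl lte_fin.
  have : 0 < ((oslope f (e, false) 0%E)%:~R - (total (echips D e))%:~R : R) * l.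
    by rewrite mulr_gt0 // subr_gt0 ltr_int.
  by move: gr hl; clear; lra.
Qed.

Lemma sum_le_total (I : finType) (F : I -> int) i : (forall i, 0 <= F i) -> F i <= \sum_i F i.
Proof. by move=> F0; rewrite (bigD1 i) //= lerDl sumr_ge0. Qed.

(** The degree of [D]. *)
Definition chip_bound : int := \sum_e total (echips D e) + \sum_(v : vertex G) D (inl v).

Lemma chip_boundP : [/\ 0 <= chip_bound, forall e, total (echips D e) <= chip_bound,
  forall v, D (inl v) <= chip_bound & forall e v, total (echips D e) + D (inl v) <= chip_bound].
Proof.
have h1 e : total (echips D e) <= \sum_e total (echips D e).
  by apply: sum_le_total => e'; exact: total_ge0.
have h2 v : D (inl v) <= \sum_(v : vertex G) D (inl v).
  by apply: (sum_le_total (F := fun v : vertex G => D (inl v))) => v'; exact: D_ge0.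
have h3 : 0 <= \sum_e total (echips D e) by apply: sumr_ge0 => e _; exact: total_ge0.
have h4 : 0 <= \sum_(v : vertex G) D (inl v) by apply: sumr_ge0 => v _; exact: D_ge0.
rewrite /chip_bound; split=> [|e|v|e v]; first exact: addr_ge0.
- by have := h1 e; lra.
- by have := h2 v; lra.
- by have := h1 e; have := h2 v; lra.
Qed.

(** The order condition at the leaf caps the final slope, and convexity carries the cap back to
    [src e]. *)
Lemma oslope_infinite f e : in_system D f -> len e = +oo%E ->
  oslope f (e, false) 0%E <= chip_bound /\ oslope f (e, true) +oo%E >= - D (inl (tgt e)).
Proof.
move=> fS eoo.
have := cslope_infinite fS eoo (lexx 0); rewrite cslope0 => le1.
have := system_ord (inl (tgt e)) fS; rewrite sum_at_infinity //= eoo => le2.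
by have [_ _ _ /(_ e (tgt e))] := chip_boundP; lra.
Qed.

Let ndir : int := #|{: edge G * bool}|%:Z.

(** Bound on a slope [s] out of a vertex with at most [n] vertices above it. At the far end of the
    climb the chips, the slope back of at most [chip_bound - s], and at most [ndir] slopes bounded
    by the previous stage must have nonnegative sum. *)
Fixpoint height_bound (n : nat) : int :=
  if n is n'.+1 then 2 * chip_bound + ndir * height_bound n' else chip_bound.

Lemma height_bound_ge n : chip_bound <= height_bound n.
Proof.
have [c0 _ _ _] := chip_boundP.
elim: n => //= n IH; have : 0 <= ndir * height_bound n by rewrite mulr_ge0 // (le_trans c0).
by lra.
Qed.

(* If f leaves v with a large slope along an edge, it rises up to the other
   end w, where the order condition forces it to leave with a large slope
   again; this climbing has to stop. *)
Lemma oslope_height f n d : in_system D f ->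
  ~ at_infinity (inl (edge_end d) : mgraph G) ->
  (#|[set w | (f (inl (edge_end d)) < f (inl w))%E]%SET| <= n)%N ->
  oslope f d (end_pos d) <= height_bound n.
Proof.
have [c0 te Dv teDv] := chip_boundP.
(* A slope above [chip_bound] cannot lead to a point at infinity, by [oslope_infinite]. *)
move=> fS; have far d' : chip_bound < oslope f d' (end_pos d') ->
    ~ at_infinity (inl (edge_end (opposite d')) : mgraph G).
  move=> big inf'; have := at_infinity_pos (at_pt_end (opposite d')) inf'.
  case: d' inf' big => e [|] //= inf' big eoo.
  by have [le1 _] := oslope_infinite fS eoo; move: le1 big; rewrite /end_pos /= leNgt => /negbTE ->.
elim: n d => [|n IH] d nd card; rewrite leNgt; apply/negP => big.
  have [|up _] := climb fS nd (far d big); first exact: le_lt_trans big.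
  move: card; rewrite leqn0 cards_eq0 => /eqP/setP/(_ (edge_end (opposite d))).
  by rewrite !inE up.
have big' := le_lt_trans (height_bound_ge n.+1) big.
have nd' := far d big'.
have [|up back] := climb fS nd nd'; first exact: le_lt_trans big'.
have IH' d' : edge_end d' = edge_end (opposite d) -> oslope f d' (end_pos d') <= height_bound n.
  move=> d'E; apply: IH; rewrite d'E //.
  rewrite -ltnS; apply: leq_trans card; apply: proper_card.
  apply/properP; split.
    by apply/fintype.subsetP => w; rewrite !inE; exact: lt_trans.
  by exists (edge_end (opposite d)); rewrite !inE ?ltxx.
have := system_ord (inl (edge_end (opposite d))) fS.
rewrite (bigD1 (opposite d)) ?at_pt_end //=.
have : \sum_(d' | at_pt (inl (edge_end (opposite d))) d' && (d' != opposite d))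
    oslope f d' (end_pos d') <= ndir * height_bound n.
  apply: (@le_trans _ _ (\sum_(d' : edge G * bool) height_bound n)).
    rewrite [leLHS]big_mkcond; apply: ler_sum => d' _.
    case: ifP => [/andP[/eqP d'E _]|_]; first exact: IH'.
    by apply: le_trans (height_bound_ge n).
  by rewrite sumr_const -mulr_natl natz.
have := Dv (edge_end (opposite d)); have := te d.1.
by move: back big => /=; clear; lra.
Qed.

(** The last term covers the upper bound. The order condition turns upper bounds on the other slopes
    into a lower bound with one [chip_bound] and the [ndir] term; the second [chip_bound] is a
    margin for the hinges, spent when the slope is read at [tgt e]. *)
Definition slope_bound : int :=
  2 * chip_bound + ndir * height_bound #|vertex G| + height_bound #|vertex G|.

Lemma oslope_bound f d : in_system D f ->
  ~ at_infinity (inl (edge_end d) : mgraph G) ->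
  - slope_bound + chip_bound <= oslope f d (end_pos d) <= slope_bound.
Proof.
move=> fS nd; have ub d' : edge_end d' = edge_end d -> oslope f d' (end_pos d') <= height_bound #|vertex G|.
  by move=> d'E; apply: oslope_height => //; rewrite ?d'E // max_card.
have [c0 te Dv teDv] := chip_boundP; have h0 := height_bound_ge #|vertex G|.
have n0 : 0 <= ndir * height_bound #|vertex G| by rewrite mulr_ge0 // (le_trans c0).
apply/andP; split; last by have := ub d erefl; rewrite /slope_bound; lra.
have := system_ord (inl (edge_end d)) fS; rewrite (bigD1 d) ?at_pt_end //=.
have : \sum_(d' | at_pt (inl (edge_end d)) d' && (d' != d))
    oslope f d' (end_pos d') <= ndir * height_bound #|vertex G|.
  apply: (@le_trans _ _ (\sum_(d' : edge G * bool) height_bound #|vertex G|)).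
    rewrite [leLHS]big_mkcond; apply: ler_sum => d' _.
    case: ifP => [/andP[/eqP d'E _]|_]; first exact: ub.
    by apply: le_trans h0.
  by rewrite sumr_const -mulr_natl natz.
by have := Dv (edge_end d); rewrite /slope_bound; move: h0 n0 c0; clear; lra.
Qed.

Lemma src_not_infinity e : ~ at_infinity (inl (src e) : mgraph G).
Proof. exact/(end_pos_fin (e, false)). Qed.

(** Slopes grow along the edge, so the first is bounded from below and the last from above; on an
    infinite edge the last one is controlled at the leaf. *)
Lemma cslope_bound f e b (r : R) : in_system D f -> in_dom (len e) b r%:E ->
  - slope_bound <= cslope D f e b r <= slope_bound.
Proof.
move=> fS dr; have [c0 te Dv teDv] := chip_boundP; have h0 := height_bound_ge #|vertex G|.
have n0 : 0 <= ndir * height_bound #|vertex G| by rewrite mulr_ge0 // (le_trans c0).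
have /andP[lo hi] := oslope_bound (d := (e, false)) fS (@src_not_infinity e).
have cB : chip_bound <= slope_bound by rewrite /slope_bound; lra.
rewrite -(cslope0 D) in lo hi.
have upL (l : R) : len e = l%:E -> cslope D f e true l <= slope_bound.
  move=> el; rewrite (cslope_len _ _ el).
  have lf : len e \is a fin_num by rewrite el.
  have /andP[+ _] := oslope_bound (d := (e, true)) fS ((end_pos_fin (e, true)).2 lf).
  by rewrite /end_pos /= el; move: (te e); clear; lra.
have upR (s : R) : 0 <= s -> (s%:E < len e)%E -> cslope D f e false s <= slope_bound.
  move=> s0; case el : (len e) => [l| |] // sl.
    apply: le_trans (upL _ el); apply: cslope_mono => //; by rewrite ?el.
  have [_] := oslope_infinite fS el; have := cslope_infinite fS el s0.
  by move: (teDv e (tgt e)) cB; clear; lra.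
move: dr => /andP[/andP[r0 rl]]; rewrite lee_fin in r0.
case: b => h.
- rewrite lte_fin in h; rewrite (le_trans _ (cslope_mono fS (lexx 0) h rl)) ?andTb; last by lra.
  move: rl; rewrite le_eqVlt => /predU1P[rl|rl]; first exact: upL.
  by apply: le_trans (cslope_le fS h rl) _; exact: upR.
- rewrite upR // andbT; move: r0; rewrite le_eqVlt => /predU1P[<-|r0]; first by lra.
  apply: le_trans (cslope_le fS r0 h).
  by apply: le_trans (cslope_mono fS (lexx 0) r0 rl); lra.
Qed.

End SlopeBound.

(** * Heights of supporting lines *)

Section Representation.
Variables (R : realType) (G : wgraph R) (D : divisor G).
Hypothesis D_ge0 : effective D.
Implicit Types (f g : fct G) (e : edge G) (d : edge G * bool) (b : bool) (t : \bar R)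
  (x : mgraph G) (v w : vertex G).

Definition slope_index := 'I_((absz (slope_bound D)) * 2).+1.
Definition slope_of (i : slope_index) : int := i%:Z - (absz (slope_bound D))%:Z.

Lemma slope_ofP (k : int) : - slope_bound D <= k <= slope_bound D ->
  exists i, slope_of i = k.
Proof.
move=> /andP[k1 k2].
have kN : (absz (k + slope_bound D)%R < (absz (slope_bound D) * 2).+1)%N by lia.
by exists (Ordinal kN); rewrite /slope_of /=; lia.
Qed.

Lemma slope_of_inj : injective slope_of.
Proof. by move=> i j /addIr[] /ord_inj. Qed.

(** Minus the Legendre transform of the convexified function at an integer slope. Only real
    parameters enter, and on an infinite edge a slope above the final one gives -oo. *)
Definition rep_ereal f e (i : slope_index) : \bar R :=
  ereal_inf [set (convexified D f e r - (slope_of i)%:~R * r)%:E | r in [set r : R | (0 <= r%:E <= len e)%E]].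

Lemma rep_subproof f e i : rep_ereal f e i != +oo%E.
Proof.
have : (rep_ereal f e i <= (convexified D f e 0 - (slope_of i)%:~R * 0)%:E)%E.
  by apply: ereal_inf_lbound; exists 0 => //=; rewrite lexx ltW // len_gt0.
by case: (rep_ereal f e i).
Qed.

Definition rep f e i : tropical R := Trop (rep_subproof f e i).

Local Notation line e i := (ell (echips D e) (slope_of i)).

Lemma rep_le f e i (r : R) : in_system D f -> (0 <= r%:E <= len e)%E ->
  (tval (rep f e i) + line e i r%:E <= along f e r%:E)%E.
Proof.
move=> fS rl; rewrite (along_fine fS rl) /=.
have : (tval (rep f e i) <= (convexified D f e r - (slope_of i)%:~R * r)%:E)%E.
  by apply: ereal_inf_lbound; exists r.
case: (tval _) => [z| //|_]; last by rewrite addNye leNye.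
by rewrite /ell -EFinD !lee_fin /convexified; clear; lra.
Qed.

(** A line whose slope is a one-sided derivative at [r] supports a convex function there, so the
    infimum is attained at [r]; [cslope_bound] puts this slope in the index range. *)
Lemma rep_tangent f e b (r : R) : in_system D f -> in_dom (len e) b r%:E ->
  exists i, slope_of i = cslope D f e b r /\
    along f e r%:E = (tval (rep f e i) + line e i r%:E)%E.
Proof.
move=> fS dr; have [i iE] := slope_ofP (cslope_bound D_ge0 fS dr); exists i; split=> //.
have /andP[rl side0] := dr.
apply/le_anti; rewrite rep_le // andbT (along_fine fS rl) /=.
suff : ((convexified D f e r - (slope_of i)%:~R * r)%:E <= tval (rep f e i))%E.
  case: (tval _) => [z|_|//]; last by rewrite leey.
  by rewrite /ell -EFinD !lee_fin /convexified; clear; lra.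
apply: le_ereal_inf_tmp => _ [s /= sl <-]; rewrite lee_fin.
have /andP[r0 rle] := rl; have /andP[s0 sle] := sl; rewrite !lee_fin in r0 s0.
have [y [yl ry sy]] : exists y : R, [/\ (y%:E <= len e)%E, r <= y & s <= y].
  exists (Num.max r s); rewrite !le_max !lexx orbT; split=> //.
  by rewrite /Order.max; case: ifP.
suff : convexified D f e r + (slope_of i)%:~R * (s - r) <= convexified D f e s by clear; lra.
apply: (tangent_below (t := r) _ (convexified_convex fS yl)); rewrite ?r0 ?s0 //.
- move=> r0'; rewrite iE ler_int; case: (b) side0 => // h.
  by apply: cslope_le.
- move=> ry'; rewrite iE ler_int; case: (b) side0 => // h.
  apply: cslope_le => //.
  by apply: lt_le_trans yl; rewrite lte_fin.
Qed.

(** At +oo the line of the final slope gives the value of [f]. Steeper lines have height -oo, and a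
    flatter one ends at -oo unless [f] ends at +oo. *)
Lemma rep_infinite f e : in_system D f -> len e = +oo%E ->
  [/\ forall i, D (inl (tgt e)) + total (echips D e) < slope_of i -> rep f e i = 0,
      forall i, (tval (rep f e i) + line e i +oo <= along f e +oo)%E
    & exists i, along f e +oo%E = (tval (rep f e i) + line e i +oo)%E].
Proof.
move=> fS eoo.
have dt : in_dom (len e) true +oo%E by rewrite /in_dom eoo lexx leey ltry.
have [a fg] := system_germ fS dt; have aoo := nearby_at fg.
move: fg aoo; set k := outgoing true _ => fg aoo.
have [w [sw hw]] := nearby_and fg (hinge_germ (echips D e) dt).
have kD : k <= D (inl (tgt e)).
  have [_] := oslope_infinite D_ge0 fS eoo; rewrite /k /outgoing; lra.
have chE : chips true +oo%E (echips D e) = total (echips D e).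
  by apply: chips_all; apply/allP => q _; exact: ltry.
set mo := moment true +oo%E (echips D e) in hw; rewrite chE in hw.
have conv_far (s : R) : (w <= s%:E)%E ->
    convexified D f e s = a - mo + (k + total (echips D e))%:~R * s.
  move=> ws; have [|f1 /(_ s erefl) h1] := hw s%:E; first by rewrite /= ws leey.
  by rewrite /convexified f1 h1 aff_fin /= rmorphD /=; lra.
have steep i : k + total (echips D e) < slope_of i -> rep f e i = 0.
  move=> ki; apply/eqP; rewrite trop_eq0; case E : (tval (rep f e i)) (tval_noo (rep f e i)) => [z| |] // _.
  have [w' ww'] : exists w' : R, (w <= w'%:E)%E.
    by case: (w) sw => [w'| |] //= _; [exists w'|exists 0; rewrite leNye].
  (* The excess slope is at least 1, so at this [s] the difference has dropped to [z - 1] or less,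
     below the supposed infimum [z]. *)
  pose s := Num.max (Num.max w' 0) (a - mo - z + 1).
  have [s1 s2 s3] : [/\ w' <= s, 0 <= s & a - mo - z + 1 <= s].
    by rewrite /s !le_max !lexx !orbT.
  have : (tval (rep f e i) <= (convexified D f e s - (slope_of i)%:~R * s)%:E)%E.
    by apply: ereal_inf_lbound; exists s => //=; rewrite eoo lee_fin leey s2.
  rewrite E lee_fin conv_far; last by apply: le_trans ww' _; rewrite lee_fin.
  have : 1 <= ((slope_of i)%:~R - (k + total (echips D e))%:~R : R).
    by rewrite -rmorphB /= ler1z -gtz0_ge1 subr_gt0.
  by move=> /(ler_wpM2r s2); lra.
have [y [y0 _ wy yE]] := cslope_final 0 fS eoo sw.
have dy : in_dom (len e) true y%:E by rewrite /in_dom eoo lee_fin lte_fin leey ltW.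
have [i0 [i0E hi0]] := rep_tangent fS dy.
have {yE} i0E : slope_of i0 = k + total (echips D e) by rewrite i0E yE.
have rep0 : tval (rep f e i0) = (a - mo)%:E.
  move: hi0; have [|-> /(_ y erefl) h1] := hw y%:E; first by rewrite /= ltW // leey.
  rewrite aff_fin /= h1 i0E; case: (tval _) => [z| |] //= [] h; congr _%:E.
  by move: h; rewrite rmorphD /=; lra.
have line_oo i : line e i +oo%E = aff mo (slope_of i - total (echips D e)) +oo by rewrite /= chE.
split=> [i hi|i|].
- by apply: steep; lra.
- rewrite aoo; have [lt_i|gt_i|eq_i] := ltgtP (slope_of i) (k + total (echips D e)).
  + rewrite line_oo !aff_oo.
    have [k0|k0] := ltP 0 k; first by rewrite [k == 0]gt_eqF // leey.
    have ni : slope_of i - total (echips D e) < 0 by move: lt_i k0; clear; lra.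
    by rewrite [_ - _ == 0]lt_eqF // [0 < _ - _]ltNge (ltW ni) /= addeC addNye leNye.
  + by rewrite steep // trop_val0 addNye leNye.
  + have -> : i = i0 by apply: slope_of_inj; rewrite eq_i.
    by rewrite rep0 line_oo i0E addrK /aff addeA -EFinD subrK.
- exists i0; rewrite aoo rep0 line_oo i0E addrK /aff addeA -EFinD subrK //.
Qed.

End Representation.

(** * Finite generation of R(D) *)

Section Generators.
Variables (R : realType) (G : wgraph R) (D : divisor G).
Hypothesis D_ge0 : effective D.
Implicit Types (f g : fct G) (e : edge G) (d : edge G * bool) (b : bool) (t : \bar R)
  (x : mgraph G) (v w : vertex G).
Local Notation T := (tropical R).
Local Notation index := (slope_index D).
Local Notation coord := (edge G * index + vertex G)%type.
Local Notation V := {ffun coord -> T^o}.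
Local Notation line e i := (ell (echips D e) (slope_of i)).
Implicit Types (i j : index) (a : V).

Definition trop_of (u : \bar R) : T := if u is r%:E then @Trop _ r%:E isT else 0.

Lemma trop_ofE u : u \is a fin_num -> tval (trop_of u) = u.
Proof. by case: u. Qed.

Definition coef d i : T := trop_of (line d.1 i (end_pos d)).

Lemma coefE d i : end_pos d \is a fin_num -> tval (coef d i) = line d.1 i (end_pos d).
Proof. by rewrite /coef; case: (end_pos d). Qed.

Definition edge_form d (A : pred index) a : T^o := \sum_(i | A i) coef d i *: (a (inl (d.1, i)) : T^o).

Definition end_slope d i : int := outgoing d.2 (slope_of i - chips d.2 (end_pos d) (echips D d.1)).

Definition steeper v (mu : {ffun edge G * bool -> index}) a : T^o :=
  \sum_(d | at_pt (inl v) d) edge_form d (fun i => end_slope d (mu d) < end_slope d i) a.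

Definition overflows v (mu : {ffun edge G * bool -> index}) : bool :=
  ~~ `[< at_infinity (inl v : mgraph G) >] &&
  (D (inl v) + \sum_(d | at_pt (inl v) d) end_slope d (mu d) < 0).

(* The coordinates of a function of R(D) are its values at the vertices and,
   for each edge e and slope i, the height of the supporting line of slope i.
   The last condition is the order condition at v: whatever slopes mu make the
   order at v too small, some strictly steeper line reaches the value at v. *)
Definition admissible : set V := [set a : V |
  [/\ forall d, end_pos d \is a fin_num -> a (inr (edge_end d)) = edge_form d xpredT a,
      forall e i, len e = +oo%E -> D (inl (tgt e)) + total (echips D e) < slope_of i ->
        a (inl (e, i)) = 0
    & forall v mu, overflows v mu -> (tval (a (inr v)) <= tval (steeper v mu a))%E]].

Lemma tlinear_edge_form d A : tlinear (edge_form d A).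
Proof.
by apply: tlinear_bigsum => i; apply: tlinear_scale; exact: tlinear_coord.
Qed.

Lemma tlinear_if (M : lSemiModType T) (c : bool) (p : M -> T^o) :
  tlinear p -> tlinear (fun z => if c then p z else 0).
Proof. by case: c => // _; exact: tlinear_zero. Qed.

Lemma admissible_fin_generated : cone admissible /\ fin_generated admissible.
Proof.
pose p1 d a : T^o := if end_pos d \is a fin_num then a (inr (edge_end d)) else 0.
pose q1 d a : T^o := if end_pos d \is a fin_num then edge_form d xpredT a else 0.
pose p2 (ei : edge G * index) a : T^o :=
  if (len ei.1 == +oo%E) && (D (inl (tgt ei.1)) + total (echips D ei.1) < slope_of ei.2)
  then a (inl ei) else 0.
pose p3 (vm : vertex G * {ffun edge G * bool -> index}) a : T^o :=
  if overflows vm.1 vm.2 then a (inr vm.1) else 0.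
pose q3 (vm : vertex G * {ffun edge G * bool -> index}) a : T^o :=
  if overflows vm.1 vm.2 then steeper vm.1 vm.2 a else 0.
have lp1 d : tlinear (p1 d) by apply: tlinear_if; exact: tlinear_coord.
have lq1 d : tlinear (q1 d) by apply: tlinear_if; exact: tlinear_edge_form.
have lp2 ei : tlinear (p2 ei) by apply: tlinear_if; exact: tlinear_coord.
have lz2 (ei : edge G * index) : tlinear (fun _ : V => 0 : T^o) by exact: tlinear_zero.
have lp3 vm : tlinear (p3 vm) by apply: tlinear_if; exact: tlinear_coord.
have lq3 vm : tlinear (q3 vm).
  by apply: tlinear_if; apply: tlinear_bigsum => d; exact: tlinear_edge_form.
(* The equalities are imposed as two opposite inequalities, and the vanishing of a coordinate as an
   inequality against the zero form. *)
have [c1 f1] := subcones_fin_generated (S := [set: V]) (And3 I (fun _ _ _ _ => I) (fun _ _ _ => I))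
  (setT_fin_generated R _) lp1 lq1.
have [c2 f2] := subcones_fin_generated c1 f1 lq1 lp1.
have [c3 f3] := subcones_fin_generated c2 f2 lp2 lz2.
have [c4 f4] := subcones_fin_generated c3 f3 lp3 lq3.
apply: (eq_ind _ (fun S => cone S /\ fin_generated S) (conj c4 f4)).
apply/seteqP; split=> a /=.
- move=> [[[[_ h1] h2] h3] h4]; split=> [d dfin|e i eoo ei|v mu vm].
  + apply: tval_inj; apply/le_anti; have := h1 d; have := h2 d.
    by rewrite /p1 /q1 dfin => -> ->.
  + by apply/eqP; rewrite trop_eq0 -leeNy_eq; have := h3 (e, i); rewrite /p2 /= eoo eqxx ei.
  + by have := h4 (v, mu); rewrite /p3 /q3 /= vm.
- move=> [h1 h2 h3]; split; [split; [split; [split=> // d|move=> d]|move=> [e i]]|move=> [v mu]].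
  + by rewrite /p1 /q1; case: ifP => // /h1 ->.
  + by rewrite /p1 /q1; case: ifP => // /h1 ->.
  + by rewrite /p2 /=; case: ifP => // /andP[/eqP eoo ei]; rewrite h2.
  + by rewrite /p3 /q3 /=; case: ifP => // /h3.
Qed.

(** These functions need not lie in R(D); only admissible combinations of them do. A point at
    infinity receives its value from the lines of its edge, because that value may be +oo and a
    tropical coordinate may not. *)
Definition generator (c : coord) : fct G := fun x =>
  match c, x with
  | inl (e, i), inr p => if (val p).1 == e then line e i (val p).2%:E else -oo%E
  | inl (e, i), inl w => if (w == tgt e) && (len e == +oo%E) then line e i +oo%E else -oo%E
  | inr v, inl w => if (w == v) && ~~ `[< at_infinity x >] then 0%E else -oo%E
  | inr v, inr _ => -oo%E
  end.

Definition combine a : fct G := \sum_c (a c : T) *: generator c.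

Lemma tlinear_combine : tlinear combine.
Proof.
split=> [a a'|c a].
  by rewrite /combine -big_split; apply: eq_bigr => k _; rewrite ffunE scalerDl.
by rewrite /combine scaler_sumr; apply: eq_bigr => k _; rewrite ffunE scalerA.
Qed.

Lemma fct_sumE (I : finType) (F : I -> fct G) x :
  (\sum_k F k) x = \big[Order.max/-oo%E]_k F k x.
Proof. by elim/big_rec2: _ => // k y h _ <-. Qed.

Lemma le_combine a c x : (tval (a c) + generator c x <= combine a x)%E.
Proof. by rewrite /combine fct_sumE; exact: (le_bigmax _ (fun k => (a k *: generator k) x)). Qed.

Lemma combine_attained a x : combine a x = -oo%E \/
  exists c, combine a x = (tval (a c) + generator c x)%E.
Proof.
rewrite /combine fct_sumE; elim/big_ind: _ => [|y z hy hz|c _]; [by left| |].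
  by rewrite /Order.max; case: ifP.
by right; exists c.
Qed.

Lemma combine_vertex a v : ~ at_infinity (inl v : mgraph G) -> combine a (inl v) = tval (a (inr v)).
Proof.
move=> nv; have gv : generator (inr v) (inl v) = 0%E.
  by rewrite /= eqxx /=; case: asboolP.
apply/le_anti/andP; split; last by have := le_combine a (inr v) (inl v); rewrite gv adde0.
have [->|[[[e i]|w] ->]] := combine_attained a (inl v); first by rewrite leNye.
- rewrite /=; case: ifP => [/andP[/eqP ve /eqP eoo]|_]; last by rewrite addeC addNye leNye.
  by case: nv; exists e; rewrite ve.
- rewrite [generator _ _]/=; case: ifP => [/andP[/eqP -> _]|_]; first by rewrite adde0.
  by rewrite addeC addNye leNye.
Qed.

Section Combination.
Variable a : V.
Hypothesis adm : admissible a.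

(** Values at finite vertices are coordinates of their own; the first admissibility condition makes
    them agree with the lines of every adjacent edge, so the description by lines extends to the
    closed edge. *)
Lemma combine_edge e t : (0 <= t <= len e)%E ->
  (forall i, (tval (a (inl (e, i))) + line e i t <= along (combine a) e t)%E) /\
  (along (combine a) e t = -oo%E \/
   exists i, along (combine a) e t = (tval (a (inl (e, i))) + line e i t)%E).
Proof.
have [adm1 adm2 adm3] := adm.
have atend d : d.1 = e -> end_pos d \is a fin_num ->
    (forall i, (tval (a (inl (e, i))) + line e i (end_pos d) <= along (combine a) e (end_pos d))%E) /\
    (along (combine a) e (end_pos d) = -oo%E \/
    exists i, along (combine a) e (end_pos d) = (tval (a (inl (e, i))) + line e i (end_pos d))%E).
  move=> <- dfin; have := adm1 d dfin.
  rewrite /along edge_pt_end combine_vertex; last exact/end_pos_fin.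
  move=> ->; split=> [i|].
    rewrite addeC -coefE // -trop_valM.
    exact: (@le_tsum _ _ xpredT (fun i => coef d i * a (inl (d.1, i)))).
  have [/eqP|] := eqVneq (edge_form d xpredT a) 0; first by rewrite trop_eq0 => /eqP; left.
  move=> /tsum_attained[i _ E]; right; exists i.
  by rewrite /edge_form E trop_valM coefE // addeC.
move=> /andP[t0 tl].
have [t0E|tn0] := eqVneq t 0%E; first by rewrite t0E; exact: (atend (e, false)).
have [tlE|tnl] := eqVneq t (len e).
  case E : (len e \is a fin_num); first by rewrite tlE; exact: (atend (e, true)).
  have eoo : len e = +oo%E by move: E (len_gt0 e); case: (len e).
  have tE : along (combine a) e t = combine a (inl (tgt e)) by rewrite /along tlE edge_pt_len.
  rewrite tE tlE eoo.
  have ge i : generator (inl (e, i)) (inl (tgt e)) = line e i +oo%E by rewrite /= eoo !eqxx.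
  split=> [i|]; first by rewrite -ge; exact: le_combine.
  have [->|[[[e' i]|w] ->]] := combine_attained a (inl (tgt e)); first by left.
    rewrite [generator _ _]/=; case: ifP => [/andP[/eqP ee' _]|_]; last by left; rewrite addeC addNye.
    have : at_pt (inl (tgt e)) (e', true) by rewrite /= ee'.
    by move=> /(at_infinity_dir eoo)[->]; right; exists i.
  rewrite [generator _ _]/=; case: asboolP => [_|[]]; last by exists e.
  by rewrite andbF; left; rewrite addeC addNye.
have {}t0 : (0 < t)%E by rewrite lt_neqAle t0 eq_sym tn0.
have {}tl : (t < len e)%E by rewrite lt_neqAle tl tnl.
case: t t0 tl {tn0 tnl} => [r| |] // r0 rl; last by rewrite ltNge leey in rl.
have [|p [pE vp]] := @edge_pt_interior _ _ e r; first by rewrite r0.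
rewrite /along pE.
have ge i : generator (inl (e, i)) (inr p) = line e i r%:E by rewrite /= vp eqxx.
split=> [i|]; first by rewrite -ge; exact: le_combine.
have [->|[[[e' i]|w] ->]] := combine_attained a (inr p); first by left.
  rewrite [generator _ _]/= vp; case: ifP => [/eqP <-|_]; last by left; rewrite addeC addNye.
  by right; exists i.
by left; rewrite addeC addNye.
Qed.

Lemma line_fin e i t : t \is a fin_num -> line e i t \is a fin_num.
Proof. by case: t. Qed.

Lemma vertex_edge d : end_pos d \is a fin_num ->
  a (inr (edge_end d)) != 0 <-> exists i, a (inl (d.1, i)) != 0.
Proof.
have [adm1 _ _] := adm.
move=> dfin; rewrite (adm1 d dfin); split=> [nz|[i ai]].
  have [i _ E] := tsum_attained nz; exists i; apply: contraNneq nz => ai.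
  by rewrite /edge_form E ai scaler0.
apply/negP; rewrite trop_eq0 -leeNy_eq => le0.
have := le_trans (@le_tsum _ _ xpredT (fun i => coef d i * a (inl (d.1, i))) i isT) le0.
rewrite trop_valM coefE // leeNy_eq adde_eq_ninfty -(trop_eq0 (a _)) (negPf ai) orbF.
by have := line_fin d.1 i dfin; case: (line _ _ _).
Qed.

(** Replaces a point at infinity by the finite end of its edge, so that nonvanishing can be
    propagated along paths of vertices. *)
Definition finite_vertex v : vertex G :=
  if [pick e | (tgt e == v) && (len e == +oo%E)] is Some e then src e else v.

Lemma finite_vertex_id v : ~ at_infinity (inl v : mgraph G) -> finite_vertex v = v.
Proof.
rewrite /finite_vertex => nv; case: pickP => // e /andP[/eqP ev /eqP eoo].
by case: nv; exists e; rewrite ev.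
Qed.

Lemma finite_vertex_tgt e : len e = +oo%E -> finite_vertex (tgt e) = src e.
Proof.
move=> eoo; rewrite /finite_vertex; case: pickP => [e' /andP[ee' _]|/(_ e)].
  by have [->] := at_infinity_dir (d := (e', true)) eoo ee'.
by rewrite eqxx eoo eqxx.
Qed.

(** A finite end of an edge is nonzero exactly when some line of the edge is, which links the two
    ends; connectedness does the rest. *)
Lemma vertex_nonzero_all v w :
  a (inr (finite_vertex v)) != 0 -> a (inr (finite_vertex w)) != 0.
Proof.
have step e : (a (inr (finite_vertex (src e))) != 0) = (a (inr (finite_vertex (tgt e))) != 0).
  rewrite (finite_vertex_id (@src_not_infinity _ _ e)).
  have [eoo|efin] := eqVneq (len e) +oo%E; first by rewrite finite_vertex_tgt.
  have {}efin : end_pos (e, true) \is a fin_num.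
    by move: efin (len_gt0 e); rewrite /end_pos /=; case: (len e).
  rewrite finite_vertex_id; last exact: ((end_pos_fin (e, true)).2 efin).
  have h1 := vertex_edge (d := (e, false)) isT; have h2 := vertex_edge efin.
  by apply/idP/idP => [/h1.1/h2.2|/h2.1/h1.2].
have /connectP[p] := connectedG v w.
elim: p v => [|u p IH] v /=; first by move=> _ ->.
move=> /andP[/existsP[e he] pu] wE vn; apply: IH pu wE _.
by case/orP: he => /andP[/eqP <- /eqP <-] in vn *; rewrite ?step // -step.
Qed.

Hypothesis nz : combine a <> cst -oo%E.

Lemma edge_nonzero e : exists i, a (inl (e, i)) != 0.
Proof.
have edge_src e' : (exists i, a (inl (e', i)) != 0) <-> a (inr (finite_vertex (src e'))) != 0.
  rewrite (finite_vertex_id (@src_not_infinity _ _ e')).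
  by have := vertex_edge (d := (e', false)) isT; rewrite /edge_end /=; case=> h1 h2; split.
apply/edge_src.
suff [v vn] : exists v, a (inr (finite_vertex v)) != 0 by exact: vertex_nonzero_all vn.
have [x xn] : exists x, combine a x != -oo%E.
  apply: contra_notP nz => h; apply/funext => x; apply/eqP.
  by apply/negPn/negP => xn; apply: h; exists x.
have [/eqP|[c cE]] := combine_attained a x; first by rewrite (negPf xn).
have cn : a c != 0.
  by apply: contraNneq xn => c0; rewrite cE c0 addNye.
case: c cE cn => [[e' i] _ cn|v cE cn].
  by exists (src e'); apply/edge_src; exists i.
have [vinf|/finite_vertex_id vE] := pselect (at_infinity (inl v : mgraph G)); last by exists v; rewrite vE.
move: xn; rewrite cE /=; case: x {cE} => [w|p]; last by rewrite addeC addNye.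
case: ifP => [/andP[/eqP -> /negP]|_]; last by rewrite addeC addNye.
by case; apply/asboolP.
Qed.

Lemma vertex_nonzero v : ~ at_infinity (inl v : mgraph G) -> a (inr v) != 0.
Proof.
move=> nv; have [[e _]|noedge] := pselect (exists e : edge G, True).
  have := edge_nonzero e; have [_ h] := vertex_edge (d := (e, false)) isT => /h.
  rewrite /edge_end /= -{1}(finite_vertex_id (@src_not_infinity _ _ e)).
  by move=> /(@vertex_nonzero_all _ v); rewrite finite_vertex_id.
apply/negP => /eqP v0; apply: nz; apply/funext => x.
have xE : x = inl v.
  case: x => [w|p]; last by case: noedge; exists (val p).1.
  have /connectP[[|u p] /=] := connectedG v w; first by move=> _ ->.
  by move=> /andP[/existsP[e _] _]; case: noedge; exists e.
by rewrite xE combine_vertex // v0.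
Qed.

(** Nonzero lines have affine germs, and two affine germs are always comparable on one side of [t];
    hence finitely many of them have a largest. *)
Lemma dominant_line e b t : in_dom (len e) b t -> exists i, a (inl (e, i)) != 0 /\
  nearby b t (fun u => forall i', (tval (a (inl (e, i'))) + line e i' u <= tval (a (inl (e, i))) + line e i u)%E).
Proof.
move=> dt; have [i0 i0n] := edge_nonzero e.
have heightE i : a (inl (e, i)) != 0 -> exists r : R, tval (a (inl (e, i))) = r%:E.
  rewrite trop_eq0; case: (tval _) (tval_noo (a (inl (e, i)))) => [r| |] // _ _.
  by exists r.
have germE i r : tval (a (inl (e, i))) = r%:E ->
    germ (fun u => tval (a (inl (e, i))) + line e i u)%E b t
      (r + moment b t (echips D e)) (slope_of i - chips b t (echips D e)).
  move=> rE; apply: nearbyW (ell_germ (echips D e) (slope_of i) dt) => u ->.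
  by rewrite rE /aff EFinD addeA.
suff [i [ini inn dom]] : exists i, [/\ i \in enum index, a (inl (e, i)) != 0 &
    nearby b t (fun u => forall i', i' \in enum index ->
      (tval (a (inl (e, i'))) + line e i' u <= tval (a (inl (e, i))) + line e i u)%E)].
  by exists i; split=> //; apply: nearbyW dom => u h i'; apply: h; rewrite mem_enum.
have : i0 \in enum index by rewrite mem_enum.
suff : forall r : seq index, (forall i, i \in r -> a (inl (e, i)) = 0) \/
    exists i, [/\ i \in r, a (inl (e, i)) != 0 & nearby b t (fun u => forall i', i' \in r ->
      (tval (a (inl (e, i'))) + line e i' u <= tval (a (inl (e, i))) + line e i u)%E)].
  by move=> /(_ (enum index))[h /h /eqP|//]; rewrite (negPf i0n).
elim=> [|j r IH]; first by left.
have [j0|jn] := eqVneq (a (inl (e, j))) 0.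
  case: IH => [h|[i [ir inz dom]]]; [left=> i|right; exists i; split=> //].
  - by rewrite inE => /predU1P[->|/h].
  - by rewrite inE ir orbT.
  - apply: nearbyW dom => u h i'; rewrite inE => /predU1P[->|/h //].
    by rewrite j0 trop_val0 addNye leNye.
right; case: IH => [h|[i [ir inz dom]]].
  exists j; rewrite inE eqxx; split=> //; apply: nearbyW (nearby_dom dt) => u _ i'.
  by rewrite inE => /predU1P[->|/h ->] //; rewrite trop_val0 addNye leNye.
have [ri /germE gi] := heightE i inz; have [rj /germE gj] := heightE j jn.
have [cmp|cmp] := aff_compare (ri + moment b t (echips D e)) (slope_of i - chips b t (echips D e))
  (rj + moment b t (echips D e)) (slope_of j - chips b t (echips D e)) dt.
- exists j; rewrite inE eqxx; split=> //.
  apply: nearbyW (nearby_and dom (nearby_and gi (nearby_and gj cmp))) => u [h [h1 [h2 h3]]] i'.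
  rewrite inE => /predU1P[->//|/h le1]; apply: le_trans le1 _.
  by rewrite h1 h2.
- exists i; rewrite inE ir orbT; split=> //.
  apply: nearbyW (nearby_and dom (nearby_and gi (nearby_and gj cmp))) => u [h [h1 [h2 h3]]] i'.
  rewrite inE => /predU1P[->|/h //].
  by rewrite h1 h2.
Qed.

Lemma along_combine_line e b t i : in_dom (len e) b t ->
  nearby b t (fun u => forall i', (tval (a (inl (e, i'))) + line e i' u <= tval (a (inl (e, i))) + line e i u)%E) ->
  nearby b t (fun u => along (combine a) e u = tval (a (inl (e, i))) + line e i u)%E.
Proof.
move=> dt dom; apply: nearbyW (nearby_and (nearby_dom dt) dom) => u [/combine_edge[lo up] h].
apply/le_anti; rewrite lo andbT.
by case: up => [->|[i' ->]]; rewrite ?leNye.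
Qed.

Lemma dominant_slope e b (r : R) i i' : in_dom (len e) b r%:E ->
  a (inl (e, i)) != 0 -> a (inl (e, i')) != 0 ->
  nearby b r%:E (fun u => forall i', (tval (a (inl (e, i'))) + line e i' u <= tval (a (inl (e, i))) + line e i u)%E) ->
  (tval (a (inl (e, i))) + line e i r%:E <= tval (a (inl (e, i'))) + line e i' r%:E)%E ->
  outgoing b (slope_of i' - chips b r%:E (echips D e)) <= outgoing b (slope_of i - chips b r%:E (echips D e)).
Proof.
move=> dr inz inz' dom le1.
have heightE j : a (inl (e, j)) != 0 -> exists s : R, tval (a (inl (e, j))) = s%:E.
  rewrite trop_eq0; case: (tval _) (tval_noo (a (inl (e, j)))) => [s| |] // _ _.
  by exists s.
have [s sE] := heightE i inz; have [s' sE'] := heightE i' inz'.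
have germE j z : tval (a (inl (e, j))) = z%:E ->
    germ (fun u => tval (a (inl (e, j))) + line e j u)%E b r%:E
      (z + moment b r%:E (echips D e)) (slope_of j - chips b r%:E (echips D e)).
  move=> zE; apply: nearbyW (ell_germ (echips D e) (slope_of j) dr) => u ->.
  by rewrite zE /aff EFinD addeA.
have gi := germE _ _ sE; have gi' := germE _ _ sE'.
apply: (aff_slope_le (a := s' + moment b r%:E (echips D e)) (a' := s + moment b r%:E (echips D e)) dr).
  by apply: nearbyW (nearby_and dom (nearby_and gi gi')) => u [h [<- <-]].
rewrite -(nearby_at gi) -(nearby_at gi'); apply/le_anti; rewrite le1 andbT.
exact: (nearby_at dom).
Qed.

Lemma combine_fin x : ~ at_infinity x -> combine a x \is a fin_num.
Proof.
case: x => [v nv|p _].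
  have := vertex_nonzero nv; rewrite combine_vertex // trop_eq0.
  by case: (tval _) (tval_noo (a (inr v))).
have dp : in_dom (len (val p).1) true (val p).2%:E.
  exact: (@in_dom_pos _ _ (inr p) ((val p).1, true) (eqxx _)).
have [i [inz dom]] := dominant_line dp.
have := nearby_at (along_combine_line dp dom); rewrite /along edge_pt_inr => ->.
rewrite trop_eq0 in inz; move: inz (tval_noo (a (inl ((val p).1, i)))).
by case: (tval _).
Qed.

Lemma combine_in_system : in_system D (combine a).
Proof.
split=> [x|x]; first exact: combine_fin.
have /choice[i iP] : forall d, exists i, at_pt x d -> a (inl (d.1, i)) != 0 /\
    nearby d.2 (pos x d) (fun u => forall i',
      (tval (a (inl (d.1, i'))) + line d.1 i' u <= tval (a (inl (d.1, i))) + line d.1 i u)%E).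
  move=> d; have [dx|_] := boolP (at_pt x d); last first.
    by exists ord0.
  by have [i h] := dominant_line (in_dom_pos dx); exists i.
exists (fun d => outgoing d.2 (slope_of (i d) - chips d.2 (pos x d) (echips D d.1))); split=> [d dx|].
  have [inz dom] := iP d dx.
  have gl := along_combine_line (in_dom_pos dx) dom.
  rewrite trop_eq0 in inz.
  case: (tval _) inz gl (tval_noo (a (inl (d.1, i d)))) => [r| |] //= _ gl _.
  exists (r + moment d.2 (pos x d) (echips D d.1)), (slope_of (i d) - chips d.2 (pos x d) (echips D d.1)).
  split=> //; apply: nearbyW (nearby_and gl (ell_germ (echips D d.1) (slope_of (i d)) (in_dom_pos dx))).
  by move=> u [-> ->]; rewrite /aff EFinD addeA.
case: x i iP => [v|p] i iP; last first.
  (* The line dominating on the left also passes through the value at [p], so the one dominating on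
     the right is at least as steep; the order is then at least minus the chip. *)
  rewrite sum_interior -echips_at /= chips_jump.
  set e := (val p).1; set r := (val p).2.
  have [nR domR] := iP (e, false) (eqxx _); have [nL domL] := iP (e, true) (eqxx _).
  have dR : in_dom (len e) false r%:E := in_dom_pos (eqxx _ : at_pt (inr p) (e, false)).
  have := dominant_slope dR nR nL domR (nearby_at domL _).
  by rewrite /outgoing; clear; lra.
have [[e [eoo [vE]]]|nv] := pselect (at_infinity (inl v : mgraph G)).
  (* A negative total would make the dominant line steeper than the second admissibility condition
     allows for a nonzero coordinate. *)
  subst v; rewrite sum_at_infinity //= eoo chips_all; last by apply/allP => q _; exact: ltry.
  have [inz _] := iP (e, true) (eqxx _); rewrite leNgt; apply/negP => lt0.
  have [_ adm2 _] := adm; move/eqP: inz; apply; apply: adm2 => //=.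
  by move: lt0; rewrite /outgoing; lia.
rewrite leNgt; apply/negP => lt0.
have [_ _ adm3] := adm.
(* Taking the dominant slopes themselves as [mu], admissibility provides a strictly steeper line
   through the value at [v], against dominance. *)
have := adm3 v [ffun d => i d]; rewrite /overflows; case: asboolP => //= _.
have -> : \sum_(d | at_pt (inl v) d) end_slope d ([ffun d => i d] d) =
    \sum_(d | at_pt (inl v) d) outgoing d.2 (slope_of (i d) - chips d.2 (pos (inl v) d) (echips D d.1)).
  by apply: eq_bigr => d _; rewrite ffunE.
move=> /(_ lt0) le1; have := vertex_nonzero nv => vn.
have : steeper v [ffun d => i d] a != 0.
  by apply: contraNneq vn => s0; rewrite trop_eq0 -leeNy_eq -[-oo%E]trop_val0 -s0.
move=> /[dup] sn /tsum_attained[d dx dE].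
rewrite /steeper dE in sn le1.
have [i' lt1 i'E] := tsum_attained sn.
rewrite ffunE in lt1.
have dfin : end_pos d \is a fin_num := pos_fin dx nv.
have [inz dom] := iP d dx.
have i'n : a (inl (d.1, i')) != 0.
  by apply: contraNneq sn => i'0; rewrite /edge_form i'E i'0 scaler0.
rewrite /edge_form i'E trop_valM coefE // addeC in le1.
have glv := nearby_at (along_combine_line (in_dom_pos dx) dom).
rewrite /along (edge_pt_pos dx) combine_vertex // in glv.
have [r rE] : exists r, end_pos d = r%:E by case: (end_pos d) dfin => // r; exists r.
have dr := in_dom_pos dx; rewrite (_ : pos _ d = end_pos d) // rE in dr dom glv.
have := dominant_slope dr inz i'n dom; rewrite -glv -rE => /(_ le1).
by rewrite leNgt; move: lt1; rewrite /end_slope => ->.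
Qed.

End Combination.

Definition coordinates f : V := [ffun c : coord => match c with
  | inl (e, i) => rep f e i : T
  | inr v => trop_of (f (inl v))
  end].

Lemma coordinates_admissible f : in_system D f -> admissible (coordinates f).
Proof.
move=> fS; have [ff _] := fS; split=> [d dfin|e i eoo ei|v mu].
- have [r rE] : exists r, end_pos d = r%:E by case: (end_pos d) dfin => // r; exists r.
  have dd : in_dom (len d.1) d.2 r%:E by rewrite -rE; exact: (in_dom_pos (at_pt_end d)).
  have fE : f (inl (edge_end d)) = along f d.1 r%:E by rewrite /along -rE edge_pt_end.
  have fv : f (inl (edge_end d)) \is a fin_num by apply: ff; exact/end_pos_fin.
  apply: tval_inj; rewrite ffunE trop_ofE // fE; apply/le_anti/andP; split.
    have [i [_ ->]] := rep_tangent D_ge0 fS dd.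
    apply: le_trans (@le_tsum _ _ xpredT (fun i => coef d i * (coordinates f) (inl (d.1, i))) i isT).
    by rewrite trop_valM coefE // ffunE addeC rE.
  apply: tsum_le => i _; rewrite [tval _]trop_valM coefE // ffunE addeC rE.
  by apply: rep_le => //; have /andP[] := dd.
- by rewrite ffunE; have [h _ _] := rep_infinite D_ge0 fS eoo; exact: h.
rewrite /overflows; case: asboolP => //= nv lt0.
(* The slopes of [f] satisfy the order condition and those of [mu] do not, so [f] is steeper in some
   direction; its tangent line there is the required one. *)
have [d dx lt1] : exists2 d, at_pt (inl v) d & end_slope d (mu d) < oslope f d (end_pos d).
  have ge0 : 0 <= D (inl v) + \sum_(d | at_pt (inl v) d) oslope f d (end_pos d) := system_ord (inl v) fS.
  apply/not_exists2P => no.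
  have : \sum_(d | at_pt (inl v) d) oslope f d (end_pos d) <= \sum_(d | at_pt (inl v) d) end_slope d (mu d).
    by apply: ler_sum => d dx; rewrite leNgt; apply/negP => h; case: (no d).
  by rewrite -(lerD2l (D (inl v))) => /(le_trans ge0); rewrite leNgt lt0.
have dfin : end_pos d \is a fin_num := pos_fin dx nv.
have [r rE] : exists r, end_pos d = r%:E by case: (end_pos d) dfin => // r; exists r.
have dd : in_dom (len d.1) d.2 r%:E by rewrite -rE; exact: (in_dom_pos dx).
have [i [iE fE]] := rep_tangent D_ge0 fS dd.
have {}fE : f (inl v) = (tval (rep f d.1 i) + line d.1 i r%:E)%E.
  by rewrite -fE -rE -{1}(edge_pt_pos dx).
rewrite ffunE trop_ofE; last exact: ff.
apply: le_trans (le_tsum _ dx).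
apply: (@le_trans _ _ (tval (coef d i * coordinates f (inl (d.1, i))))).
  by rewrite trop_valM coefE // ffunE rE fE addeC.
apply: (@le_tsum _ _ (fun i => end_slope d (mu d) < end_slope d i)
  (fun i => coef d i * coordinates f (inl (d.1, i)))).
rewrite [in ltRHS]/end_slope iE /cslope rE addrK outgoingK -rE.
by case: (d) lt1.
Qed.

Lemma combine_coordinates f : in_system D f -> combine (coordinates f) = f.
Proof.
move=> fS; have [ff _] := fS; have adm := coordinates_admissible fS.
have on_edge e t : (0 <= t <= len e)%E ->
    (forall i, (tval (rep f e i) + line e i t <= along f e t)%E) ->
    (exists i, along f e t = tval (rep f e i) + line e i t)%E ->
    along (combine (coordinates f)) e t = along f e t.
  move=> tl lo [i iE]; have [lo' up'] := combine_edge adm tl.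
  apply/le_anti/andP; split.
    by case: up' => [->|[i' ->]]; rewrite ?leNye // ffunE.
  by rewrite iE; have := lo' i; rewrite ffunE.
apply/funext => x.
have [[e [eoo ->]]|nx] := pselect (at_infinity x).
  rewrite -edge_pt_len -/(along _ e _) -/(along f e _).
  have [_ h1 h2] := rep_infinite D_ge0 fS eoo.
  by apply: on_edge; rewrite eoo ?leey ?lexx.
case: x nx => [v|p] nx.
  by rewrite combine_vertex // ffunE trop_ofE //; exact: ff.
rewrite -edge_pt_inr -/(along _ _ _) -/(along f _ _).
have dp : in_dom (len (val p).1) true (val p).2%:E.
  exact: (@in_dom_pos _ _ (inr p) ((val p).1, true) (eqxx _)).
have /andP[pl _] := dp.
apply: on_edge => // [i|]; first exact: rep_le.
by have [i [_ ->]] := rep_tangent D_ge0 fS dp; exists i.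
Qed.

Lemma Rspace_fin_generated : fin_generated (Rspace D).
Proof.
have [[adm0 _ _] fg] := admissible_fin_generated.
rewrite (_ : Rspace D = combine @` admissible); first exact: image_fin_generated tlinear_combine fg.
apply/seteqP; split=> [f /RspaceP[->|fS]|_ [a adm <-]].
- by exists 0 => //; exact: tlinear0 tlinear_combine.
- by exists (coordinates f); [exact: coordinates_admissible|exact: combine_coordinates].
- apply/RspaceP; have [->|nz] := pselect (combine a = cst -oo%E); first by left.
  by right; exact: combine_in_system.
Qed.

End Generators.

(** * Isometries *)

Section Lipschitz.
Variables (R : realType) (G : wgraph R).
Implicit Types (e : edge G) (d : edge G * bool) (b : bool) (x y : mgraph G) (v w : vertex G)
  (phi : mgraph G -> R) (r s t u : R).

Definition lipschitz1 phi := forall e s t, (0 <= s%:E <= len e)%E -> (0 <= t%:E <= len e)%E ->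
  `|phi (edge_pt e s%:E) - phi (edge_pt e t%:E)| <= `|s - t|.

(** Telescoping over the segments of a chain; a nondegenerate segment with an end at +oo is
    infinitely long and imposes nothing on [phi]. *)
Lemma lipschitz_dist phi x y : lipschitz1 phi -> (`|phi x - phi y|%:E <= dist x y)%E.
Proof.
move=> lip; apply: le_ereal_inf_tmp => _ [c /= cxy <-].
elim: c x cxy => [|[[e s] t] c IH] x /=; first by move=> ->; rewrite big_nil subrr normr0.
move=> [se te -> /IH]; rewrite big_cons /= => le1.
apply: (@le_trans _ _ (`|phi (edge_pt e s) - phi (edge_pt e t)|%:E + `|phi (edge_pt e t) - phi y|%:E)%E).
  by rewrite -EFinD lee_fin ler_distD.
apply: leeD le1; rewrite /seg_len; have [->|st] := eqVneq s t; first by rewrite subrr normr0.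
case: s t se te st => [s| |] [t| |] //= se te st; rewrite ?leey //.
by rewrite lee_fin; exact: lip.
Qed.

Lemma dist_edge_le e (s t : R) : (0 <= s%:E <= len e)%E -> (0 <= t%:E <= len e)%E ->
  (dist (edge_pt e s%:E) (edge_pt e t%:E) <= `|s - t|%:E)%E.
Proof.
move=> se te; apply: ereal_inf_lbound; exists [:: (e, s%:E, t%:E)] => //=.
rewrite big_cons big_nil adde0 /= /seg_len; case: eqP => // -[->].
by rewrite subrr normr0.
Qed.

Lemma edge_pt_inl e (s : R) v : (0 <= s%:E <= len e)%E -> edge_pt e s%:E = inl v ->
  exists b, v = edge_end (e, b) /\ end_pos (e, b) = s%:E.
Proof.
move=> /andP[s0 sl].
have [->|sn0] := eqVneq s 0; first by rewrite edge_pt0 => -[<-]; exists false.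
have [sE|snl] := eqVneq s%:E (len e).
  by rewrite sE edge_pt_len => -[<-]; exists true.
have [|p [-> //]] := @edge_pt_interior _ _ e s.
by rewrite !lt_neqAle s0 sl snl eqe eq_sym sn0.
Qed.

(** No real parameter reaches [x], so the function equal to [K] at [x] and 0 elsewhere is
    1-Lipschitz for every [K]. *)
Lemma dist_at_infinity x y : at_infinity x -> x <> y -> dist x y = +oo%E.
Proof.
move=> xinf xy.
have key (K : R) : 0 <= K -> (K%:E <= dist x y)%E.
  move=> K0; pose phi z := if z == x then K else 0.
  have -> : K%:E = `|phi x - phi y|%:E.
    rewrite /phi eqxx; case: eqP => [/esym//|_]; by rewrite subr0 ger0_norm.
  apply: lipschitz_dist => e s t se te.
  have phi0 (u : R) : (0 <= u%:E <= len e)%E -> phi (edge_pt e u%:E) = 0.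
    move=> /in_dom_ex[b /in_dom_not_infinity nx]; rewrite /phi; case: eqP => // ux.
    by case: nx; rewrite ux.
  by rewrite !phi0 // subrr normr0.
case: (dist x y) key => [z| //|] key; last by have := key 0 (lexx 0).
have K0 : 0 <= `|z| + 1 by rewrite addr_ge0.
by have := key _ K0; rewrite lee_fin leNgt ltr_pwDr // ler_norm.
Qed.

Lemma distxx x : (dist x x <= 0)%E.
Proof. by apply: ereal_inf_lbound; exists [::] => //=; rewrite big_nil. Qed.

End Lipschitz.

(** * Small stars around a finite point *)

Section Stars.
Variables (R : realType) (G : wgraph R) (x : mgraph G).
Hypothesis x_fin : ~ at_infinity x.
Implicit Types (o : option (edge G * bool)) (e : edge G) (d : edge G * bool) (b : bool) (y : mgraph G) (v w : vertex G)
  (r s t u : R).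

Let posr d : R := fine (pos x d).

Lemma posrE d : at_pt x d -> pos x d = (posr d)%:E.
Proof. by move=> dx; rewrite fineK //; exact: pos_fin. Qed.

Definition ray_pos d s : R := if d.2 then posr d - s else posr d + s.
Definition ray d s : mgraph G := edge_pt d.1 (ray_pos d s)%:E.
Definition reach d : \bar R := if d.2 then pos x d else (len d.1 - pos x d)%E.

Lemma ray0 d : at_pt x d -> ray d 0 = x.
Proof.
move=> dx; rewrite /ray /ray_pos addr0 subr0 if_same -posrE //; exact: edge_pt_pos.
Qed.

Lemma reach_gt0 d : at_pt x d -> (0 < reach d)%E.
Proof.
move=> dx; have /andP[_] := in_dom_pos dx; rewrite /reach; case: d.2 => //.
by rewrite sube_gt0.
Qed.

Lemma ray_pos_in d s : at_pt x d -> 0 <= s -> (s%:E <= reach d)%E ->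
  (0 <= (ray_pos d s)%:E <= len d.1)%E.
Proof.
move=> dx s0; have /andP[/andP[p0 pl] _] := in_dom_pos dx.
rewrite /reach /ray_pos; move: p0 pl; rewrite posrE //; case: d.2.
  rewrite !lee_fin => p0 pl sp; rewrite subr_ge0 sp /=.
  by apply: le_trans pl; rewrite lee_fin gerBl.
rewrite leeBrDr // => p0 pl; rewrite -EFinD addrC => ->.
by rewrite lee_fin addr_ge0.
Qed.

(** With the factor 4, a point within [rho] of one end of a loop is at least [3 * rho] away from the
    other end, and this is the distance at which a decreasing [profile] is back at [rho]. *)
Definition star_radius rho := 0 < rho /\ forall d, at_pt x d -> ((4 * rho)%:E <= reach d)%E.

Lemma ex_star_radius : exists rho, star_radius rho.
Proof.
have /choice[r rP] : forall d, exists r : R, 0 < r /\ (at_pt x d -> (r%:E <= reach d)%E).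
  move=> d; have [dx|_] := boolP (at_pt x d); last by exists 1.
  have := reach_gt0 dx; case: (reach d) => [r| |] // r0; first by exists r.
  by exists 1; rewrite leey.
exists ((\big[Num.min/1]_d r d) / 4); split.
  have : 0 < \big[Num.min/1]_d r d.
    by apply/bigmin_gtP; split=> // d _; have [] := rP d.
  by lra.
move=> d dx; have [_ /(_ dx)] := rP d; apply: le_trans; rewrite lee_fin.
by rewrite mulrC divfK // bigmin_le_cond.
Qed.

Variable rho : R.
Hypothesis rhoP : star_radius rho.

Let rho0 : 0 < rho := rhoP.1.

(* A 1-Lipschitz function which is the distance to x, truncated at rho, except
   that it is decreasing along the beginning of the ray o, if any. *)
Definition profile (c : bool) s : R := if c then `|s - rho| - rho else `|s|.
(** Coordinate along the ray [d] with origin [x]; it is negative behind [x], which occurs when [x]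
    is interior to the edge. *)
Definition signed d u : R := if d.2 then posr d - u else u - posr d.
Definition on_edge (o : option (edge G * bool)) e u : R :=
  \big[Num.min/rho]_(d | at_pt x d && (d.1 == e)) profile (Some d == o) (signed d u).
Definition star_fun o y : R :=
  match y with
  | inl v => if y == x then 0 else rho
  | inr p => on_edge o (val p).1 (val p).2
  end.

Lemma profile_lip c s t : `|profile c s - profile c t| <= `|s - t|.
Proof.
rewrite /profile; case: c.
  have := ler_dist_dist (s - rho) (t - rho).
  by rewrite (_ : s - rho - (t - rho) = s - t) 1?(_ : `|s - rho| - rho - _ = `|s - rho| - `|t - rho|); lra.
exact: ler_dist_dist.
Qed.

Lemma profile_far c s : 3 * rho <= `|s| -> rho <= profile c s.
Proof.
rewrite /profile; case: c => h; last by have := rho0; lra.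
have := lerB_dist s rho; rewrite (gtr0_norm rho0) => h'; lra.
Qed.

Lemma on_edge_lip o e s t : `|on_edge o e s - on_edge o e t| <= `|s - t|.
Proof.
apply: (big_ind2 (fun a b : R => `|a - b| <= `|s - t|)).
- by rewrite subrr normr0.
- move=> a1 a2 b1 b2; rewrite !ler_norml => /andP[h1 h2] /andP[h3 h4].
  by case: (leP a1 b1); case: (leP a2 b2) => ? ?; apply/andP; split; lra.
- move=> d _; apply: le_trans (profile_lip _ _ _) _.
  rewrite /signed; case: d.2; last by rewrite (_ : s - posr d - (t - posr d) = s - t) //; lra.
  by rewrite -normrN (_ : - (posr d - s - (posr d - t)) = s - t) //; lra.
Qed.

Lemma bigmin_eq (I : finType) (P : pred I) (F : I -> R) (z m : R) : m <= z ->
  (forall i, P i -> m <= F i) -> m = z \/ (exists2 i, P i & F i = m) ->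
  \big[Num.min/z]_(i | P i) F i = m.
Proof.
move=> mz mF h; apply/le_anti/andP; split; last exact/bigmin_geP.
case: h => [->|[i Pi <-]]; first exact: bigmin_le_id.
exact: bigmin_le_cond.
Qed.

Lemma signed_end d e b (u : R) : at_pt x d -> d.1 = e -> end_pos (e, b) = u%:E ->
  inl (edge_end (e, b)) = x /\ d = (e, b) /\ signed d u = 0 \/ 4 * rho <= `|signed d u|.
Proof.
case: d => _ b' /[swap] /= -> dx bE.
have /posrE := dx; have := rhoP.2 _ dx; rewrite /reach /signed /=.
case xE : x => [v|p] far pE; last first.
  right; have nx b0 : at_pt x (e, b0) by move: dx; rewrite xE.
  have posrb b0 : posr (e, b0) = posr (e, b') by rewrite /posr xE.
  have := rhoP.2 _ (nx true); have := rhoP.2 _ (nx false); rewrite /reach /= !posrE //.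
  rewrite !posrb lee_fin; have -> : (if b' then posr (e, b') - u else u - posr (e, b')) =
    (if b' then 1 else -1) * (posr (e, b') - u) by case: (b'); lra.
  rewrite normrM (_ : `|if b' then 1 else -1| = 1) ?mul1r; last by case: (b'); rewrite ?normrN normr1.
  move: bE; rewrite /end_pos /=; case: (b) => uE; rewrite ?uE ?lee_fin.
    by rewrite -normrN => h _; apply: le_trans (ler_norm _); lra.
  by move: uE => [<-] _ h; apply: le_trans (ler_norm _); lra.
have {pE} pE : end_pos (e, b') = (posr (e, b'))%:E by rewrite -pE.
have [bb|bb] := eqVneq b' b.
  left; subst b'; have [uE] : u%:E = (posr (e, b))%:E :> \bar R by rewrite -bE -pE.
  move: dx; rewrite xE /= => /eqP <-; split=> //; split=> //.
  by rewrite uE subrr if_same.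
right; apply: le_trans (ler_norm _).
move: bb bE pE far; rewrite /end_pos /=; case: (b'); case: (b) => //= _.
  by move=> [<-] ->; rewrite lee_fin subr0.
by move=> -> [<-]; rewrite sube0 lee_fin subr0.
Qed.

(** Two directions on one edge are the two sides of an interior point or the two ends of a loop. *)
Lemma opposite_ray d d' s : at_pt x d -> at_pt x d' -> d'.1 = d.1 -> d' != d -> 0 <= s <= rho ->
  signed d' (ray_pos d s) = - s \/ 3 * rho <= signed d' (ray_pos d s).
Proof.
case: d d' => [e b] [e' b'] /= dx dx' ee; subst e'; rewrite xpair_eqE eqxx /= => bb /andP[s0 sr].
have /posrE := dx; have /posrE := dx'; have := rhoP.2 _ dx; have := rhoP.2 _ dx'.
rewrite /reach /signed /ray_pos /=.
case xE : x => [v|p] /=.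
  case: (b) (b') bb => -[] //= _ far far' pE pE'.
    rewrite pE' lee_fin in far'; right.
    by move: pE => [<-]; lra.
  rewrite pE lee_fin in far; right.
  by move: pE' => [<-]; lra.
have -> : posr (e, b') = posr (e, b) by rewrite /posr xE.
by case: (b) (b') bb => -[] //= _ _ _ _ _; left; lra.
Qed.

Lemma star_fun_edge o e u : (0 <= u%:E <= len e)%E ->
  star_fun o (edge_pt e u%:E) = on_edge o e u.
Proof.
move=> ue; case E : (edge_pt e u%:E) => [v|p]; last first.
  have /andP[u0 ul] := ue.
  have [u0'|un0] := eqVneq u 0; first by move: E; rewrite u0' edge_pt0.
  have [uE|unl] := eqVneq u%:E (len e); first by move: E; rewrite uE edge_pt_len.
  have [|p' [pE' vp']] := @edge_pt_interior _ _ e u.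
    by rewrite !lt_neqAle u0 ul unl eqe eq_sym un0.
  by move: pE'; rewrite E => -[->]; rewrite /star_fun vp'.
have [b [vE bE]] := edge_pt_inl ue E.
rewrite /star_fun; apply/esym/bigmin_eq.
- by case: ifP => _ //; exact: ltW.
- move=> d /andP[dx /eqP de].
  have [[xE [dE ->]]|far] := signed_end dx de bE.
    rewrite vE xE eqxx /profile sub0r normrN normr0 (gtr0_norm rho0) subrr.
    by case: ifP.
  have far' : 3 * rho <= `|signed d u| by have := rho0; lra.
  by apply: le_trans (profile_far _ far'); case: ifP => _ //; exact: ltW.
case: eqP => [vx|_]; last by left.
right; have dx : at_pt x (e, b) by rewrite -vx vE at_pt_end.
exists (e, b); first by rewrite dx /= eqxx.
have [[_ [_ ->]]|] := signed_end dx erefl bE.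
  rewrite /profile sub0r normrN normr0 (gtr0_norm rho0) subrr.
  by case: ifP.
have pE : pos x (e, b) = u%:E by rewrite -bE -vx.
have -> : signed (e, b) u = 0 by rewrite /signed /posr pE /= subrr if_same.
by rewrite normr0; have := rho0; lra.
Qed.

Lemma star_fun_lip o : lipschitz1 (star_fun o).
Proof. by move=> e s t se te; rewrite !star_fun_edge //; exact: on_edge_lip. Qed.

Lemma le_reach d s : at_pt x d -> 0 <= s <= rho -> (s%:E <= reach d)%E.
Proof.
move=> dx /andP[s0 sr]; apply: le_trans (rhoP.2 _ dx).
by rewrite lee_fin; have := rho0; lra.
Qed.

Lemma star_fun_ray o d s : at_pt x d -> 0 <= s <= rho ->
  star_fun o (ray d s) = if Some d == o then - s else s.
Proof.
move=> dx /[dup] srho /andP[s0 sr].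
rewrite star_fun_edge; last by apply: ray_pos_in => //; exact: le_reach.
have sdE : signed d (ray_pos d s) = s by rewrite /signed /ray_pos; case: d.2; lra.
have prE c : profile c s = if c then - s else s.
  rewrite /profile; case: c; last exact: ger0_norm.
  by rewrite ler0_norm ?subr_le0 //; lra.
apply: bigmin_eq.
- by case: ifP => _ //; have := rho0; lra.
- move=> d' /andP[dx' /eqP ed]; have [->|dd] := eqVneq d' d; first by rewrite sdE prE.
  have sle : (if Some d == o then - s else s) <= s by case: ifP => _ //; lra.
  apply: le_trans sle _.
  have [->|far] := opposite_ray dx dx' ed dd srho.
    rewrite /profile normrN (ger0_norm s0) (_ : - s - rho = - (s + rho)); last by lra.
    by rewrite normrN ger0_norm; [case: ifP => _ //; lra|lra].
  by apply: le_trans sr _; apply: profile_far; apply: le_trans far (ler_norm _).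
- by right; exists d; rewrite ?dx ?eqxx // sdE prE.
Qed.

Lemma star_fun_center o : star_fun o x = 0.
Proof.
have [[v xE]|[d dx]] := pt_cases x; first by rewrite /star_fun {1}xE xE eqxx.
rewrite -{1}(ray0 dx) star_fun_ray ?lexx ?ltW //.
by case: ifP; rewrite ?oppr0.
Qed.

Lemma ball_ray y : (dist x y < rho%:E)%E -> y = x \/ exists d s,
  [/\ at_pt x d, 0 < s < rho & y = ray d s].
Proof.
move=> /(le_lt_trans (lipschitz_dist x y (star_fun_lip None))).
rewrite star_fun_center sub0r normrN lte_fin => /(le_lt_trans (ler_norm _)).
case: y => [v|p]; first by rewrite /star_fun; case: eqP => [->|_]; [left|rewrite ltxx].
rewrite /star_fun /on_edge; set e := (val p).1; set u := (val p).2.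
move=> lt1; have [d /andP[dx /eqP de] sm] : exists2 d, at_pt x d && (d.1 == e) & `|signed d u| < rho.
  apply/not_exists2P => no; move: lt1; rewrite ltNge => /negP; apply.
  apply/bigmin_geP; split=> // d dP; rewrite /= leNgt; apply/negP => h.
  by case: (no d).
have yE : inr p = edge_pt e u%:E by rewrite edge_pt_inr.
have [s0|s0|s0] := ltgtP (signed d u) 0.
(* Behind [x] the point lies on the opposite ray; a vertex has nothing behind it on this edge, so
   [x] is interior. *)
- right; exists (opposite d), (- signed d u).
  rewrite oppr_gt0 s0 -(ltr0_norm s0) sm.
  case xE : x => [v|q].
    exfalso; move: s0 (posrE dx); rewrite /signed xE /= de; have := valP p.
    rewrite -/e -/u; case: d.2 => /andP[u0 ul] s0 pE.
      by move: ul; rewrite pE lte_fin; lra.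
    by move: pE s0 u0 => [<-]; rewrite lte_fin; lra.
  have dx' : at_pt x (opposite d) by move: dx; rewrite xE.
  rewrite -xE; split=> //; rewrite yE /ray /opposite /= de; congr (edge_pt _ _%:E).
  rewrite ltr0_norm // /ray_pos /= /signed /posr xE /=.
  by case: d.2 => /=; lra.
- rewrite gtr0_norm // in sm.
  right; exists d, (signed d u); rewrite s0 sm; split=> //.
  rewrite yE /ray de; congr (edge_pt _ _%:E).
  by rewrite /ray_pos /signed; case: d.2; lra.
- left; rewrite yE -[RHS](ray0 dx) /ray de; congr (edge_pt _ _%:E).
  by move: s0; rewrite /ray_pos /signed; case: d.2; lra.
Qed.

Lemma dist_ray d s : at_pt x d -> 0 <= s <= rho -> dist x (ray d s) = s%:E.
Proof.
move=> dx /[dup] srho /andP[s0 sr]; apply/le_anti/andP; split; last first.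
  have := lipschitz_dist x (ray d s) (star_fun_lip None).
  by rewrite star_fun_center star_fun_ray // sub0r normrN ger0_norm.
rewrite -{1}(ray0 dx).
have h0 : (0 <= (ray_pos d 0)%:E <= len d.1)%E.
  by apply: ray_pos_in => //; apply: le_reach => //; rewrite lexx ltW.
have hs : (0 <= (ray_pos d s)%:E <= len d.1)%E.
  by apply: ray_pos_in => //; exact: le_reach.
apply: le_trans (dist_edge_le h0 hs) _; rewrite lee_fin /ray_pos.
by case: d.2; rewrite ler_norml; apply/andP; split; lra.
Qed.

(** The test function attached to [d] is [- s] on the ray [d] and [s'] on the other one. *)
Lemma rays_apart d d' s s' : at_pt x d -> at_pt x d' -> 0 <= s <= rho -> 0 <= s' <= rho ->
  d != d' -> ((s + s')%:E <= dist (ray d s) (ray d' s'))%E.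
Proof.
move=> dx dx' srho srho' dd.
have := lipschitz_dist (ray d s) (ray d' s') (star_fun_lip (Some d)).
rewrite !star_fun_ray // eqxx (inj_eq Some_inj) eq_sym (negPf dd); apply: le_trans.
rewrite lee_fin -normrN; apply: le_trans (ler_norm _); lra.
Qed.

Lemma dist_same_ray d s s' : at_pt x d -> 0 <= s <= rho -> 0 <= s' <= rho ->
  (dist (ray d s) (ray d s') <= `|s - s'|%:E)%E.
Proof.
move=> dx srho srho'.
have hs : (0 <= (ray_pos d s)%:E <= len d.1)%E.
  by apply: ray_pos_in => //; [case/andP: srho|exact: le_reach].
have hs' : (0 <= (ray_pos d s')%:E <= len d.1)%E.
  by apply: ray_pos_in => //; [case/andP: srho'|exact: le_reach].
apply: le_trans (dist_edge_le hs hs') _; rewrite lee_fin /ray_pos.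
case: d.2; last by rewrite (_ : posr d + s - (posr d + s') = s - s') //; lra.
by rewrite -normrN (_ : - (posr d - s - (posr d - s')) = s - s') //; lra.
Qed.

Lemma has_slope_ray (f : fct G) d m : at_pt x d -> has_slope f x d m <->
  exists c r, 0 < r /\ forall s, 0 <= s <= r -> f (ray d s) = (c + m%:~R * s)%:E.
Proof.
move=> dx; split.
  move=> [a [k [[w [sw hw]] ->]]].
  have [r [sr br]] := side_pick (in_dom_pos dx) sw.
  rewrite posrE // in hw sr br.
  exists (a + k%:~R * posr d), `|r - posr d|.
  have rp : r != posr d.
    by move: sr; rewrite /side; case: d.2; rewrite lte_fin lt_neqAle => /andP[]; rewrite // eq_sym.
  split=> [|s /andP[s0 sr']]; first by rewrite normr_gt0 subr_eq0.
  rewrite /ray /ray_pos; have := hw (ray_pos d s)%:E.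
  rewrite /along /ray_pos /outgoing.
  case: d.2 sr br sr' {hw} => /=; rewrite !lte_fin => sr /andP[b1 b2] sr' hw.
    rewrite ltr0_norm ?subr_lt0 // in sr'.
    rewrite hw; first by rewrite aff_fin rmorphN /=; congr _%:E; lra.
    by rewrite lee_fin gerBl s0 andbT; apply: le_trans b1 _; rewrite lee_fin; lra.
  rewrite gtr0_norm ?subr_gt0 // in sr'.
  rewrite hw; first by rewrite aff_fin; congr _%:E; lra.
  by rewrite lee_fin lerDl s0 /=; apply: le_trans _ b2; rewrite lee_fin; lra.
move=> [c [r [r0 fE]]].
exists (c - (outgoing d.2 m)%:~R * posr d), (outgoing d.2 m); rewrite outgoingK; split=> //.
exists (ray_pos d r)%:E; split.
  by rewrite posrE // /ray_pos; case: d.2; rewrite /= lte_fin ?gtrBl ?ltrDl.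
move=> u; rewrite posrE // /ray_pos /along => bu.
have [s [uE s0 sr]] : exists s, [/\ u = (ray_pos d s)%:E, 0 <= s & s <= r].
  rewrite /ray_pos; case: d.2 bu; rewrite /=; case: u => [u| |]; rewrite ?leye_eq ?leeNy_eq ?andbF // !lee_fin => /andP[h1 h2].
    by exists (posr d - u); split; [congr _%:E| |]; lra.
  by exists (u - posr d); split; [congr _%:E| |]; lra.
rewrite uE -/(ray d s) fE ?s0 // aff_fin /ray_pos /outgoing.
by case: d.2; rewrite ?rmorphN /=; congr _%:E; lra.
Qed.

End Stars.

(** * Local form of isometries at finite points and at infinity *)

Section Isometries.
Variables (R : realType) (G : wgraph R).
Implicit Types (f : fct G) (e : edge G) (d : edge G * bool) (x y : mgraph G) (v w : vertex G)
  (sigma : mgraph G -> mgraph G) (r s t u : R).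

Lemma ex_direction e x : exists d, at_pt x d.
Proof.
have [[v ->]|//] := pt_cases x.
have /connectP[[|u p] /=] := connectedG v (src e).
  by move=> _ <-; exists (e, false); rewrite /= eqxx.
move=> /andP[/existsP[e' /orP[]/andP[/eqP sv /eqP tv]] _ _].
  by exists (e', false); rewrite /= sv.
by exists (e', true); rewrite /= tv.
Qed.

(** A finite point with an edge has points at positive finite distance, a point at infinity has
    none. *)
Lemma isometry_at_infinity sigma sigma' x : isometric sigma -> cancel sigma' sigma ->
  at_infinity x -> at_infinity (sigma x).
Proof.
move=> [_ iso] sK xinf; apply: contrapT => sx.
have [e _] := xinf; have [d dx] := ex_direction e (sigma x).
have [rho rhoP] := ex_star_radius (sigma x); have rho0 := rhoP.1.
have dy : dist (sigma x) (ray (sigma x) d rho) = rho%:E.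
  by apply: (dist_ray sx rhoP) => //; rewrite lexx ltW.
have xy : x <> sigma' (ray (sigma x) d rho).
  move=> xE; have sxE : sigma x = ray (sigma x) d rho by rewrite {1}xE sK.
  by move: dy; rewrite -sxE => dy; have := distxx (sigma x); rewrite dy leNgt lte_fin rho0.
by have := dist_at_infinity xinf xy; rewrite -iso sK dy.
Qed.

Lemma isometry_star sigma x : isometric sigma -> injective sigma ->
  ~ at_infinity x -> ~ at_infinity (sigma x) ->
  exists r (tau : edge G * bool -> edge G * bool), [/\ 0 < r,
    forall d, at_pt x d -> at_pt (sigma x) (tau d),
    forall d d', at_pt x d -> at_pt x d' -> tau d = tau d' -> d = d' &
    forall d s, at_pt x d -> 0 <= s <= r -> sigma (ray x d s) = ray (sigma x) (tau d) s].
Proof.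
move=> [_ iso] inj xf sxf.
have [rho rhoP] := ex_star_radius x; have rho0 := rhoP.1.
have [rho' rhoP'] := ex_star_radius (sigma x); have rho0' := rhoP'.1.
(* Halving gives [r < rho'], since [ball_ray] asks for a strict bound. *)
pose r := Num.min rho rho' / 2.
have m0 : 0 < Num.min rho rho' by rewrite lt_min rho0.
have m1 : Num.min rho rho' <= rho by rewrite ge_min lexx.
have m2 : Num.min rho rho' <= rho' by rewrite ge_min lexx orbT.
have r0 : 0 < r by rewrite /r; lra.
have rrho : r <= rho by rewrite /r; lra.
have rrho' : r < rho' by rewrite /r; lra.
have step d s : exists d', at_pt x d -> 0 < s <= r ->
    at_pt (sigma x) d' /\ sigma (ray x d s) = ray (sigma x) d' s.
  have [dx|_] := boolP (at_pt x d); last by exists d.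
  have [/andP[s0 sr]|_] := boolP (0 < s <= r); last by exists d.
  have ds : dist (sigma x) (sigma (ray x d s)) = s%:E.
    by rewrite iso (dist_ray xf rhoP) // ltW //= (le_trans sr).
  have [|rx|[d' [s' [dx' /andP[s0' sr'] rE]]]] := ball_ray sxf rhoP' (y := sigma (ray x d s)).
  - by rewrite ds lte_fin (le_lt_trans sr).
  - by move: ds; rewrite rx => ds; have := distxx (sigma x); rewrite ds lee_fin leNgt s0.
  - exists d' => _ _; split=> //; rewrite rE; congr ray.
    move: ds; rewrite rE (dist_ray sxf rhoP') //; last by rewrite !ltW.
    by case.
have /choice[tau tauP] := fun d => step d r.
have {tauP} tauP d (dx : at_pt x d) := tauP d dx (introT andP (conj r0 (lexx r))).
have in_rho s : 0 <= s <= r -> 0 <= s <= rho.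
  by move=> /andP[-> sr]; exact: le_trans rrho.
have in_rho' s : 0 <= s <= r -> 0 <= s <= rho'.
  by move=> /andP[-> sr]; exact: le_trans (ltW rrho').
have rr : 0 <= r <= r by rewrite lexx ltW.
exists r, tau; split=> // [d dx|d d' dx dx' dd|d s dx /[dup] sr /andP[s0 _]].
- by have [] := tauP d dx.
- apply/eqP/negPn/negP => nd.
  have [_ h1] := tauP d dx; have [_ h2] := tauP d' dx'.
  have rE : ray x d r = ray x d' r by apply: inj; rewrite h1 h2 dd.
  have := rays_apart xf rhoP dx dx' (in_rho _ rr) (in_rho _ rr) nd.
  by rewrite rE => /le_trans/(_ (distxx _)); rewrite lee_fin; lra.
- have [tx h1] := tauP d dx.
  move: s0; rewrite le_eqVlt => /predU1P[<-|s0]; first by rewrite !ray0.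
  have [d' h] := step d s; have [|dx' h2] := h dx.
    by rewrite s0; case/andP: sr.
  (* Switching to another image ray would put the images at distance at least [s + r], while the
     points themselves are at most [r - s] apart. *)
  rewrite h2; have [-> //|nd] := eqVneq d' (tau d).
  have := rays_apart sxf rhoP' dx' tx (in_rho' _ sr) (in_rho' _ rr) nd.
  rewrite -h1 -h2 iso => /le_trans/(_ (dist_same_ray xf rhoP dx (in_rho _ sr) (in_rho _ rr))).
  case/andP: sr => _ sr.
  rewrite lee_fin distrC ger0_norm ?subr_ge0 // leNgt => /negP; case.
  by rewrite (@lt_le_trans _ _ r) ?gtrBl // lerDr ltW.
Qed.

Definition edge_coord e y : R := if y is inr p then if (val p).1 == e then (val p).2 else 0 else 0.

Lemma edge_coordE e u : len e = +oo%E -> 0 <= u -> edge_coord e (edge_pt e u%:E) = u.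
Proof.
move=> eoo; rewrite le_eqVlt => /predU1P[<-|u0]; first by rewrite edge_pt0.
have [|p [-> vp]] := @edge_pt_interior _ _ e u; first by rewrite eoo lte_fin u0 ltry.
by rewrite /= vp eqxx.
Qed.

Lemma edge_coord_lip e : len e = +oo%E -> lipschitz1 (edge_coord e).
Proof.
move=> eoo e' s t se te; have [ee|ee] := eqVneq e' e.
  by subst e'; rewrite !edge_coordE //; [case/andP: te|case/andP: se].
have z u : edge_coord e (edge_pt e' u%:E) = 0.
  rewrite /edge_coord /edge_pt; case: insubP => [p _ vp|_] //.
  by rewrite vp /= (negPf ee).
by rewrite !z subrr normr0.
Qed.

Lemma dist_infinite_edge e s t : len e = +oo%E -> 0 <= s -> 0 <= t ->
  dist (edge_pt e s%:E) (edge_pt e t%:E) = `|s - t|%:E.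
Proof.
move=> eoo s0 t0; apply/le_anti/andP; split.
  by apply: dist_edge_le; rewrite eoo leey lee_fin ?s0 ?t0.
have := lipschitz_dist (edge_pt e s%:E) (edge_pt e t%:E) (edge_coord_lip eoo).
by rewrite !edge_coordE.
Qed.

Definition infinity_nbhd e (T : R) : set (mgraph G) := [set y | match y with
  | inl w => w = tgt e
  | inr p => (val p).1 = e /\ T < (val p).2
  end].

Lemma infinity_nbhd_open e T : len e = +oo%E -> 0 <= T -> open (infinity_nbhd e T).
Proof.
move=> eoo T0; change (mgraph_open (infinity_nbhd e T)) => e' t te Ut.
have [ee|ee] := eqVneq e' e; last first.
  exfalso; move: Ut; rewrite /edge_pt; case: insubP => [p _ vp /=|_ /=].
    by rewrite vp => -[] /eqP; rewrite (negPf ee).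
  case: ifP => _ h.
    by have := at_infinity_dir (d := (e', false)) eoo; rewrite /= h eqxx => /(_ isT).
  have := at_infinity_dir (d := (e', true)) eoo; rewrite /= h eqxx => /(_ isT)[] /eqP.
  by rewrite (negPf ee).
subst e'.
have far (s : \bar R) : (T%:E < s)%E -> infinity_nbhd e T (edge_pt e s).
  case: s => [s| |] // Ts; last by rewrite -eoo edge_pt_len.
  rewrite lte_fin in Ts.
  have [|p [-> vp]] := @edge_pt_interior _ _ e s; first by rewrite eoo ltry lte_fin (le_lt_trans T0).
  by rewrite /infinity_nbhd /= vp.
have Tt : (T%:E < t)%E.
  move: te Ut; case: t => [t| |] //; last by rewrite ltry.
  move=> /andP[]; rewrite lee_fin le_eqVlt => /predU1P[<-|t0] _.
    rewrite edge_pt0 /= => h.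
    by have := at_infinity_dir (d := (e, false)) eoo; rewrite /= h eqxx => /(_ isT).
  have [|p [-> vp]] := @edge_pt_interior _ _ e t; first by rewrite eoo ltry lte_fin t0.
  by rewrite /infinity_nbhd /= vp lte_fin => -[].
have : \forall s \near t, (T%:E < s)%E.
  case: t {te Ut} Tt => [t| |] // Tt.
    exact: (nbhs_open_ereal_gt (f := fun=> T)).

  by exists T; split=> //; rewrite num_real.
by apply: filterS => s Ts _; exact: far.
Qed.

(** Continuity at the leaf sends far points of [e] far out on [e']. There the distance to the image
    [h1] of the point [M + 1] leaves two candidates, and images beyond [h1] select the
    translation. *)
Lemma isometry_end sigma e e' : isometric sigma -> injective sigma ->
  len e = +oo%E -> len e' = +oo%E -> sigma (inl (tgt e)) = inl (tgt e') ->
  exists s0 shift : R, 0 <= s0 /\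
    forall s, s0 < s -> 0 < s + shift /\ sigma (edge_pt e s%:E) = edge_pt e' (s + shift)%:E.
Proof.
move=> [cont iso] inj eoo eoo' se.
have far T : 0 <= T -> exists M : R, 0 <= M /\ forall s, M < s ->
    exists2 h : R, T < h & sigma (edge_pt e s%:E) = edge_pt e' h%:E.
  move=> T0.
  have op : open (sigma @^-1` infinity_nbhd e' T).
    by apply: open_comp (infinity_nbhd_open eoo' T0) => x _; exact: cont.
  have tin : (0 <= (+oo : \bar R) <= len e)%E by rewrite eoo !leey.
  have := (op : mgraph_open (sigma @^-1` infinity_nbhd e' T)) e +oo%E tin; rewrite /= -{1}eoo edge_pt_len se => /(_ erefl).
  move=> [M [_ hM]]; exists (Num.max 0 M); rewrite le_max lexx; split=> // s.
  rewrite gt_max => /andP[s0 Ms].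
  have := hM s%:E; rewrite lte_fin Ms => /(_ isT).
  rewrite eoo leey lee_fin (ltW s0) => /(_ isT).
  case E : (sigma (edge_pt e s%:E)) => [w|p] /=.
    move=> wE; move: E; rewrite wE -se => /inj.
    by have [|p [-> _]] := @edge_pt_interior _ _ e s; first by rewrite eoo ltry lte_fin s0.
  by move=> [pe Tp]; exists (val p).2 => //; rewrite -pe edge_pt_inr.
have [M [M0 hM]] := far 0 (lexx 0).
have M1 : M < M + 1 by rewrite ltrDl.
have [h1 h10 h1E] := hM _ M1.
have [M' [M0' hM']] := far h1 (ltW h10).
exists (Num.max (M + 1) M'), (h1 - (M + 1)); split=> [|s].
  by rewrite le_max M0' orbT.
rewrite gt_max => /andP[Ms Ms']; have [h hh hE] := hM' s Ms'.
have := dist_infinite_edge eoo (_ : 0 <= s) (_ : 0 <= M + 1).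
rewrite -iso hE h1E dist_infinite_edge ?(ltW h10) ?(ltW (lt_trans h10 hh)) //.
have s0 : 0 <= s by apply: le_trans M0' (ltW Ms').
have M10 : 0 <= M + 1 by rewrite addr_ge0.
move=> /(_ s0 M10) [].
rewrite !gtr0_norm ?subr_gt0 // => sE.
have -> : s + (h1 - (M + 1)) = h by rewrite addrCA -sE addrC subrK.
by rewrite (lt_trans h10 hh).
Qed.

Lemma isometry_end_slope sigma e e' f m : isometric sigma -> injective sigma ->
  len e = +oo%E -> len e' = +oo%E -> sigma (inl (tgt e)) = inl (tgt e') ->
  has_slope f (inl (tgt e')) (e', true) m -> has_slope (f \o sigma) (inl (tgt e)) (e, true) m.
Proof.
move=> iso inj eoo eoo' se [a [k [[w [/= sw hw]] ->]]]; rewrite eoo' in sw hw.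
have [s0 [shift [s00 sE]]] := isometry_end iso inj eoo eoo' se.
exists (a + k%:~R * shift), k; split=> //=; rewrite eoo.
have [W wW] : exists W : R, (w <= W%:E)%E.
  by case: w sw {hw} => [W| |] //= _; [exists W|exists 0; rewrite leNye].
exists (Num.max (s0 + 1) (W - shift))%:E; split; first by rewrite /side ltry.
case=> [s| |] /=; last by [].
  rewrite leey andbT lee_fin ge_max => /andP[h1 h2].
  have [|_ E] := sE s; first by lra.
  rewrite /along /= E -/(along f e' _) hw; last first.
    by rewrite /= leey andbT; apply: le_trans wW _; rewrite lee_fin; lra.
  by rewrite !aff_fin; congr _%:E; lra.
move=> _; rewrite /along /= -eoo edge_pt_len se -edge_pt_len -/(along f e' _) eoo' hw; last first.
  by rewrite /= lexx leey.
(* The shift changes the intercept by [k * shift], which vanishes for [k = 0], the only case where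
   the intercept matters at +oo. *)
by rewrite eoo !aff_oo; case: eqP => // ->; rewrite mul0r addr0.
Qed.

Lemma isometry_slopes sigma sigma' x : isometric sigma -> isometric sigma' ->
  cancel sigma sigma' -> cancel sigma' sigma ->
  exists tau : edge G * bool -> edge G * bool,
  [/\ forall d, at_pt x d -> at_pt (sigma x) (tau d),
      forall d d', at_pt x d -> at_pt x d' -> tau d = tau d' -> d = d' &
      forall f d m, at_pt x d -> has_slope f (sigma x) (tau d) m -> has_slope (f \o sigma) x d m].
Proof.
move=> iso iso' sK sK'; have inj := can_inj sK.
have [xinf|xf] := pselect (at_infinity x).
  have [e [eoo xE]] := xinf; have [e' [eoo' xE']] := isometry_at_infinity iso sK' xinf.
  rewrite xE in xE' *; exists (fun=> (e', true)); rewrite xE'; split=> [d _|d d'|f d m].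
  - by rewrite /= eqxx.
  - by move=> /(at_infinity_dir eoo) -> /(at_infinity_dir eoo) ->.
  - by move=> /(at_infinity_dir eoo) ->; exact: isometry_end_slope.
have sxf : ~ at_infinity (sigma x).
  by move=> /(isometry_at_infinity iso' sK); rewrite sK.
have [r [tau [r0 tx tinj tE]]] := isometry_star iso inj xf sxf.
exists tau; split=> // f d m dx /(has_slope_ray sxf f m (tx d dx))[c [r' [r0' fE]]].
apply/(has_slope_ray xf) => //.
exists c, (Num.min r r'); split=> [|s]; first by rewrite lt_min r0.
rewrite le_min => /andP[s0 /andP[sr sr']].
by rewrite /= tE ?s0 // fE ?s0.
Qed.

Lemma in_system_comp (D : mgraph G -> int) sigma sigma' f : isometric sigma -> isometric sigma' ->
  cancel sigma sigma' -> cancel sigma' sigma -> (forall x, D (sigma x) = D x) ->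
  in_system D f -> in_system D (f \o sigma).
Proof.
move=> iso iso' sK sK' Ds [ff fl]; split=> [x nx|x].
  by apply: ff => /(isometry_at_infinity iso' sK); rewrite sK.
have [tau [tx tinj tslope]] := isometry_slopes x iso iso' sK sK'.
have [tau' [tx' tinj' _]] := isometry_slopes (sigma x) iso' iso sK' sK.
rewrite sK in tx'.
have [m [fm mD]] := fl (sigma x).
exists (fun d => m (tau d)); split=> [d dx|]; first by apply: tslope => //; exact: fm (tx d dx).
pose A := [set d | at_pt x d]%SET; pose B := [set d | at_pt (sigma x) d]%SET.
have injA : {in A &, injective tau} by move=> d d'; rewrite !inE; exact: tinj.
have injB : {in B &, injective tau'} by move=> d d'; rewrite !inE; exact: tinj'.
(* Injections in both directions between finite sets make [tau] a bijection, without identifying its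
   inverse. *)
have AB : [set tau d | d in A]%SET = B.
  apply/eqP; rewrite eqEcard; apply/andP; split.
    by apply/fintype.subsetP => _ /imsetP[d dA ->]; rewrite inE in dA; rewrite inE; exact: tx.
  rewrite card_in_imset // -(card_in_imset injB); apply: subset_leq_card.
  by apply/fintype.subsetP => _ /imsetP[d dB ->]; rewrite inE in dB; rewrite inE; exact: tx'.
rewrite -Ds; apply: le_trans mD _; rewrite lerD2l.
rewrite (eq_bigl (mem B)); last by move=> d; rewrite /= inE.
rewrite [leRHS](eq_bigl (mem A)); last by move=> d; rewrite /= inE.
by rewrite -AB big_imset.
Qed.

End Isometries.

(** * Invariant functions *)

Section Symmetrization.
Variables (R : realType) (G : wgraph R) (K : finGroupType) (to : {action K &-> mgraph G}).
Implicit Types (f g : fct G) (x : mgraph G) (sigma : K).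

(* The library states these two for actions on finite types only. *)
Lemma action_mul x sigma sigma' : to x (sigma * sigma')%g = to (to x sigma) sigma'.
Proof.
have [_ actM] : is_action [set: K]%SET to by case: (to).
by apply: actM; rewrite inE.
Qed.

Lemma action1 x : to x 1%g = x.
Proof.
have [inj _] : is_action [set: K]%SET to by case: (to).
by apply: (inj 1%g); rewrite -action_mul mulg1.
Qed.

Definition translate f sigma : fct G := fun x => f (to x sigma).
Definition symmetrize f : fct G := \sum_(sigma : K) translate f sigma.

Lemma tlinear_symmetrize : tlinear symmetrize.
Proof.
split=> [f g|a f]; first by rewrite /symmetrize -big_split.
by rewrite /symmetrize scaler_sumr.
Qed.

Lemma symmetrize_invariant f : K_invariant to (symmetrize f).
Proof.
move=> sigma x; rewrite /symmetrize !fct_sumE (reindex_inj (mulgI sigma^-1%g)) /=.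
by apply: eq_bigr => s _; rewrite /translate -action_mul mulgA mulgV mul1g.
Qed.

(** A tropical sum of copies of [f] is [f], by idempotency; the group provides at least one copy. *)
Lemma symmetrize_id f : K_invariant to f -> symmetrize f = f.
Proof.
move=> finv; have fE sigma : translate f sigma = f by apply/funext => x; exact: finv.
rewrite /symmetrize (eq_bigr (fun=> f)) => [|sigma _]; last exact: fE.
apply: semimod_le_anti.
  by apply: sum_semimod_le => _; exact: semimod_addxx.
exact: (semimod_le_sum (fun=> f) (1%g : K)).
Qed.

Lemma symmetrize_Rspace (D : divisor G) f : isometric_action to -> K_invariant to D ->
  Rspace D f -> Rspace D (symmetrize f).
Proof.
move=> iso Dinv fD; apply: cone_sum (Rspace_cone D) _ => sigma.
move: fD => /RspaceP[->|fS]; first by right.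
apply/RspaceP; right.
apply: (in_system_comp (sigma := to^~ sigma) (sigma' := to^~ (sigma^-1)%g) (iso _) (iso _)) fS.
- by move=> x; rewrite -action_mul mulgV action1.
- by move=> x; rewrite -action_mul mulVg action1.
- exact: Dinv.
Qed.

End Symmetrization.

Lemma RspaceK_cone (R : realType) (G : wgraph R) (K : finGroupType)
    (to : {action K &-> mgraph G}) (D : divisor G) : cone (RspaceK to D).
Proof.
have [S0 SD SZ] := Rspace_cone D; split.
- by split=> // sigma x.
- move=> f g [fD fK] [gD gK]; split; first exact: SD.
  by move=> sigma x; rewrite [LHS]/GRing.add /= /fct_add fK gK.
- move=> a f [fD fK]; split; first exact: SZ.
  by move=> sigma x; rewrite [LHS]/GRing.scale /= /fct_scale fK.
Qed.

Lemma RspaceK_fin_generated (R : realType) (G : wgraph R) (K : finGroupType)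
    (to : {action K &-> mgraph G}) (D : divisor G) :
  isometric_action to -> K_invariant to D -> effective D -> fin_generated (RspaceK to D).
Proof.
move=> iso Dinv D0; rewrite (_ : RspaceK to D = symmetrize to @` Rspace D).
  exact: image_fin_generated (tlinear_symmetrize to) (Rspace_fin_generated D0).
apply/seteqP; split=> [f [fD fK]|_ [f fD <-]].
  by exists f => //; exact: symmetrize_id.
by split; [exact: symmetrize_Rspace|exact: symmetrize_invariant].
Qed.

Theorem theorem1p0p4 (R : realType) (G : wgraph R) (K : finGroupType)
    (to : {action K &-> mgraph G}) (hK : isometric_action to)
    (D : divisor G) (hDK : K_invariant to D) (hD : effective D) :
  GRing.subsemimod_closed [in RspaceK to D] /\ fin_generated (RspaceK to D).
Proof.
split; last exact: RspaceK_fin_generated.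
have [S0 SD SZ] := RspaceK_cone to D.
split; first split.
- exact: mem_set.
- by move=> f g /set_mem fD /set_mem gD; apply: mem_set; exact: SD.
- by move=> a f /set_mem fD; apply: mem_set; exact: SZ.
Qed.
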